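(* Let $G$ be a connected graph on $n$ vertices with $m$ edges, clique number $\omega$ and second largest adjacency eigenvalue $\rho_2$. Then the following hold. (i) If $n\ge5$ is odd, then $|\rho_2|\cdot\omega\le m-2$, with equality if and only if $G$ is composed of $K_{\frac{n+1}2}$ and $K_{\frac{n-1}2}$ linked by an edge, or of $K_{\frac{n-1}2}$ and $K_{\frac{n-1}2}$ linked by a path. (ii) If $n\ge2$ is even, then, among all connected graphs on $n$ vertices, $|\rho_2|\cdot\omega-m$ is maximized if and only if $G$ is composed of two copies of $K_{\frac n2}$ linked by an edge.
   Context: All graphs are finite, simple and undirected. The adjacency eigenvalues of $G$ are $\rho_1\ge\rho_2\ge\cdots\ge\rho_n$. ''$K_a$ and $K_b$ linked by an edge'' means the graph obtained from the disjoint union of the complete graphs $K_a$ and $K_b$ by adding one edge between a vertex of $K_a$ and a vertex of $K_b$. ''$K_{\frac{n-1}{2}}$ and $K_{\frac{n-1}{2}}$ linked by a path'' means the graph of order $n$ obtained from two disjoint copies of $K_{\frac{n-1}2}$ by adding one new vertex $z$ and two edges joining $z$ to one vertex of each copy (so the linking path has length two). *)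

(* Defs.v *)
From HB Require Import structures.
From mathcomp Require Import all_boot all_order all_algebra.
From mathcomp Require Import polyrcf reals.

Set Implicit Arguments.
Unset Strict Implicit.
Unset Printing Implicit Defensive.

Import Order.TTheory GRing.Theory Num.Theory.

Local Open Scope ring_scope.

Record sgraph := SGraph {
  vertex :> finType;
  edge : rel vertex;
  edge_sym : symmetric edge;
  edge_irr : irreflexive edge
}.

Definition connected_graph (G : sgraph) : Prop :=
  (0 < #|G|)%N /\ forall x y : G, connect (@edge G) x y.

Definition edge_set (G : sgraph) : {set {set G}} :=
  [set E : {set G} | [exists x, exists y, edge x y && (E == [set x; y])]].

Definition nb_edges (G : sgraph) : nat := #|edge_set G|.

Definition is_clique (G : sgraph) (S : {set G}) : bool :=
  [forall x in S, forall y in S, (x != y) ==> edge x y].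

Definition clique_number (G : sgraph) : nat :=
  \max_(S : {set G} | is_clique S) #|S|.

Definition graph_iso (G H : sgraph) : Prop :=
  exists f : G -> H, bijective f /\ forall x y : G, edge (f x) (f y) = edge x y.

Definition adjacency (R : nzRingType) (G : sgraph) : 'M[R]_#|G| :=
  \matrix_(i, j) (edge (enum_val i) (enum_val j))%:R.

(* All eigenvalues in R, in nonincreasing order, each one repeated according
   to its algebraic multiplicity. *)
Definition eigenvalues (R : rcfType) (n : nat) (A : 'M[R]_n) : seq R :=
  sort >=%R (flatten [seq nseq (mup x (char_poly A)) x
                     | x <- rootsR (char_poly A)]).

(* The indices of the mathematical sequence rho_1 >= rho_2 >= ... >= rho_n
   start at 1, those of nth at 0; the value is only meaningful when G has at
   least two vertices. *)
Definition rho2 (R : rcfType) (G : sgraph) : R :=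
  (eigenvalues (adjacency R G))`_1.

Lemma count_mem_eigenvalues (R : rcfType) (n : nat) (A : 'M[R]_n) (x : R) :
  count_mem x (eigenvalues A) = mup x (char_poly A).
Proof.
have p0 : char_poly A != 0 by rewrite monic_neq0 ?char_poly_monic.
rewrite /eigenvalues; set p := char_poly A in p0 *.
have /permP-> := permEl (perm_sort >=%R (flatten [seq nseq (mup y p) y | y <- rootsR p])).
rewrite count_flatten -map_comp.
have -> : map (count_mem x \o (fun y => nseq (mup y p) y)) (rootsR p)
    = [seq (if y == x then mup x p else 0)%N | y <- rootsR p].
  apply: eq_map => y /=; rewrite count_nseq /=.
  by case: eqVneq => [->|_]; rewrite ?mul1n ?mul0n.
have us : uniq (rootsR p) by exact: uniq_roots.
rewrite sumnE big_map -big_mkcond /= big_const_seq iter_addn_0 count_uniq_mem //.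
have -> : (x \in rootsR p) = root p x.
  by rewrite -(roots_on_rootsR p0) in_itv.
by case: (boolP (root p x)) => [|/mupNroot ->]; rewrite ?muln1 ?mul0n.
Qed.

(* K_a and K_b, with the additional edge between u in K_a and v in K_b. *)
Section LinkedByEdge.
Variables (a b : nat) (u : 'I_a) (v : 'I_b).

Definition link_edge_rel : rel ('I_a + 'I_b) := fun x y =>
  match x, y with
  | inl i, inl j => i != j
  | inr i, inr j => i != j
  | inl i, inr j => (i == u) && (j == v)
  | inr j, inl i => (i == u) && (j == v)
  end.

Lemma link_edge_sym : symmetric link_edge_rel.
Proof. by move=> [i|i] [j|j] //=; rewrite eq_sym. Qed.

Lemma link_edge_irr : irreflexive link_edge_rel.
Proof. by move=> [i|i] /=; rewrite eqxx. Qed.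

Definition link_edge : sgraph := SGraph link_edge_sym link_edge_irr.
End LinkedByEdge.

(* Two disjoint copies of K_k; the new vertex z is None, adjacent to u in the
   first copy and to v in the second one. *)
Section LinkedByPath.
Variables (k : nat) (u v : 'I_k).

Definition link_path_rel : rel (option ('I_k + 'I_k)) := fun x y =>
  match x, y with
  | Some (inl i), Some (inl j) => i != j
  | Some (inr i), Some (inr j) => i != j
  | None, Some (inl i) | Some (inl i), None => i == u
  | None, Some (inr i) | Some (inr i), None => i == v
  | _, _ => false
  end.

Lemma link_path_sym : symmetric link_path_rel.
Proof. by move=> [[i|i]|] [[j|j]|] //=; rewrite eq_sym. Qed.

Lemma link_path_irr : irreflexive link_path_rel.
Proof. by move=> [[i|i]|] //=; rewrite eqxx. Qed.

Definition link_path : sgraph := SGraph link_path_sym link_path_irr.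
End LinkedByPath.

Definition cliques_linked_by_edge (G : sgraph) (a b : nat) : Prop :=
  exists (u : 'I_a) (v : 'I_b), graph_iso G (link_edge u v).

Definition cliques_linked_by_path (G : sgraph) (k : nat) : Prop :=
  exists u v : 'I_k, graph_iso G (link_path u v).

(* Main.v *)
Require Import Defs.
From mathcomp Require Import all_boot all_order all_algebra.
From mathcomp Require Import reals complex spectral ring lra zify.

Import Order.TTheory GRing.Theory Num.Theory.

Set Implicit Arguments.
Unset Strict Implicit.
Unset Printing Implicit Defensive.

Local Open Scope ring_scope.

(* Let rho = rho2 > 0, let j be its integer ceiling, and let x be an eigenvector for rho
   taking both signs, scaled so that its maximum x u is 1. Counting the walks of length
   two from u inside the positive part P shows that twice the number of edges of P is
   rho ^+ 2 + j plus non-negative excess terms (Stanley's bound); the same holds for the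
   negative part N. If the clique number om is at most j, the bounds for P and N suffice;
   if om >= j + 3, delete the edges of a maximum clique K: on the side where K sums to
   at most 0, x is still a subsolution, so Stanley's bound applies to what is left. For
   om = j + 1 or om = j + 2, either every maximum clique meets both P and N, and then it
   has many edges between the two, or, up to the sign of x, some maximum clique K avoids
   P and one adds the edges of K, those of P and those attaching P to the rest. The
   excess terms then force P to be a clique, which yields the extremal graphs, except
   when a single edge attaches K of size j + 1 to P: there the exact form of the excess
   compares G with two copies of K_(j + 1) linked by an edge, whose second eigenvalue is
   j - tp with tp the root in (0, 1) of tp ^+ 2 - (j + 2) * tp + 1. Lower bounds for rho2
   come from test vectors supported on the two cliques. *)

(** * Spectrum of real symmetric matrices *)

(** Write rho = j - th with 0 <= th < 1. A clique of order om sharing no edge with a part that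
    carries Stanley's rho^2 + j edge ends has the surplus (om - rho)^2 - (om - j) over 2 rho om, to
    be compared with 4. For om = j + s it is (s + th)^2 - s: at least 6 for s >= 3, 2 + 4 th + th^2
    for s = 2, 2 th + th^2 for s = 1. Hence two edge ends across settle s = 2 and four settle s = 1,
    with equality only for th = 0: these are the two extremal families of odd order. A single edge
    across with s = 1 leaves 2 + 2 th + th^2, which can stay below 4. This obstacle is real, since
    the bound m - 2 fails for two copies of K_(j + 1) linked by an edge. There K is eliminated from
    the eigenvalue equations, and the edges missing in P are weighed against the drop of rho that
    they cause. The ceiling j enters because the degree of u inside P is an integer that is at least
    rho. *)

Lemma mup_prod_XsubC (F : fieldType) (x : F) (s : seq F) :
  mup x (\prod_(a <- s) ('X - a%:P)) = count_mem x s.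
Proof.
elim: s => [|a s IHs]; first by rewrite big_nil mupNroot // root1.
have nz : \prod_(b <- s) ('X - b%:P) != 0 :> {poly F}.
  by rewrite monic_neq0 // monic_prod_XsubC.
rewrite big_cons mupM ?polyXsubC_eq0 // IHs /=.
by have := mup_XsubCX 1 x a; rewrite expr1 => ->; rewrite eq_sym; case: eqP.
Qed.

Lemma char_poly_similar (F : fieldType) n (P A : 'M[F]_n) :
  P \in unitmx -> char_poly (invmx P *m A *m P) = char_poly A.
Proof.
move=> Pu; rewrite /char_poly /char_poly_mx.
have -> : 'X%:M - map_mx polyC (invmx P *m A *m P) =
    map_mx polyC (invmx P) *m ('X%:M - map_mx polyC A) *m map_mx polyC P.
  rewrite mulmxBr mulmxBl !map_mxM; congr (_ - _).
  by rewrite mul_mx_scalar -scalemxAl -map_mxM mulVmx // map_mx1 scalemx1.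
rewrite !det_mulmx mulrAC -det_mulmx -map_mxM mulVmx // map_mx1 det1 mul1r.
by [].
Qed.

Section RealSymmetric.
Variable R : rcfType.
Local Notation C := R[i].
Local Notation toC := (real_complex R).
Local Open Scope sesquilinear_scope.

(** Seen in [R[i]] the matrix is hermitian, hence unitarily diagonalizable with a real diagonal. The
    factorization of the characteristic polynomial descends to [R], while [P] stays complex. *)
Lemma symmetric_spectral n (A : 'M[R]_n) : A^T = A ->
  exists (P : 'M[C]_n) (r : 'I_n -> R), [/\ P \is unitarymx,
    map_mx toC A = P^t* *m diag_mx (\row_i (r i)%:C%C) *m P &
    char_poly A = \prod_i ('X - (r i)%:P)].
Proof.
move=> symA; pose B := map_mx toC A.
have hB : B \is hermsymmx.
  apply/is_hermitianmxP; rewrite expr0 scale1r; apply/matrixP => i j.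
  by rewrite !mxE -[in LHS]symA mxE; rewrite conj_Creal // complex_real.
have dr := hermitian_spectral_diag_real hB.
have /orthomx_spectralP eB := hermitian_normalmx hB.
set P := spectralmx B in eB; set D := spectral_diag B in eB dr.
have uP : P \is unitarymx by exact: spectral_unitarymx.
have eD : D = \row_i (complex.Re (D 0 i))%:C%C.
  apply/rowP => i; rewrite mxE RRe_real //.
  by move/mxOverP: dr => ->.
exists P, (fun i => complex.Re (D 0 i)); split => //.
  by rewrite -eD -invmx_unitary.
apply: (map_poly_inj toC); rewrite map_char_poly -/B eB.
rewrite char_poly_similar ?unitarymx_unit // char_poly_trig; last first.
  by apply/is_trig_mxP => i j ij; rewrite mxE -val_eqE /= ltn_eqF ?mulr0n.
rewrite rmorph_prod; apply: eq_bigr => i _.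
rewrite rmorphB /= map_polyX map_polyC /= mxE eqxx mulr1n.
by congr (_ - _%:P); rewrite {1}eD mxE.
Qed.

(** Links the sorted list [eigenvalues] to the unordered diagonal [r]: two sorted lists with the
    same multiplicities agree. Indices are compared rather than values because the two largest
    values may coincide. *)
Lemma eigenvalues_top2 n (A : 'M[R]_n) (r : 'I_n -> R) : (1 < n)%N ->
  char_poly A = \prod_i ('X - (r i)%:P) ->
  exists i0 i1, [/\ i0 != i1, r i0 = (eigenvalues A)`_0,
    r i1 = (eigenvalues A)`_1, forall i, i != i0 -> r i <= (eigenvalues A)`_1 &
    (eigenvalues A)`_1 <= (eigenvalues A)`_0].
Proof.
move=> n1 eA; pose s := sort (relpre r >=%R) (enum 'I_n).
have ss : size s = n by rewrite size_sort size_enum_ord.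
have es : eigenvalues A = [seq r i | i <- s].
  apply: (@sorted_eq _ >=%R).
  - by move=> y x z /= h1 h2; apply: le_trans h2 h1.
  - by move=> x y /= /andP[h1 h2]; apply/eqP; rewrite eq_le h1 h2.
  - by apply: sort_sorted => x y; apply: le_total.
  - by rewrite sorted_map; apply: sort_sorted => x y; apply: le_total.
  have pr : perm_eq [seq r i | i <- s] [seq r i | i <- enum 'I_n].
    by apply: perm_map; rewrite perm_sort.
  apply: (perm_trans _ (_ : perm_eq [seq r i | i <- enum 'I_n] _)); last first.
    by rewrite perm_sym.
  apply/allP => x _; apply/eqP; rewrite count_mem_eigenvalues eA.
  by rewrite -mup_prod_XsubC big_map big_enum.
have us : uniq s by rewrite sort_uniq enum_uniq.
have ms i : i \in s by rewrite mem_sort mem_enum.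
have srt : sorted >=%R (eigenvalues A).
  by apply: sort_sorted => x y; apply: le_total.
case: s ss es us ms => [|i0 [|i1 s]] ss es us ms; try by exfalso; move: n1; rewrite -{1}ss.
exists i0, i1; rewrite es /=; split => //.
- by move: us; rewrite /= inE negb_or -andbA => /andP[].
- move=> i ii0; move: (ms i); rewrite !inE (negPf ii0) /= => /orP[/eqP -> //|si].
  move: srt; rewrite es /= => /andP[_]; rewrite (path_sortedE) /=; last first.
    by move=> y x z /= h1 h2; apply: le_trans h2 h1.
  by case/andP => /allP/(_ (r i)) /= h _; apply: h; apply: map_f.
- by move: srt; rewrite es /= => /andP[].
Qed.

(** The cross terms i (v A u^T - u A v^T) cancel because A is symmetric, so a complex test vector
    amounts to the pair of its real and imaginary parts. *)
Lemma real_form n (A : 'M[R]_n) (u v : 'rV[R]_n) : A^T = A ->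
  let w := map_mx toC u + 'i%C *: map_mx toC v in
  w *m map_mx toC A *m w^t* = map_mx toC (u *m A *m u^T + v *m A *m v^T).
Proof.
move=> symA w.
have wt : w^t* = map_mx toC u^T - 'i%C *: map_mx toC v^T.
  apply/matrixP => i j; rewrite !mxE rmorphD rmorphM /=.
  have cR (a : R) : (toC a)^* = toC a by rewrite conj_Creal // complex_real.
  rewrite !cR.
  have -> : ('i%C : C)^* = - 'i%C.
    by apply/eqP; rewrite eq_complex /= oppr0 !eqxx.
  by rewrite mulNr.
have sw : v *m A *m u^T = u *m A *m v^T.
  have -> : v *m A *m u^T = (v *m A *m u^T)^T.
    by apply/matrixP => i j; rewrite [RHS]mxE !ord1.
  by rewrite !trmx_mul trmxK symA mulmxA.
rewrite wt mulmxBr !mulmxDl -!scalemxAl -!scalemxAr -!map_mxM sw.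
rewrite map_mxD scalerA -expr2 sqr_i scaleN1r opprD opprK.
by rewrite addrA addrK.
Qed.

(** In the eigenbasis the form is a weighted sum of the [r i], and the coordinate along [i0], the
    only index where [r i] may exceed [e], vanishes. *)
Lemma complex_form_le n (A : 'M[R]_n) (P : 'M[C]_n) (r : 'I_n -> R) e i0
    (w : 'rV[C]_n) : P \is unitarymx ->
  map_mx toC A = P^t* *m diag_mx (\row_i (r i)%:C%C) *m P ->
  (forall i, i != i0 -> r i <= e) -> (w *m P^t*) 0 i0 = 0 ->
  (w *m map_mx toC A *m w^t*) 0 0 <= e%:C%C * (w *m w^t*) 0 0.
Proof.
move=> uP eA le_e c0; pose c := w *m P^t*.
have ct : c^t* = P *m w^t* by rewrite /c trmx_mul map_mxM trmxCK.
have -> : w *m w^t* = c *m c^t*.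
  rewrite ct /c mulmxA -[_ *m _ *m P]mulmxA.
  have -> : P^t* *m P = 1%:M by rewrite -invmx_unitary // mulVmx ?unitarymx_unit.
  by rewrite mulmx1.
have -> : w *m map_mx toC A *m w^t* = c *m diag_mx (\row_i (r i)%:C%C) *m c^t*.
  by rewrite ct eA /c !mulmxA.
rewrite !mxE mulr_sumr; apply: ler_sum => i _.
rewrite mul_mx_diag !mxE -!mulrA mulrCA.
case: (eqVneq i i0) => [->|ii0].
  move: c0; rewrite -/c => c0.
  have -> : \sum_j w 0 j * P^t* j i0 = c 0 i0 by rewrite /c mxE.
  by rewrite c0 !(mul0r, mulr0).
by apply: ler_wpM2r; rewrite ?mul_conjC_ge0 // lecR le_e.
Qed.

Lemma mx_ReIm n (w : 'rV[C]_n) :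
  w = map_mx toC (map_mx (@complex.Re R) w) +
      'i%C *: map_mx toC (map_mx (@complex.Im R) w).
Proof. by apply/matrixP => i j; rewrite !mxE -complexE. Qed.

Lemma real_norm n (u v : 'rV[R]_n) :
  let w := map_mx toC u + 'i%C *: map_mx toC v in
  w *m w^t* = map_mx toC (u *m u^T + v *m v^T).
Proof.
move=> w; have /= := real_form u v (@trmx1 R n).
by rewrite -/w map_mx1 !mulmx1.
Qed.

Lemma sqr_row_gt0 n (u : 'rV[R]_n) : u != 0 -> 0 < (u *m u^T) 0 0.
Proof.
move=> u0; rewrite lt_neqAle; apply/andP; split; last first.
  by rewrite mxE sumr_ge0 // => i _; rewrite mxE -expr2 sqr_ge0.
apply: contraNneq u0 => /esym/eqP; rewrite mxE psumr_eq0; last first.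
  by move=> i _; rewrite mxE -expr2 sqr_ge0.
move=> /allP h; apply/eqP/rowP => i; rewrite mxE.
have := h i (mem_index_enum _).
by rewrite mxE mulf_eq0 orbb => /eqP.
Qed.

(** Courant-Fischer on the plane of [a] and [b]: some nonzero complex combination is orthogonal to
    the top eigenvector, and its real and imaginary parts still lie in the real plane, where the
    form is bounded below by hypothesis. *)
Lemma second_eigenvalue_ge n (A : 'M[R]_n) (a b : 'rV[R]_n) lam :
  (1 < n)%N -> A^T = A ->
  (forall al be : R, al *: a + be *: b = 0 -> al = 0 /\ be = 0) ->
  (forall al be : R, let w := al *: a + be *: b in
     lam * (w *m w^T) 0 0 <= (w *m A *m w^T) 0 0) ->
  lam <= (eigenvalues A)`_1.
Proof.
move=> n1 symA fr le_lam.
have [P [r [uP eA cpA]]] := symmetric_spectral symA.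
have [i0 [i1 [_ _ _ le_e _]]] := eigenvalues_top2 n1 cpA.
pose pr (c : 'rV[R]_n) := (map_mx toC c *m P^t*) 0 i0.
have [al [be [nz pr0]]] : exists al be : C, (al != 0) || (be != 0) /\
    al * pr a + be * pr b = 0.
  have [pa0|pa0] := eqVneq (pr a) 0; last first.
    by exists (pr b), (- pr a); rewrite oppr_eq0 pa0 orbT mulNr mulrC subrr.
  by exists 1, 0; rewrite oner_eq0 pa0 mulr0 mul0r addr0.
pose w := al *: map_mx toC a + be *: map_mx toC b.
pose u := complex.Re al *: a + complex.Re be *: b.
pose v := complex.Im al *: a + complex.Im be *: b.
have ew : w = map_mx toC u + 'i%C *: map_mx toC v.
  apply/rowP => i; rewrite !mxE {1}[al]complexE {1}[be]complexE.
  by rewrite !rmorphD !rmorphM /=; ring.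
have w0 : (w *m P^t*) 0 i0 = 0.
  by rewrite mulmxDl -!scalemxAl !mxE; rewrite /pr !mxE in pr0.
have := complex_form_le uP eA le_e w0; rewrite ew real_form // real_norm.
rewrite [X in X <= _]mxE [X in _ <= _ * X]mxE -rmorphM lecR => hle.
have hge : lam * (u *m u^T + v *m v^T) 0 0 <= (u *m A *m u^T + v *m A *m v^T) 0 0.
  rewrite [X in lam * X]mxE [X in _ <= X]mxE mulrDr.
  by apply: lerD; apply: le_lam.
have gt0 : 0 < (u *m u^T + v *m v^T) 0 0.
  have [u0|u0] := eqVneq u 0; have [v0|v0] := eqVneq v 0.
  - exfalso; have [a0 b0] := fr _ _ u0; have [a1 b1] := fr _ _ v0.
    by move: nz; rewrite !eq_complex a0 b0 a1 b1 /= !eqxx.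
  - by rewrite u0 mul0mx add0r sqr_row_gt0.
  - by rewrite v0 mul0mx addr0 sqr_row_gt0.
  - by rewrite mxE addr_gt0 // sqr_row_gt0.
by rewrite -(ler_pM2r gt0); apply: le_trans hge hle.
Qed.

Lemma complex_eigenvector n (A : 'M[R]_n) e (w : 'rV[C]_n) :
  w *m map_mx toC A = e%:C%C *: w ->
  map_mx (@complex.Re R) w *m A = e *: map_mx (@complex.Re R) w /\
  map_mx (@complex.Im R) w *m A = e *: map_mx (@complex.Im R) w.
Proof.
rewrite {1 2}[w]mx_ReIm; set u := map_mx _ w; set v := map_mx _ w.
rewrite mulmxDl -scalemxAl -!map_mxM => h.
move: (u *m A) (v *m A) h => uA vA h.
have hij i j : uA i j = e * u i j /\ vA i j = e * v i j.
  move/matrixP/(_ i j): h; rewrite !mxE => /eqP.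
  rewrite eq_complex /= => /andP[/eqP h1 /eqP h2]; move: h1 h2.
  by rewrite !(mul0r, mulr0, mul1r, add0r, addr0, subr0, oppr0).
by split; apply/matrixP => i j; rewrite [RHS]mxE; case: (hij i j).
Qed.
(** Prepares an eigenvector with entries of both signs. If the two largest eigenvalues coincide, two
    independent eigenvectors combine into one with zero sum; otherwise the strict inequality will
    serve against a vector of one sign. *)
Lemma second_eigenvector n (A : 'M[R]_n) : (1 < n)%N -> A^T = A ->
  let e := eigenvalues A in
  (exists v : 'rV[R]_n, [/\ v != 0, v *m A = e`_1 *: v & \sum_i v 0 i = 0]) \/
  (exists v0 v1 : 'rV[R]_n, [/\ v0 != 0, v1 != 0, v0 *m A = e`_0 *: v0,
     v1 *m A = e`_1 *: v1 & e`_1 < e`_0]).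
Proof.
move=> n1 symA e.
have [P [r [uP eA cpA]]] := symmetric_spectral symA.
have [i0 [i1 [i01 r0 r1 le_e le10]]] := eigenvalues_top2 n1 cpA.
have rowPE i : row i P *m map_mx toC A = (r i)%:C%C *: row i P.
  rewrite eA !mulmxA -row_mul; have /unitarymxP -> := uP.
  rewrite row1 -mulmxA -rowE; apply/rowP => j.
  by rewrite mul_diag_mx !mxE.
have row0 i : row i P != 0.
  apply: contraTneq uP => h; apply/negP => /row_unitarymxP/(_ i i).
  by rewrite h linear0l eqxx => /esym/eqP; rewrite oner_eq0.
have split0 (w : 'rV[C]_n) : w != 0 ->
    (map_mx (@complex.Re R) w != 0) || (map_mx (@complex.Im R) w != 0).
  move=> w0; rewrite -negb_and; apply: contra w0 => /andP[/eqP h1 /eqP h2].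
  by rewrite [w]mx_ReIm h1 h2 !map_mx0 scaler0 addr0.
have [lt10|ge10] := ltP e`_1 e`_0.
  right.
  have ev k : exists2 v : 'rV[R]_n, v != 0 & v *m A = r k *: v.
    have [h1 h2] := complex_eigenvector (rowPE k).
    by case/orP: (split0 _ (row0 k)) => h; [exists (map_mx (@complex.Re R) (row k P)) |
      exists (map_mx (@complex.Im R) (row k P))].
  have [v0 v0n v0e] := ev i0; have [v1 v1n v1e] := ev i1.
  by exists v0, v1; split => //; rewrite ?v0e ?v1e ?r0 ?r1.
left; have e01 : r i0 = r i1 by rewrite r0 r1; apply/eqP; rewrite eq_le le10 ge10.
pose s k := \sum_i row k P 0 i.
have [al [be [nz s0]]] : exists al be : C, (al != 0) || (be != 0) /\
    al * s i0 + be * s i1 = 0.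
  have [pa0|pa0] := eqVneq (s i0) 0; last first.
    by exists (s i1), (- s i0); rewrite oppr_eq0 pa0 orbT mulNr mulrC subrr.
  by exists 1, 0; rewrite oner_eq0 pa0 mulr0 mul0r addr0.
pose w := al *: row i0 P + be *: row i1 P.
have wE : w *m map_mx toC A = (r i1)%:C%C *: w.
  by rewrite mulmxDl -!scalemxAl !rowPE e01 scalerDr !scalerA ![_ * (r i1)%:C%C]mulrC.
have w0 : w != 0.
  apply: contraTneq nz => h.
  (* Multiplying by the adjoint of [P] recovers the coefficients, so [w] = 0 would make both of them
     vanish. *)
  have h0 : w *m P^t* = al *: delta_mx 0 i0 + be *: delta_mx 0 i1.
    rewrite mulmxDl -!scalemxAl -!row_mul; have /unitarymxP -> := uP.
    by rewrite !row1.
  move: h0; rewrite h mul0mx => /rowP h0.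
  move: (h0 i0) (h0 i1); rewrite !mxE !eqxx (negPf i01) eq_sym (negPf i01) /=.
  rewrite !(mulr1, mulr0, addr0, add0r) => <- <-.
  by rewrite eqxx.
have sw : \sum_i w 0 i = 0.
  rewrite -[RHS]s0 /s !mulr_sumr -big_split /=; apply: eq_bigr => i _.
  by rewrite !mxE.
have [h1 h2] := complex_eigenvector wE.
have sR : \sum_i map_mx (@complex.Re R) w 0 i = 0.
  rewrite (eq_bigr (fun i => complex.Re (w 0 i))) => [|i _]; last by rewrite mxE.
  by rewrite -raddf_sum sw.
have sI : \sum_i map_mx (@complex.Im R) w 0 i = 0.
  rewrite (eq_bigr (fun i => complex.Im (w 0 i))) => [|i _]; last by rewrite mxE.
  by rewrite -raddf_sum sw.
by case/orP: (split0 _ w0) => h; [exists (map_mx (@complex.Re R) w) |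
  exists (map_mx (@complex.Im R) w)]; split => //; rewrite -/e -r1.
Qed.
End RealSymmetric.

(** * The second eigenvalue of a graph *)

Section GraphSpectrum.
Variables (R : rcfType) (G : sgraph).
Local Notation A := (adjacency R G).

Lemma adjacency_sym : A^T = A.
Proof. by apply/matrixP => i j; rewrite !mxE edge_sym. Qed.

Definition vec_of (x : G -> R) : 'rV[R]_#|G| := \row_i x (enum_val i).

Lemma sum_enum_val (F : G -> R) : \sum_(i < #|G|) F (enum_val i) = \sum_p F p.
Proof. by rewrite (reindex (@enum_val G G)) //; apply: onW_bij; exact: enum_val_bij. Qed.

Lemma vec_adj (x : G -> R) i :
  (vec_of x *m A) 0 i = \sum_(q | edge (enum_val i) q) x q.
Proof.
rewrite mxE [RHS]big_mkcond -sum_enum_val /=; apply: eq_bigr => k _.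
by rewrite !mxE edge_sym; case: edge; rewrite ?mulr1 ?mulr0.
Qed.

Lemma vec_dot (x y : G -> R) : (vec_of x *m (vec_of y)^T) 0 0 = \sum_p x p * y p.
Proof. by rewrite mxE -sum_enum_val; apply: eq_bigr => k _; rewrite !mxE. Qed.

Lemma vec_form (x y : G -> R) :
  (vec_of x *m A *m (vec_of y)^T) 0 0 = \sum_p \sum_(q | edge p q) x q * y p.
Proof.
rewrite mxE -sum_enum_val; apply: eq_bigr => k _.
by rewrite vec_adj !mxE mulr_suml.
Qed.

Lemma vec_ofK (v : 'rV[R]_#|G|) : vec_of (fun p => v 0 (enum_rank p)) = v.
Proof. by apply/rowP => i; rewrite mxE enum_valK. Qed.

(** Disjoint supports make [a] and [b] linearly independent, so that they span a plane of test
    vectors. *)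
Lemma rho2_ge (a b : G -> R) lam :
  (1 < #|G|)%N -> (forall p, a p * b p = 0) ->
  (exists p, a p != 0) -> (exists p, b p != 0) ->
  (forall al be : R, let w p := al * a p + be * b p in
     lam * (\sum_p w p ^+ 2) <= \sum_p \sum_(q | edge p q) w q * w p) ->
  lam <= rho2 R G.
Proof.
move=> n1 ab0 [p ap] [q bq] h.
apply: (@second_eigenvalue_ge _ _ _ (vec_of a) (vec_of b)) => //.
- exact: adjacency_sym.
- move=> al be /rowP e.
  have bp0 : b p = 0 by move/eqP: (ab0 p); rewrite mulf_eq0 (negPf ap) => /eqP.
  have aq0 : a q = 0 by move/eqP: (ab0 q); rewrite mulf_eq0 (negPf bq) orbF => /eqP.
  move: (e (enum_rank p)) (e (enum_rank q)).
  rewrite !mxE !enum_rankK bp0 aq0 !mulr0 addr0 add0r => /eqP e1 /eqP e2.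
  by move: e1 e2; rewrite !mulf_eq0 (negPf ap) (negPf bq) !orbF => /eqP -> /eqP ->.
move=> al be /=.
have -> : al *: vec_of a + be *: vec_of b = vec_of (fun p => al * a p + be * b p).
  by apply/rowP => i; rewrite !mxE.
rewrite vec_dot vec_form; apply: le_trans (h al be).
by under eq_bigr do rewrite -expr2.
Qed.

Lemma connect_closed_pred (T : finType) (e : rel T) (a : pred T) x y :
  (forall u v, e u v -> a u -> a v) -> connect e x y -> a x -> a y.
Proof.
move=> cl /connectP[s es ->]; elim: s x es => //= z s IHs x /andP[xz zs] ax.
by apply: IHs zs _; apply: cl xz ax.
Qed.

Definition is_eigenvector (x : G -> R) (lam : R) :=
  forall p, \sum_(q | edge p q) x q = lam * x p.

Lemma is_eigenvectorN x lam :
  is_eigenvector x lam -> is_eigenvector (fun p => - x p) lam.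
Proof. by move=> h p; rewrite sumrN h mulrN. Qed.

Lemma mx_eigenvector (v : 'rV[R]_#|G|) lam : v *m A = lam *: v ->
  is_eigenvector (fun p => v 0 (enum_rank p)) lam.
Proof.
move=> h p; have := vec_adj (fun p => v 0 (enum_rank p)) (enum_rank p).
by rewrite vec_ofK h mxE enum_rankK.
Qed.

Lemma row_neq0 (v : 'rV[R]_#|G|) : v != 0 -> exists p, v 0 (enum_rank p) != 0.
Proof.
move=> v0; apply/existsP; apply: contraR v0; rewrite negb_exists => /forallP h.
apply/eqP/rowP => i; rewrite mxE; apply/eqP; move: (h (enum_val i)).
by rewrite negbK enum_valK.
Qed.

(** At a zero of [x] the row is a vanishing sum of nonnegative terms, so zeros spread to neighbours
    and, by connectedness, everywhere. *)
Lemma nonneg_eigenvector_gt0 x lam : connected_graph G -> is_eigenvector x lam ->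
  (forall p, 0 <= x p) -> (exists p, x p != 0) -> forall p, 0 < x p.
Proof.
move=> [_ con] ex x0 [q xq] p; rewrite lt_neqAle x0 andbT; apply/negP => /eqP xp.
suff : x q == 0 by apply/negP.
apply: (connect_closed_pred (a := fun p => x p == 0) _ (con p q)); last by rewrite -xp.
move=> u v uv /eqP xu; have /eqP := ex u; rewrite xu mulr0 psumr_eq0 => [|i _]; last exact: x0.
by move/allP/(_ v (mem_index_enum _)); rewrite uv.
Qed.

(** Perron-Frobenius: pair the positive [x1] with |x0|. By symmetry, pairing [x1] with A |x0|
    multiplies the result by [l1], while A |x0| >= l0 |x0| entrywise. *)
Lemma nonneg_eigenvector_max x0 l0 x1 l1 : connected_graph G ->
  is_eigenvector x0 l0 -> (exists p, x0 p != 0) ->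
  is_eigenvector x1 l1 -> (exists p, x1 p != 0) -> (forall p, 0 <= x1 p) ->
  l0 <= l1.
Proof.
move=> cG e0 [q x0q] e1 n1 x1ge.
have x1gt := nonneg_eigenvector_gt0 cG e1 x1ge n1.
have gt0 : 0 < \sum_p x1 p * `|x0 p|.
  rewrite (bigD1 q) //= ltr_wpDr ?mulr_gt0 ?normr_gt0 //.
  by apply: sumr_ge0 => p _; rewrite mulr_ge0.
rewrite -(ler_pM2r gt0).
have <- : \sum_p x1 p * (\sum_(q | edge p q) `|x0 q|) = l1 * \sum_p x1 p * `|x0 p|.
  under eq_bigr do rewrite mulr_sumr big_mkcond.
  rewrite exchange_big /= mulr_sumr; apply: eq_bigr => p _.
  rewrite mulrA -e1 mulr_suml [RHS]big_mkcond /=; apply: eq_bigr => i _.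
  by rewrite edge_sym.
rewrite mulr_sumr; apply: ler_sum => p _; rewrite mulrCA ler_wpM2l //.
apply: le_trans (ler_norm_sum _ _ _).
by rewrite e0 normrM ler_wpM2r // ler_norm.
Qed.

(** If the two top eigenvalues differ, an eigenvector of one sign for the second would, by
    [nonneg_eigenvector_max], make the second at least the first. *)
Lemma rho2_eigenvector : connected_graph G -> (1 < #|G|)%N ->
  exists x, [/\ is_eigenvector x (rho2 R G), exists p, 0 < x p & exists p, x p < 0].
Proof.
move=> cG n1; case: (second_eigenvector n1 adjacency_sym) => [[v [v0 ev sv]]|].
  have [p xp] := row_neq0 v0; exists (fun p => v 0 (enum_rank p)).
  have sx : \sum_p v 0 (enum_rank p) = 0.
    rewrite -[RHS]sv -(@sum_enum_val (fun p => v 0 (enum_rank p))).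
    by apply: eq_bigr => i _; rewrite enum_valK.
  split; first exact: mx_eigenvector.
    apply/existsP; apply: contraR xp; rewrite negb_exists => /forallP h.
    have : \sum_p - v 0 (enum_rank p) == 0 by rewrite sumrN sx oppr0.
    rewrite psumr_eq0 => [|i _]; last by rewrite oppr_ge0 leNgt.
    by move/allP/(_ p (mem_index_enum _)); rewrite oppr_eq0.
  apply/existsP; apply: contraR xp; rewrite negb_exists => /forallP h.
  move/eqP: sx; rewrite psumr_eq0 => [|i _]; last by rewrite leNgt.
  by move/allP/(_ p (mem_index_enum _)).
case=> v0 [v1 [v0n v1n /mx_eigenvector e0 /mx_eigenvector e1 lt10]].
have n0 := row_neq0 v0n; have n1' := row_neq0 v1n.
set x := fun p => v1 0 (enum_rank p) in e1 n1'; exists x; split => //.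
  apply/existsP; move: lt10; apply: contraLR; rewrite negb_exists -leNgt => /forallP h.
  apply: nonneg_eigenvector_max cG e0 n0 (is_eigenvectorN e1) _ _.
    by case: n1' => p; exists p; rewrite oppr_eq0.
  by move=> p; rewrite oppr_ge0 leNgt.
apply/existsP; move: lt10; apply: contraLR; rewrite negb_exists -leNgt => /forallP h.
apply: nonneg_eigenvector_max cG e0 n0 e1 n1' _.
by move=> p; rewrite leNgt.
Qed.
End GraphSpectrum.

(** * Stanley's bound on the positive part *)

Section Counting.
Variable T : finType.
Implicit Types F : rel T.

(** Relations stand for subgraphs, and edges are counted as ordered pairs: for symmetric irreflexive
    [F], [npairs] is twice the number of edges, which avoids halves throughout. *)
Definition deg F p : nat := \sum_q F p q.
Definition npairs F : nat := \sum_p deg F p.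

Lemma npairs_set2 F : symmetric F -> irreflexive F ->
  npairs F = (#|[set E : {set T} | [exists x, exists y, F x y && (E == [set x; y])]]|).*2.
Proof.
move=> sF iF; pose D := [set z : T * T | F z.1 z.2].
pose f (z : T * T) := [set z.1; z.2].
have -> : [set E : {set T} | [exists x, exists y, F x y && (E == [set x; y])]] = f @: D.
  apply/setP => E; rewrite inE; apply/existsP/imsetP.
    by case=> p /existsP[q /andP[pq /eqP ->]]; exists (p, q); rewrite ?inE.
  by case=> [[p q]]; rewrite inE /= => pq ->; exists p; apply/existsP; exists q; rewrite pq /=.
have -> : npairs F = \sum_(z in D) 1.
  rewrite /npairs /deg pair_big /= [RHS]big_mkcond /=; apply: eq_bigr => z _.
  by rewrite inE; case: (F _ _).
rewrite (partition_big_imset f) /= -muln2 -sum_nat_const; apply: eq_bigr => E.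
case/imsetP => [[p q]]; rewrite inE /= => pq ->.
have npq : p != q by apply: contraTneq pq => ->; rewrite iF.
rewrite sum1dep_card.
have -> : [set z | (z \in D) && (f z == f (p, q))] = [set (p, q); (q, p)].
  apply/setP => [[a b]]; rewrite !inE /f /= -!pair_eqE /=; apply/andP/idP.
    case=> ab /eqP e; have : a \in [set p; q] by rewrite -e !inE eqxx.
    have : b \in [set p; q] by rewrite -e !inE eqxx orbT.
    have nab : a != b by apply: contraTneq ab => ->; rewrite iF.
    move: nab; rewrite !inE => nab /orP[]/eqP eb /orP[]/eqP ea;
      move: nab; rewrite ea eb ?eqxx ?orbT //.
  case/orP => /andP[/eqP -> /eqP ->]; first by rewrite pq eqxx.
  by rewrite sF pq setUC.
by rewrite cards2 -pair_eqE /= (negPf npq).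
Qed.

Lemma npairs_even F : symmetric F -> irreflexive F -> exists k, npairs F = k.*2.
Proof. by move=> sF iF; rewrite npairs_set2 //; eexists. Qed.

Lemma npairsS F F' : subrel F F' -> (npairs F <= npairs F')%N.
Proof.
move=> s; apply: leq_sum => p _; apply: leq_sum => q _.
by case e: (F p q) => //; rewrite (s _ _ e).
Qed.

Lemma npairsU F1 F2 : (forall p q, F1 p q -> ~~ F2 p q) ->
  npairs (relU F1 F2) = (npairs F1 + npairs F2)%N.
Proof.
move=> dis; rewrite /npairs -big_split /=; apply: eq_bigr => p _.
rewrite /deg -big_split /=; apply: eq_bigr => q _ /=.
by have := dis p q; case: (F1 _ _); case: (F2 _ _) => // /(_ isT).
Qed.

Lemma eq_npairs F1 F2 : F1 =2 F2 -> npairs F1 = npairs F2.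
Proof. by move=> e; apply: eq_bigr => p _; apply: eq_bigr => q _; rewrite e. Qed.

Lemma npairs_gt0 F p q : F p q -> (0 < npairs F)%N.
Proof.
by move=> pq; rewrite /npairs (bigD1 p) //= /deg (bigD1 q) //= pq.
Qed.

Lemma npairs0 F : npairs F = 0%N -> forall p q, F p q = false.
Proof.
move=> h p q; apply: contra_eqF h => pq; rewrite -lt0n; exact: npairs_gt0 pq.
Qed.

Lemma npairs_complete (A : {set T}) :
  npairs (fun p q => [&& p != q, p \in A & q \in A]) = (#|A| * (#|A|).-1)%N.
Proof.
rewrite /npairs -sum_nat_const [RHS]big_mkcond /=; apply: eq_bigr => p _.
case: ifP => pA; last by rewrite /deg big1 // => q _; rewrite pA andbF.
rewrite (cardsD1 p) pA /= /deg -sum1_card [RHS]big_mkcond /=; apply: eq_bigr => q _.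
by rewrite !inE eq_sym pA; case: (q == p); case: (q \in A).
Qed.

Lemma deg_card F p : deg F p = #|[set q | F p q]|.
Proof.
rewrite -sum1_card [RHS]big_mkcond /deg; apply: eq_bigr => q _.
by rewrite inE; case: (F _ _).
Qed.
End Counting.

Section StanleyIdentity.
Variables (R : realFieldType) (T : finType) (F : rel T).
Hypothesis iF : irreflexive F.

Lemma degE p : (deg F p)%:R = \sum_(q | F p q) 1 :> R.
Proof. by rewrite /deg natr_sum [RHS]big_mkcond /=; apply: eq_bigr => q _; case: (F _ _). Qed.

Definition outside_degree u : nat := \sum_(w | (w != u) && ~~ F u w) deg F w.

Definition slack (y : T -> R) u : R :=
  \sum_(w | F u w) \sum_(z | F w z) (1 - y z).

(* Bookkeeping behind Stanley's bound: the two-step walks from u do not see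
   the edge ends at u itself nor those outside the closed neighbourhood. *)
Lemma npairs_walks (y : T -> R) u :
  (npairs F)%:R = \sum_(w | F u w) \sum_(z | F w z) y z + (deg F u)%:R +
    (outside_degree u)%:R + slack y u.
Proof.
have -> : (npairs F)%:R = (deg F u)%:R + \sum_(w | F u w) (deg F w)%:R +
    (outside_degree u)%:R :> R.
  rewrite /npairs natr_sum (bigD1 u) //= -addrA; congr (_ + _).
  rewrite /outside_degree natr_sum (bigID (F u)) /=; congr (_ + _).
  apply: eq_bigl => w; rewrite andb_idl // => uw.
  by apply: contraTneq uw => ->; rewrite iF.
have -> : \sum_(w | F u w) (deg F w)%:R =
    \sum_(w | F u w) \sum_(z | F w z) y z + slack y u.
  rewrite -big_split /=; apply: eq_bigr => w _.
  by rewrite degE -big_split /=; apply: eq_bigr => z _; rewrite addrC subrK.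
by ring.
Qed.
End StanleyIdentity.

Definition within (G : sgraph) (A : {set G}) : rel G :=
  fun p q => [&& edge p q, p \in A & q \in A].

Lemma within_sym (G : sgraph) (A : {set G}) : symmetric (within A).
Proof.
by move=> p q; rewrite /within edge_sym andbCA andbC -andbA; congr (_ && _); rewrite andbC.
Qed.

Lemma within_irr (G : sgraph) (A : {set G}) : irreflexive (within A).
Proof. by move=> p; rewrite /within edge_irr. Qed.

Lemma npairs_edge (G : sgraph) : npairs (@edge G) = (nb_edges G).*2.
Proof. by rewrite npairs_set2 //; [exact: edge_sym | exact: edge_irr]. Qed.

Section PositivePart.
Variables (R : rcfType) (G : sgraph) (x : G -> R) (rho : R).
Hypothesis ev : is_eigenvector x rho.
Hypothesis rho_gt0 : 0 < rho.

Definition pos_set : {set G} := [set p | 0 < x p].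
Local Notation P := pos_set.
Local Notation PP := (within P).
(** Discarding the negative neighbours of [p] raises its row sum by this amount, so [x] restricted
    to the positive part is a subsolution with a known surplus. *)
Definition neg p : R := \sum_(q | edge p q && (x q < 0)) - x q.

Lemma neg_ge0 p : 0 <= neg p.
Proof. by apply: sumr_ge0 => q /andP[_ h]; rewrite oppr_ge0 ltW. Qed.

Lemma neg_gt0 p q : edge p q -> x q < 0 -> 0 < neg p.
Proof.
move=> pq xq; rewrite /neg (bigD1 q) ?pq //= ltr_wpDr ?oppr_gt0 //.
by apply: sumr_ge0 => i /andP[/andP[_ h] _]; rewrite oppr_ge0 ltW.
Qed.

Lemma pos_row p : \sum_(q | edge p q && (0 < x q)) x q = rho * x p + neg p.
Proof.
rewrite -ev [in RHS](bigID (fun q => 0 < x q)) /= -addrA [X in _ = _ + X](_ : _ = 0) ?addr0 //.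
rewrite (bigID (fun q => x q < 0)) /= [X in _ + X + _]big1 => [|q]; last first.
  by rewrite -!leNgt => /andP[/andP[_ h1] h2]; apply/eqP; rewrite eq_le h1 h2.
rewrite addr0 /neg -[X in X + _](opprK) -sumrN addrC; apply/eqP; rewrite subr_eq0; apply/eqP.
apply: eq_bigl => q; rewrite -andbA; congr (_ && _).
by rewrite andb_idl // => h; rewrite -leNgt ltW.
Qed.

Lemma within_row p : p \in P -> \sum_(q | PP p q) x q = rho * x p + neg p.
Proof.
by move=> pP; rewrite -pos_row; apply: eq_bigl => q; rewrite /within pP !inE.
Qed.

Lemma within_deg_gt0 p : p \in P -> (0 < deg PP p)%N.
Proof.
move=> pP; rewrite lt0n; apply/negP => /eqP d0.
have := within_row pP; rewrite big1 => [h|q pq].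
  have : 0 < rho * x p + neg p.
    by rewrite ltr_wpDr ?neg_ge0 // mulr_gt0 //; rewrite inE in pP.
  by rewrite -h ltxx.
by move: d0; rewrite /deg (bigD1 q) //= pq.
Qed.

Section Top.
Variables (u : G) (xu : x u = 1) (x_le1 : forall p, x p <= 1).

Lemma top_pos : u \in P. Proof. by rewrite inE xu. Qed.

(** The walk term of [npairs_walks] is evaluated by using the rows twice: a neighbour [w] of [u]
    contributes rho x w + neg w, and the x w sum to rho + neg u. Beyond rho^2 and the degree of [u],
    every term is a nonnegative excess. *)
Lemma stanley : (npairs PP)%:R = rho ^+ 2 + rho * neg u +
  \sum_(w | PP u w) neg w + (deg PP u)%:R + (outside_degree PP u)%:R +
  slack PP x u.
Proof.
rewrite (npairs_walks (@within_irr _ _) x u) //; congr (_ + _ + _ + _).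
rewrite (eq_bigr (fun w => rho * x w + neg w)) => [|w /and3P[_ _ wP]]; last first.
  exact: within_row.
rewrite big_split /= -mulr_sumr within_row ?top_pos // xu; ring.
Qed.

Lemma slack_ge0 : 0 <= slack PP x u.
Proof. by apply: sumr_ge0 => w _; apply: sumr_ge0 => z _; rewrite subr_ge0. Qed.

Lemma slack_ge w z : PP u w -> PP w z -> 1 - x z <= slack PP x u.
Proof.
move=> uw wz; rewrite /slack (bigD1 w) //= (bigD1 z) //= -addrA lerDl addr_ge0 //.
  by apply: sumr_ge0 => i _; rewrite subr_ge0.
by apply: sumr_ge0 => i _; apply: sumr_ge0 => k _; rewrite subr_ge0.
Qed.

Lemma sum_neg_ge0 : 0 <= \sum_(w | PP u w) neg w.
Proof. by apply: sumr_ge0 => w _; exact: neg_ge0. Qed.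

Lemma sum_neg_ge w : PP u w -> neg w <= \sum_(w | PP u w) neg w.
Proof.
move=> uw; rewrite (bigD1 w) //= lerDl; apply: sumr_ge0 => i _; exact: neg_ge0.
Qed.

Lemma top_deg_ge : rho + neg u <= (deg PP u)%:R.
Proof.
have := within_row top_pos; rewrite xu mulr1 => <-; rewrite degE.
by apply: ler_sum => q _.
Qed.

Lemma outside_ge w : w \in P -> w != u -> ~~ PP u w ->
  (deg PP w <= outside_degree PP u)%N.
Proof. by move=> wP wu uw; rewrite /outside_degree (bigD1 w) ?wu //= leq_addr. Qed.

Variables (j : nat) (th : R).
Hypotheses (rhoE : rho = j%:R - th) (th_ge0 : 0 <= th) (th_lt1 : th < 1).

(** Entries are at most 1, so the degree of [u] is at least its row sum, hence at least rho > j -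
    1. *)
Lemma deg_ge_j : (j <= deg PP u)%N.
Proof.
have h1 := top_deg_ge; have h2 := neg_ge0 u.
rewrite leqNgt; apply/negP => h; have : ((deg PP u).+1)%:R <= j%:R :> R by rewrite ler_nat.
by rewrite -natr1 => h3; move: rhoE th_lt1 => h4 h5; lra.
Qed.

Lemma stanley_ge : rho ^+ 2 + j%:R <= (npairs PP)%:R.
Proof.
have := deg_ge_j; rewrite -(ler_nat R) stanley => h1.
have h2 : 0 <= rho * neg u by rewrite mulr_ge0 ?neg_ge0 // ltW.
have h3 := sum_neg_ge0; have h4 := slack_ge0.
have h5 : 0 <= (outside_degree PP u)%:R :> R by [].
by lra.
Qed.

(** Wherever [p] lies, it feeds an excess term: [neg u] if p = u, the sum of [neg] if [p] is
    adjacent to [u], and [outside_degree] otherwise. *)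
Lemma stanley_gt p q : edge p q -> 0 < x p -> x q < 0 ->
  rho ^+ 2 + j%:R < (npairs PP)%:R.
Proof.
move=> pq xp xq; have := deg_ge_j; rewrite -(ler_nat R) stanley => h1.
have h2 : 0 <= rho * neg u by rewrite mulr_ge0 ?neg_ge0 // ltW.
have h3 := sum_neg_ge0; have h4 := slack_ge0.
have h5 : 0 <= (outside_degree PP u)%:R :> R by [].
have np := neg_gt0 pq xq.
have [pu|pu] := eqVneq p u.
  have h6 : 0 < rho * neg u by rewrite mulr_gt0 // -pu.
  by lra.
have [up|up] := boolP (PP u p).
  by have := sum_neg_ge up; lra.
have pP : p \in P by rewrite inE.
have h6 : 1 <= (outside_degree PP u)%:R :> R.
  by rewrite ler1n (leq_trans (within_deg_gt0 pP)) // outside_ge.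
by lra.
Qed.
End Top.

End PositivePart.

Lemma exists_top (R : rcfType) (G : sgraph) (x : G -> R) rho :
  is_eigenvector x rho -> (exists p, 0 < x p) ->
  exists (c : R) (u : G), [/\ 0 < c, is_eigenvector (fun p => c * x p) rho,
    c * x u = 1 & forall p, c * x p <= 1].
Proof.
move=> ev [p xp].
have [u _ umax] := @Order.TotalTheory.arg_maxP _ _ G p predT x isT.
have xu : 0 < x u by apply: lt_le_trans xp (umax p isT).
exists (x u)^-1, u; split; first by rewrite invr_gt0.
- by move=> q; rewrite -mulr_sumr ev mulrCA.
- by rewrite mulVf // gt_eqF.
- by move=> q; rewrite mulrC ler_pdivrMr // mul1r; apply: umax.
Qed.

Section Unscaled.
Variables (R : rcfType) (G : sgraph) (x : G -> R) (rho : R).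
Hypotheses (ev : is_eigenvector x rho) (rho_gt0 : 0 < rho).
Variables (j : nat) (th : R).
Hypotheses (rhoE : rho = j%:R - th) (th_ge0 : 0 <= th) (th_lt1 : th < 1).
Hypothesis xpos : exists p, 0 < x p.

Lemma pos_setZ c : 0 < c -> pos_set (fun p => c * x p) = pos_set x.
Proof. by move=> c0; apply/setP => p; rewrite !inE pmulr_rgt0. Qed.

Lemma pos_npairs_ge : rho ^+ 2 + j%:R <= (npairs (within (pos_set x)))%:R.
Proof.
have [c [u [c0 ev' xu le1]]] := exists_top ev xpos.
by rewrite -(pos_setZ c0); apply: (stanley_ge ev' rho_gt0 xu le1 rhoE).
Qed.

Lemma pos_npairs_gt p q : edge p q -> 0 < x p -> x q < 0 ->
  rho ^+ 2 + j%:R < (npairs (within (pos_set x)))%:R.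
Proof.
move=> pq xp xq; have [c [u [c0 ev' xu le1]]] := exists_top ev xpos.
rewrite -(pos_setZ c0); apply: (stanley_gt ev' rho_gt0 xu le1 rhoE) pq _ _ => //.
  by rewrite mulr_gt0.
by rewrite pmulr_rlt0.
Qed.
End Unscaled.

(** * Cliques and the cut between the two parts *)

Lemma npairs_split (T : finType) (F : rel T) (A B : {set T}) :
  (forall p q, F p q -> ~~ [&& p \in A, q \in A, p \in B & q \in B]) ->
  npairs F = (npairs (fun p q => [&& F p q, p \in A & q \in A]) +
    npairs (fun p q => [&& F p q, p \in B & q \in B]) +
    npairs (fun p q => [&& F p q, ~~ ((p \in A) && (q \in A)) &
                          ~~ ((p \in B) && (q \in B))]))%N.
Proof.
move=> dis; rewrite -!npairsU /=.
- apply: eq_npairs => p q /=; have := dis p q.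
  by case: (F p q) => //= /(_ isT); case: (p \in A); case: (q \in A);
    case: (p \in B); case: (q \in B).
- by move=> p q /orP[] /and3P[-> -> ->]; rewrite ?andbF.
- move=> p q /and3P[pq pA qA]; have := dis p q pq.
  by rewrite pA qA pq.
Qed.

Section Graph.
Variable G : sgraph.
Implicit Types A B K : {set G}.

Definition across A B : rel G := fun p q =>
  [&& edge p q, ~~ ((p \in A) && (q \in A)) & ~~ ((p \in B) && (q \in B))].

Lemma across_sym A B : symmetric (across A B).
Proof.
by move=> p q; rewrite /across edge_sym; congr [&& _, ~~ _ & ~~ _]; exact: andbC.
Qed.

Lemma across_irr A B : irreflexive (across A B).
Proof. by move=> p; rewrite /across edge_irr. Qed.

Lemma npairs_edge_split A B :
  (forall p q, edge p q -> ~~ [&& p \in A, q \in A, p \in B & q \in B]) ->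
  npairs (@edge G) = (npairs (within A) + npairs (within B) + npairs (across A B))%N.
Proof. exact: npairs_split. Qed.

Lemma disjoint_edge_split A B : [disjoint A & B] ->
  npairs (@edge G) = (npairs (within A) + npairs (within B) + npairs (across A B))%N.
Proof.
move=> dAB; apply: npairs_edge_split => p q _; apply/negP => /and4P[pA _ pB _].
by move/pred0P/(_ p): dAB; rewrite /= pA pB.
Qed.

Lemma is_cliqueP K : reflect (forall p q, p \in K -> q \in K -> p != q -> edge p q)
  (is_clique K).
Proof.
apply: (iffP forall_inP) => [h p q pK qK pq|h p pK].
  by move/forall_inP/(_ q qK)/implyP: (h p pK); apply.
by apply/forall_inP => q qK; apply/implyP; apply: h.
Qed.

Lemma clique_sub K K' : K' \subset K -> is_clique K -> is_clique K'.
Proof.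
move=> /subsetP s /is_cliqueP cK; apply/is_cliqueP => p q pK qK.
by apply: cK; apply: s.
Qed.

Lemma clique_npairs K : is_clique K -> npairs (within K) = (#|K| * #|K|.-1)%N.
Proof.
move=> /is_cliqueP cK; rewrite -npairs_complete; apply: eq_npairs => p q.
rewrite /within; case pK: (p \in K); case qK: (q \in K); rewrite ?andbF ?andbT //.
case: eqVneq => [->|pq]; first by rewrite edge_irr.
exact: cK.
Qed.

Lemma npairs_clique K : npairs (within K) = (#|K| * #|K|.-1)%N -> is_clique K.
Proof.
rewrite -npairs_complete => e; apply/is_cliqueP => p q pK qK pq.
set C := fun p q => _ in e.
have eC : npairs C = (npairs (within K) + npairs (fun p q => C p q && ~~ edge p q))%N.
  rewrite -npairsU => [|a b /and3P[-> _ _]]; last by rewrite andbF.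
  apply: eq_npairs => a b /=; rewrite /C /within.
  by case: eqVneq => [->|_] /=; [rewrite edge_irr | case: edge; case: (a \in K); case: (b \in K)].
have e0 : npairs (fun p q => C p q && ~~ edge p q) = 0%N by lia.
by have := npairs0 e0 p q; rewrite /C pq pK qK /= => /negbFE.
Qed.

Lemma connected_cut A : connected_graph G -> (exists p, p \in A) ->
  (exists p, p \notin A) -> exists p q, [/\ p \in A, q \notin A & edge p q].
Proof.
move=> [_ con] [p pA] [q qA].
have [/existsP[a /existsP[b /and3P[aA bA ab]]]|h] :=
  boolP [exists a, exists b, [&& a \in A, b \notin A & edge a b]].
  by exists a, b.
case/negP: qA; apply: (connect_closed_pred (a := mem A) _ (con p q)) => // a b ab aA.
apply: contraNT h => bA; apply/existsP; exists a; apply/existsP; exists b.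
by rewrite ab bA !andbT.
Qed.

Lemma npairs2 (F : rel G) p q a b : symmetric F -> irreflexive F ->
  npairs F = 2%N -> F p q -> F a b -> (a = p /\ b = q) \/ (a = q /\ b = p).
Proof.
move=> sF iF; rewrite npairs_set2 // => e2 pq ab.
have /eqP/cards1P[E eE] :
    #|[set E : {set G} | [exists x, exists y, F x y && (E == [set x; y])]]| = 1%N by lia.
have inE' c d : F c d -> [set c; d] = E.
  move=> cd; apply/set1P; rewrite -eE inE; apply/existsP; exists c.
  by apply/existsP; exists d; rewrite cd eqxx.
have e := inE' _ _ pq; have e' := inE' _ _ ab.
have : a \in [set p; q] by rewrite e -e' !inE eqxx.
have : b \in [set p; q] by rewrite e -e' !inE eqxx orbT.
rewrite !inE => /orP[]/eqP eb /orP[]/eqP ea; subst a b; try by [left|right].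
  by rewrite iF in ab.
by rewrite iF in ab.
Qed.

Lemma npairs4 (F : rel G) p q p' q' a b : symmetric F -> irreflexive F ->
  npairs F = 4%N -> F p q -> F p' q' -> [set p; q] != [set p'; q'] ->
  F a b -> [set a; b] = [set p; q] \/ [set a; b] = [set p'; q'].
Proof.
move=> sF iF; rewrite npairs_set2 // => e2 pq pq' n ab.
set S := [set E : {set G} | _] in e2.
have inS c d : F c d -> [set c; d] \in S.
  move=> cd; rewrite inE; apply/existsP; exists c.
  by apply/existsP; exists d; rewrite cd eqxx.
have eS : [set [set p; q]; [set p'; q']] = S.
  apply/eqP; rewrite eqEcard cards2 n; apply/andP; split; last by lia.
  by apply/subsetP => E; rewrite !inE => /orP[]/eqP ->; [have := inS _ _ pq | have := inS _ _ pq']; rewrite inE.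
by have := inS _ _ ab; rewrite -eS !inE => /orP[]/eqP ->; [left|right].
Qed.
End Graph.

(* Deleting the edges of a clique K leaves a graph whose spectral radius is
   still at least rho: after a sign change the vertices of K sum to at most 0,
   and then the positive part of the eigenvector is a subsolution. *)
Lemma clique_deleted_npairs (R : rcfType) (G : sgraph) (x : G -> R) (rho th : R)
    (j : nat) (K : {set G}) :
  is_eigenvector x rho -> 0 < rho -> rho = j%:R - th -> th < 1 ->
  (exists p, 0 < x p) -> is_clique K -> \sum_(p in K) x p <= 0 ->
  rho ^+ 2 + j%:R <=
    (npairs (fun p q => [&& edge p q & ~~ ((p \in K) && (q \in K))]))%:R.
Proof.
move=> ev0 rho0 rhoE th1 xpos /is_cliqueP cK S0.
have [c [u [c0 ev xu le1]]] := exists_top ev0 xpos.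
have {}S0 : \sum_(p in K) c * x p <= 0 by rewrite -mulr_sumr pmulr_rle0.
suff main z : is_eigenvector z rho -> z u = 1 -> (forall p, z p <= 1) ->
    \sum_(p in K) z p <= 0 -> rho ^+ 2 + j%:R <=
    (npairs (fun p q => [&& edge p q & ~~ ((p \in K) && (q \in K))]))%:R.
  exact: (main _ ev xu le1 S0).
clear x ev0 xpos ev xu le1 S0; move: z => x ev xu le1 S0.
set F := fun p q => _; pose y p := if 0 < x p then x p else 0.
have y0 p : 0 <= y p by rewrite /y; case: ltP => // /ltW.
have xy p : x p <= y p by rewrite /y; case: ltP.
have y1 p : y p <= 1 by rewrite /y; case: ltP.
have key p : rho * y p <= \sum_(q | F p q) y q.
  rewrite {1}/y; case: ltP => xp; last by rewrite mulr0 sumr_ge0.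
  apply: le_trans (_ : \sum_(q | F p q) x q <= _); last by apply: ler_sum.
  (* If [p] is in [K], the deleted part of its row is the sum over [K] minus x p, hence negative:
     deleting it only helps. *)
  rewrite -ev (bigID (fun q => (p \in K) && (q \in K))) /= -[X in _ <= X]add0r.
  apply: lerD; last by rewrite le_eqVlt; apply/orP; left; apply/eqP; apply: eq_bigl.
  case pK: (p \in K); last by rewrite big_pred0 // => q; rewrite andbF.
  rewrite (eq_bigl (fun q => (q \in K) && (q != p))); last first.
    move=> q /=; case qK: (q \in K); rewrite ?andbF // andbT.
    case: eqVneq => [->|qp]; first by rewrite edge_irr.
    by rewrite cK // eq_sym.
  by move: S0; rewrite (bigD1 p) //=; lra.
rewrite (npairs_walks _ y u) => [|p]; last by rewrite /F edge_irr.
have h1 : rho ^+ 2 <= \sum_(w | F u w) \sum_(z | F w z) y z.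
  apply: le_trans (_ : \sum_(w | F u w) rho * y w <= _); last exact: ler_sum.
  rewrite -mulr_sumr expr2 ler_pM2l //; apply: le_trans (key u).
  by rewrite /y xu ltr01 mulr1.
have h2 : (j <= deg F u)%N.
  have h : rho <= (deg F u)%:R.
    rewrite degE; apply: le_trans (_ : \sum_(q | F u q) y q <= _); last exact: ler_sum.
    by apply: le_trans (key u); rewrite /y xu ltr01 mulr1.
  rewrite leqNgt; apply/negP => h'.
  have : ((deg F u).+1)%:R <= j%:R :> R by rewrite ler_nat.
  by rewrite -natr1; lra.
have h3 : j%:R <= (deg F u)%:R :> R by rewrite ler_nat.
have h4 : 0 <= (outside_degree F u)%:R :> R by [].
have h5 : 0 <= slack F y u.
  by apply: sumr_ge0 => w _; apply: sumr_ge0 => z _; rewrite subr_ge0.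
by lra.
Qed.

(** * Cliques meeting both parts *)

Notation neg_set x := (pos_set (fun p => - x p)).

Lemma pos_neg_disjoint (R : rcfType) (G : sgraph) (x : G -> R) :
  [disjoint pos_set x & neg_set x].
Proof.
apply/pred0P => p /=; rewrite !inE oppr_gt0; apply/negP => /andP[h1 h2].
by have := lt_trans h1 h2; rewrite ltxx.
Qed.

Lemma two_sided_ge (R : rcfType) (G : sgraph) (x : G -> R) (rho th : R) (j : nat) :
  is_eigenvector x rho -> 0 < rho -> rho = j%:R - th -> 0 <= th -> th < 1 ->
  (exists p, 0 < x p) -> (exists p, x p < 0) ->
  2 * (rho ^+ 2 + j%:R) + (npairs (across (pos_set x) (neg_set x)))%:R
    <= (npairs (@edge G))%:R.
Proof.
move=> ev rho0 rhoE th0 th1 xpos [n xn].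
have h1 := pos_npairs_ge ev rho0 rhoE th1 xpos.
have xneg : exists p, 0 < - x p by exists n; rewrite oppr_gt0.
have h2 := pos_npairs_ge (is_eigenvectorN ev) rho0 rhoE th1 xneg.
rewrite (disjoint_edge_split (pos_neg_disjoint x)) !natrD; lra.
Qed.

Lemma two_sided_gt (R : rcfType) (G : sgraph) (x : G -> R) (rho th : R) (j : nat) p q :
  is_eigenvector x rho -> 0 < rho -> rho = j%:R - th -> 0 <= th -> th < 1 ->
  edge p q -> 0 < x p -> x q < 0 ->
  2 * (rho ^+ 2 + j%:R) + (npairs (across (pos_set x) (neg_set x)))%:R
    < (npairs (@edge G))%:R.
Proof.
move=> ev rho0 rhoE th0 th1 pq xp xq.
have h1 := pos_npairs_gt ev rho0 rhoE th1 (ex_intro _ p xp) pq xp xq.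
have xneg : exists p, 0 < - x p by exists q; rewrite oppr_gt0.
have h2 := pos_npairs_ge (is_eigenvectorN ev) rho0 rhoE th1 xneg.
rewrite (disjoint_edge_split (pos_neg_disjoint x)) !natrD; lra.
Qed.

Lemma across_even (G : sgraph) (A B : {set G}) :
  exists k, npairs (across A B) = k.*2.
Proof. exact: npairs_even (@across_sym _ _ _) (@across_irr _ _ _). Qed.

Lemma across_ge2 (G : sgraph) (A B : {set G}) p q :
  across A B p q -> (2 <= npairs (across A B))%N.
Proof. by move=> /npairs_gt0; have [k ->] := across_even A B; case: k. Qed.

Lemma clique_number_small (R : rcfType) (G : sgraph) (x : G -> R) (rho th : R)
    (j om : nat) : connected_graph G ->
  is_eigenvector x rho -> 0 < rho -> rho = j%:R - th -> 0 <= th -> th < 1 ->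
  (exists p, 0 < x p) -> (exists p, x p < 0) ->
  (2 <= om)%N -> (om <= j)%N -> 2 * rho * om%:R + 4 < (npairs (@edge G))%:R.
Proof.
move=> cG ev rho0 rhoE th0 th1 xpos xneg om2 omj.
have := two_sided_ge ev rho0 rhoE th0 th1 xpos xneg.
have [||p [q [pP qP pq]]] := @connected_cut G (pos_set x) cG.
- by case: xpos => p xp; exists p; rewrite inE.
- by case: xneg => p xp; exists p; rewrite inE ltNge ltW.
have /across_ge2 : across (pos_set x) (neg_set x) p q.
  rewrite /across pq (negPf qP) andbF /=; move: pP; rewrite !inE oppr_gt0 => xp.
  by rewrite (lt_gtF xp).
rewrite -(ler_nat R) => X2 h.
have hj : om%:R <= j%:R :> R by rewrite ler_nat.
have h2 : 2 <= om%:R :> R by rewrite (ler_nat R 2).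
apply: lt_le_trans h.
have : 2 * rho * om%:R <= 2 * rho * j%:R by rewrite ler_pM2l ?mulr_gt0.
(* For om = j and two pairs across, the margin is 2 (1 - th) (j - 1 - th), positive since j >= 2. *)
by rewrite rhoE in rho0 *; nra.
Qed.

Lemma clique_number_large (R : rcfType) (G : sgraph) (x : G -> R) (rho th : R)
    (j : nat) (K : {set G}) :
  is_eigenvector x rho -> 0 < rho -> rho = j%:R - th -> 0 <= th -> th < 1 ->
  (exists p, 0 < x p) -> (exists p, x p < 0) -> is_clique K ->
  (j + 3 <= #|K|)%N -> 2 * rho * #|K|%:R + 4 < (npairs (@edge G))%:R.
Proof.
move=> ev rho0 rhoE th0 th1 xpos xneg cK Kj.
have main : rho ^+ 2 + j%:R <=
    (npairs (fun p q => [&& @edge G p q & ~~ ((p \in K) && (q \in K))]))%:R.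
  have [S0|S0] := lerP (\sum_(p in K) x p) 0.
    exact: clique_deleted_npairs ev rho0 rhoE th1 xpos cK S0.
  apply: (clique_deleted_npairs (is_eigenvectorN ev) rho0 rhoE th1 _ cK).
    by case: xneg => p xp; exists p; rewrite oppr_gt0.
  by rewrite sumrN oppr_le0 ltW.
have -> : npairs (@edge G) = (npairs (within K) +
    npairs (fun p q => [&& @edge G p q & ~~ ((p \in K) && (q \in K))]))%N.
  rewrite -npairsU => [|a b /and3P[-> -> ->]]; last by [].
  by apply: eq_npairs => a b /=; rewrite /within; case: edge => //=; case: andb.
rewrite clique_npairs // natrD natrM.
have K0 : (0 < #|K|)%N by rewrite (leq_trans _ Kj) // addn3.
rewrite -subn1 natrB //.
have hK : j%:R + 3 <= #|K|%:R :> R by rewrite -natrD ler_nat.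
(* The surplus over 2 rho |K| is (|K| - rho - 1) (|K| - rho) + th. *)
have h2 : (2 + th) * (3 + th) <= (#|K|%:R - rho - 1) * (#|K|%:R - rho).
  by rewrite rhoE; apply: ler_pM; lra.
by rewrite rhoE in rho0 main h2 *; nra.
Qed.

Lemma straddling_across (R : rcfType) (G : sgraph) (x : G -> R) (K : {set G}) :
  is_clique K ->
  (#|K| * #|K|.-1 <= #|K :&: pos_set x| * #|K :&: pos_set x|.-1 +
    #|K :&: neg_set x| * #|K :&: neg_set x|.-1 +
    npairs (across (pos_set x) (neg_set x)))%N.
Proof.
move=> cK; have dis := pos_neg_disjoint x.
rewrite -(clique_npairs cK) (@npairs_split _ (within K) (pos_set x) (neg_set x)) => [|p q _].
  rewrite leq_add ?leq_add //.
  - rewrite -clique_npairs; last by apply: clique_sub cK; exact: subsetIl.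
    by apply: npairsS => p q /and3P[/and3P[e pK qK] pP qP]; rewrite /within e !in_setI pK qK pP qP.
  - rewrite -clique_npairs; last by apply: clique_sub cK; exact: subsetIl.
    by apply: npairsS => p q /and3P[/and3P[e pK qK] pP qP]; rewrite /within e !in_setI pK qK pP qP.
  - by apply: npairsS => p q /and3P[/and3P[e pK qK] pP qP]; rewrite /across e pP qP.
apply/negP => /and4P[pA _ pB _].
by move/pred0P/(_ p): dis; rewrite /= pA pB.
Qed.

(** By convexity the extreme split is 1 and s. *)
Lemma pairs_sum_le a b s : (0 < a)%N -> (0 < b)%N -> (a + b <= s.+1)%N ->
  (a * a.-1 + b * b.-1 <= s * s.-1)%N.
Proof.
case: a b => [//|a] [//|b] _ _ abs.
have -> : s = (a + b + (s - (a + b).+1)).+1 by lia.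
by move: (s - _)%N => k /=; nia.
Qed.

(** The same convexity, now with extreme split 2 and s. *)
Lemma pairs_sum_le2 a b s : (1 < a)%N -> (1 < b)%N -> (a + b <= s.+2)%N ->
  (a * a.-1 + b * b.-1 <= s * s.-1 + 2)%N.
Proof.
case: a b => [//|[//|a]] [//|[//|b]] _ _ abs.
have -> : s = (a + b + (s - (a + b).+2)).+2 by lia.
by move: (s - _)%N => k /=; nia.
Qed.

Lemma straddling_card (R : rcfType) (G : sgraph) (x : G -> R) (K : {set G}) :
  (#|K :&: pos_set x| + #|K :&: neg_set x| <= #|K|)%N.
Proof.
rewrite -cardsUI [X in (_ + #|pred_of_set X|)%N](_ : _ = set0) ?cards0 ?addn0; last first.
  rewrite -setIIr; have := pos_neg_disjoint x.
  by rewrite -setI_eq0 => /eqP ->; rewrite setI0.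
by apply: subset_leq_card; rewrite -setIUr subsetIl.
Qed.

(** After Stanley's bound on both sides, the pairs across must cover 2 j (1 + th) + 4 - 4 th - 2
    th^2 if |K| = j + 2, and 4 + 2 j th - 2 th - 2 th^2 if |K| = j + 1. The last hypothesis lists
    the splits for which this is achieved by counting. Left over are the split of j + 2 into 1 and j
    + 1, a triangle with j = 2 and fewer than 6 pairs across, and an edge with j = 1. *)
Lemma straddling_gt (R : rcfType) (G : sgraph) (x : G -> R) (rho th : R)
    (j : nat) (K : {set G}) :
  is_eigenvector x rho -> 0 < rho -> rho = j%:R - th -> 0 <= th -> th < 1 ->
  is_clique K ->
  let a := #|K :&: pos_set x| in let b := #|K :&: neg_set x| in
  (0 < a)%N -> (0 < b)%N ->
  [|| (#|K| == j + 2) && ((a + b < #|K|) || (1 < a) && (1 < b)),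
      (#|K| == j + 1) && (2 < j) |
      [&& #|K| == j + 1, j == 2 & 6 <= npairs (across (pos_set x) (neg_set x))]]%N ->
  2 * rho * #|K|%:R + 4 < (npairs (@edge G))%:R.
Proof.
move=> ev rho0 rhoE th0 th1 cK a b a0 b0 cond.
have ab : (a + b <= #|K|)%N by exact: straddling_card.
have := straddling_across x cK; rewrite -/a -/b => hX.
have [p] : exists p, p \in K :&: pos_set x by apply/set0Pn; rewrite -card_gt0.
have [q] : exists q, q \in K :&: neg_set x by apply/set0Pn; rewrite -card_gt0.
rewrite !inE oppr_gt0 => /andP[qK xq] /andP[pK xp].
have pq : edge p q.
  by move/is_cliqueP: cK => -> //; apply: contraTneq xp => ->; rewrite -leNgt ltW.
have := two_sided_gt ev rho0 rhoE th0 th1 pq xp xq.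
set X := npairs (across _ _) in hX cond *.
move=> h; apply: le_lt_trans h.
have jj : (0 < j)%N by rewrite -(ltr_nat R); lra.
case/or3P: cond => [/andP[/eqP Kj c]|/andP[/eqP Kj c]|/and3P[/eqP Kj /eqP c X6]].
(* The (j + 2) (j + 1) pairs of [K] minus at most j (j - 1) + 2 inside the parts leave 4 j. For j =
   1 both intersections cannot have two elements, which saves the 2. *)
- have [X4 X6] : ((2 <= j)%N -> (4 * j <= X)%N) /\ ((j < 2)%N -> (6 <= X)%N).
    have e : (a * a.-1 + b * b.-1 <= j * j.-1 + 2)%N /\
        ((j < 2)%N -> (a * a.-1 + b * b.-1 <= j * j.-1)%N).
      case/orP: c => [ab1|/andP[a1 b1]].
        by move: (@pairs_sum_le a b j a0 b0) ab1; rewrite Kj; clear; lia.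
      by have := @pairs_sum_le2 a b j a1 b1; move: a1 b1 ab; rewrite Kj; clear; lia.
    case: j {rhoE} jj Kj hX e c => // j _ Kj; rewrite Kj /= => hX [e1 e2] c.
    move: hX e1 e2; move: (a * a.-1)%N (b * b.-1)%N X; clear=> p q X hX e1 e2.
    by split=> hj; [nia | have := e2 hj; nia].
  rewrite Kj natrD rhoE in rho0 *.
  have [j2|j2] := leqP 2 j.
    have : 4 * j%:R <= X%:R :> R by rewrite -natrM ler_nat X4.
    have : 2 <= j%:R :> R by rewrite (ler_nat R 2).
    by nra.
  have : 6 <= X%:R :> R by rewrite (ler_nat R 6) X6.
  have j1 : j = 1%N by move: jj j2; clear; lia.
  by rewrite j1; nra.
- have X2 : (2 * j <= X)%N.
    have e : (a + b <= j.+1)%N by rewrite -addn1 -Kj.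
    have := pairs_sum_le a0 b0 e.
    case: j {rhoE jj} c Kj e hX => // j c Kj _; rewrite Kj /=.
    by move: (a * a.-1)%N (b * b.-1)%N X; clear=> p q X hX h; nia.
  rewrite Kj natrD rhoE in rho0 *.
  have : 2 * j%:R <= X%:R :> R by rewrite -natrM ler_nat X2.
  have : 3 <= j%:R :> R by rewrite (ler_nat R 3).
  by nra.
- rewrite Kj c rhoE c in rho0 *.
  have : 6 <= X%:R :> R by rewrite (ler_nat R 6).
  by nra.
Qed.

(** * Near equality in Stanley's bound *)

Section Top.
Variables (R : rcfType) (G : sgraph) (x : G -> R) (rho th : R) (j : nat) (u : G).
Local Notation P := (pos_set x).
Local Notation PP := (within P).
Hypotheses (ev : is_eigenvector x rho) (rho0 : 0 < rho) (xu : x u = 1)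
  (x_le1 : forall p, x p <= 1).
Hypotheses (rhoE : rho = j%:R - th) (th1 : th < 1).

(** The degree of [u] and [outside_degree] are integers: unless both are minimal, they alone give an
    excess of 1. *)
Lemma stanley_tight :
  rho ^+ 2 + j%:R + 1 <= (npairs PP)%:R \/
  [/\ deg PP u = j, outside_degree PP u = 0%N &
    (npairs PP)%:R = rho ^+ 2 + j%:R + rho * neg x u +
      \sum_(w | PP u w) neg x w + slack PP x u].
Proof.
have st := stanley ev xu; have dj := deg_ge_j ev xu x_le1 rhoE th1.
have n1 : 0 <= rho * neg x u by rewrite mulr_ge0 ?neg_ge0 // ltW.
have n2 := sum_neg_ge0 x u; have n3 := slack_ge0 u x_le1.
have [o0|o0] := posnP (outside_degree PP u); last first.
  left; have h1 : 1 <= (outside_degree PP u)%:R :> R by rewrite ler1n.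
  have h2 : j%:R <= (deg PP u)%:R :> R by rewrite ler_nat.
  by rewrite st; move: rho0; lra.
move: dj; rewrite leq_eqVlt => /orP[/eqP dj|dj]; last first.
  left; have h2 : j%:R + 1 <= (deg PP u)%:R :> R by rewrite natr1 ler_nat.
  have h1 : 0 <= (outside_degree PP u)%:R :> R by [].
  by rewrite st; move: rho0; lra.
right; split => //; rewrite st -dj o0 mulr0n; ring.
Qed.

Lemma outside0_adj p : outside_degree PP u = 0%N -> p \in P -> p != u -> PP u p.
Proof.
move=> o0 pP pu; apply/negPn/negP => up.
have := outside_ge pP pu up; rewrite o0 leqn0.
by have := within_deg_gt0 ev rho0 pP; case: deg.
Qed.

Lemma outside0_card : outside_degree PP u = 0%N -> #|P| = (deg PP u).+1.
Proof.
move=> o0; rewrite (cardsD1 u) (top_pos xu) deg_card add1n; congr _.+1.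
apply: eq_card => p; rewrite !inE; apply/andP/idP => [[pu pP]|].
  by apply: outside0_adj => //; rewrite inE.
case/and3P => up _; rewrite inE => xp; split => //.
by apply: contraTneq up => ->; rewrite edge_irr.
Qed.
End Top.

Lemma edge_within (G : sgraph) (A : {set G}) p q : within A p q -> edge p q.
Proof. by case/and3P. Qed.

Lemma neg_ge (R : rcfType) (G : sgraph) (x : G -> R) p q :
  edge p q -> x q < 0 -> - x q <= neg x p.
Proof.
move=> pq xq; rewrite /neg (bigD1 q) ?pq //= lerDl.
by apply: sumr_ge0 => i /andP[/andP[_ h] _]; rewrite oppr_ge0 ltW.
Qed.

(* The excesses over Stanley's bound on the two sides cannot both be small: the
   negative neighbour n of the top u lowers the rows of u and p1, and symmetrically. *)
Lemma straddling_triangle_gt (R : rcfType) (G : sgraph) (x : G -> R) (rho th : R)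
    (K : {set G}) :
  is_eigenvector x rho -> 0 < rho -> rho = 2%:R - th -> 0 <= th -> th < 1 ->
  is_clique K -> #|K| = 3%N -> #|K :&: pos_set x| = 2%N -> #|K :&: neg_set x| = 1%N ->
  (forall K' : {set G}, is_clique K' -> #|K'| = 3%N -> ~~ (K' \subset pos_set x)) ->
  2 * rho * 3 + 4 < (npairs (@edge G))%:R.
Proof.
move=> ev rho0 rhoE th0 th1 cK K3 KP KN noT.
have := straddling_across x cK; rewrite K3 KP KN /= => X4.
have [p pP] : exists p, p \in K :&: pos_set x by apply/card_gt0P; rewrite KP.
have /cards1P[n nE] : #|K :&: neg_set x| == 1%N by rewrite KN.
have : n \in K :&: neg_set x by rewrite nE inE.
rewrite !inE oppr_gt0 => /andP[nK xn].
have xpos : exists p, 0 < x p by exists p; move: pP; rewrite !inE => /andP[].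
have xneg : exists p, 0 < - x p by exists n; rewrite oppr_gt0.
have [c [u [c0 ev1 xu le1]]] := exists_top ev xpos.
have [c' [u' [c0' ev2 xu' le1']]] := exists_top (is_eigenvectorN ev) xneg.
set z := fun p => c * x p in ev1 xu le1; set y := fun p => c' * - x p in ev2 xu' le1'.
have zP : pos_set z = pos_set x by exact: pos_setZ.
have yP : pos_set y = neg_set x by exact: pos_setZ.
rewrite (disjoint_edge_split (pos_neg_disjoint x)) !natrD.
have X4R : 4 <= (npairs (across (pos_set x) (neg_set x)))%:R :> R.
  by rewrite (ler_nat R 4); lia.
have g1 := pos_npairs_ge ev rho0 rhoE th1 xpos.
have g2 := pos_npairs_ge (is_eigenvectorN ev) rho0 rhoE th1 xneg.
have t1 := stanley_tight ev1 rho0 xu le1 rhoE th1; rewrite zP in t1.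
have t2 := stanley_tight ev2 rho0 xu' le1' rhoE th1; rewrite yP in t2.
set A := (npairs (within (pos_set x)))%:R in t1 g1 *.
set B := (npairs (within (neg_set x)))%:R in t2 g2 *.
clearbody A B.
(* With four pairs across, the two-sided bound falls short by 2 th (1 - th), which is at most
   1/2. *)
suff : 1 / 2 < (A - rho ^+ 2 - 2%:R) + (B - rho ^+ 2 - 2%:R).
  by move=> h; have := sqr_ge0 (th - 1 / 2); rewrite rhoE in h *; nra.
case: t1 => [t1|[d1 o1 t1]]; first lra.
case: t2 => [t2|[d2 o2 t2]]; first lra.
have o1' : outside_degree (within (pos_set z)) u = 0%N by rewrite zP.
have o2' : outside_degree (within (pos_set y)) u' = 0%N by rewrite yP.
have adj1 := outside0_adj ev1 rho0 o1'; rewrite zP in adj1.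
have adj2 := outside0_adj ev2 rho0 o2'; rewrite yP in adj2.
have uP : u \in pos_set x by rewrite -zP (top_pos xu).
have cl := is_cliqueP _ cK.
(* [u] is adjacent to the rest of the positive part; outside [K] it would form a positive triangle
   with the two positive vertices of [K]. *)
have uK : u \in K.
  apply: contraT => uK.
  suff : is_clique (u |: K :&: pos_set x).
    move=> /noT; rewrite cardsU1 !inE (negPf uK) /= KP => /(_ erefl).
    rewrite subUset sub1set uP /= => /negP[]; exact: subsetIr.
  apply/is_cliqueP => a b; rewrite !in_setU1 => /orP[/eqP->|aP] /orP[/eqP->|bP] ab.
  - by rewrite eqxx in ab.
  - by apply: (edge_within (adj1 _ _ _)); [case/setIP: bP|rewrite eq_sym].
  - by rewrite edge_sym; apply: (edge_within (adj1 _ _ _)); [case/setIP: aP|].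
  - by apply: cl => //; [case/setIP: aP|case/setIP: bP].
have [q] : exists q, q \in (K :&: pos_set x) :\ u.
  by apply/card_gt0P; have := cardsD1 u (K :&: pos_set x); rewrite in_setI uK uP KP; case: #|_ :\ _|.
rewrite !inE => /and3P[qu qK xq].
have nu : n != u by apply: contraTneq uP => <-; rewrite inE -leNgt ltW.
have nq : n != q by apply: contraTneq xq => <-; rewrite -leNgt ltW.
have un : edge u n by apply: cl => //; rewrite eq_sym.
have qn : edge q n by apply: cl => //; rewrite eq_sym.
(* [y] and [z] are multiples of opposite sign of the same vector; [r] is the ratio of their
   scales. *)
pose r := c' / c; have r0 : 0 < r by rewrite divr_gt0.
have yE a : y a = - r * z a.
  by rewrite /y /z /r; field; rewrite gt_eqF.
have zn : z n < 0 by rewrite /z pmulr_rlt0.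
have zq : 0 < z q by rewrite /z mulr_gt0.
have zu : z u = 1 by [].
have rho1 : 1 <= rho by lra.
pose b := - z n; have b0 : 0 < b by rewrite /b; lra.
have s1 : 0 <= slack (within (pos_set x)) z u by have := slack_ge0 u le1; rewrite zP.
have s2 : 0 <= slack (within (neg_set x)) y u' by have := slack_ge0 u' le1'; rewrite yP.
(* [n] is a negative neighbour of both [u] and [q], so its weight [b] enters twice, at [u] with a
   factor rho >= 1. *)
have e1 : 2 * b <= A - rho ^+ 2 - 2%:R.
  have h1 : b <= neg z u := neg_ge un zn.
  have h2 : b <= \sum_(w | within (pos_set x) u w) neg z w.
    apply: le_trans (neg_ge qn zn) _; rewrite -zP; apply: sum_neg_ge.
    by rewrite zP; apply: adj1 => //; rewrite inE.
  have h3 : b <= rho * neg z u by nra.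
  by rewrite t1; lra.
have yu : y u < 0 by rewrite yE zu mulr1 oppr_lt0.
have yq : y q < 0 by rewrite yE mulNr oppr_lt0 mulr_gt0.
have yn : y n = r * b by rewrite yE /b; ring.
have negn : r <= neg y n.
  have nu' : edge n u by rewrite edge_sym.
  apply: le_trans (neg_ge nu' yu); rewrite yE zu; lra.
(* Either [n] is the top of the negative side and r b = 1, or it is adjacent to that top and its row
   bounds r b from below. *)
have [e|nu'] := eqVneq n u'.
  have e2 : rho * r <= B - rho ^+ 2 - 2%:R.
    have h2 : 0 <= \sum_(w | within (neg_set x) u' w) neg y w.
      by rewrite -yP; exact: sum_neg_ge0.
    have h3 : rho * r <= rho * neg y u' by rewrite -e ler_pM2l.
    by rewrite t2; move: h2 h3 s2; clear; lra.
  have h : r * b = 1 by rewrite -yn e.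
  by nra.
have nP : n \in neg_set x by rewrite inE oppr_gt0.
have un' : within (neg_set x) u' n by apply: adj2.
have e2 : neg y n <= B - rho ^+ 2 - 2%:R.
  have h2 : neg y n <= \sum_(w | within (neg_set x) u' w) neg y w.
    by rewrite -yP; apply: sum_neg_ge; rewrite yP.
  have h3 : 0 <= rho * neg y u' by rewrite mulr_ge0 ?neg_ge0 // ltW.
  by rewrite t2; move: h2 h3 s2; clear; lra.
have row : 1 <= rho * y n + neg y n.
  have nP' : n \in pos_set y by rewrite yP.
  rewrite -(within_row ev2 nP') (bigD1 u') /=; last by rewrite yP within_sym.
  rewrite -[y u']/(c' * - x u') xu' lerDl; apply: sumr_ge0 => i /andP[/and3P[_ _]].
  by rewrite inE => /ltW.
have h1 : 1 - neg y n <= 2 * (r * b).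
  have yn0 : 0 < y n by rewrite yn mulr_gt0.
  have : rho * y n <= 2 * y n by rewrite ler_pM2r // rhoE; move: th0; clear; lra.
  by rewrite -yn; move: row; clear; lra.
have [hs|hs] := lerP (neg y n) (1 / 2); last by move: e1 e2 hs b0; clear; lra.
have h2 : r * b <= neg y n * b by rewrite ler_pM2r.
have h3 : neg y n * b <= 1 / 2 * b by rewrite ler_pM2r.
by move: e1 e2 h1 h2 h3 hs; clear; lra.
Qed.

Lemma neg_eq0 (R : rcfType) (G : sgraph) (x : G -> R) p :
  (forall q, edge p q -> 0 <= x q) -> neg x p = 0.
Proof.
move=> h; rewrite /neg big_pred0 // => q; apply/negP => /andP[pq].
by rewrite ltNge h.
Qed.

Lemma outside_ge2 (R : rcfType) (G : sgraph) (x : G -> R) rho u v w :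
  is_eigenvector x rho -> 0 < rho -> v != w ->
  v \in pos_set x -> v != u -> ~~ within (pos_set x) u v ->
  w \in pos_set x -> w != u -> ~~ within (pos_set x) u w ->
  (2 <= outside_degree (within (pos_set x)) u)%N.
Proof.
move=> ev rho0 vw vP vu uv wP wu uw.
have hv := within_deg_gt0 ev rho0 vP; have hw := within_deg_gt0 ev rho0 wP.
rewrite /outside_degree (bigD1 v) ?vu //= (bigD1 w) ?wu ?uw ?(eq_sym w) //=.
by rewrite addnA (leq_trans _ (leq_addr _ _)) // (leq_add hv hw).
Qed.

(** If [across] is empty, the rows of the vertices of [K] other than [v] show that they share one
    value -m and that x v = th m. The weight g of the negative neighbours of [v] then satisfies th g
    = (j + 1) x v, so it is large against x v. The required excess is found according to whether [v]
    is [u], adjacent to [u], or neither. *)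
Lemma glued_clique_gt (R : rcfType) (G : sgraph) (x : G -> R) (rho th : R) (j : nat)
    (K : {set G}) (u v : G) :
  is_eigenvector x rho -> 0 < rho -> rho = j%:R - th -> 0 <= th -> th < 1 ->
  x u = 1 -> (forall p, x p <= 1) ->
  is_clique K -> #|K| = (j + 2)%N -> v \in K -> 0 < x v ->
  (forall p, p \in K -> p != v -> x p < 0) ->
  2 * rho * #|K|%:R + 4 < (npairs (@edge G))%:R.
Proof.
move=> ev rho0 rhoE th0 th1 xu le1 cK Kj vK xv Kneg.
have cl := is_cliqueP _ cK.
have jj : (0 < j)%N by rewrite -(ltr_nat R); lra.
have j1 : 1 <= j%:R :> R by rewrite ler1n.
have KP p : p \in K -> p \in pos_set x -> p = v.
  by move=> pK; rewrite inE; apply: contraTeq => pv; rewrite -leNgt ltW ?Kneg.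
rewrite (@npairs_edge_split G K (pos_set x)) => [|p q pq]; last first.
  apply/negP => /and4P[pK qK pP qP]; move: pq.
  by rewrite (KP p) // (KP q) // edge_irr.
rewrite clique_npairs // Kj addn2 /= !natrD natrM -!(natr1 j.+1) -!(natr1 j).
(* What remains of 2 rho (j + 2) + 4 after the (j + 2) (j + 1) pairs of [K]. *)
suff : rho ^+ 2 + j%:R + 2 - 4 * th - th ^+ 2 <
    (npairs (within (pos_set x)))%:R + (npairs (across K (pos_set x)))%:R.
  by move=> h; rewrite rhoE in h *; lra.
have cK1 : #|K :\ v| = j.+1.
  by have := cardsD1 v K; rewrite vK Kj addn2 add1n => /succn_inj.
have [k kK kv] : exists2 k, k \in K & k != v.
  have : (0 < #|K :\ v|)%N by rewrite cK1.
  by case/card_gt0P => k; rewrite !inE => /andP[kv kK]; exists k.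
have vk : edge v k by apply: cl => //; rewrite eq_sym.
have [Y0|Y0] := posnP (npairs (across K (pos_set x))); last first.
  have Y2 : 2 <= (npairs (across K (pos_set x)))%:R :> R.
    rewrite (ler_nat R 2).
    by move: Y0; have [m ->] := across_even K (pos_set x); case: m.
  have := stanley_gt ev rho0 xu le1 rhoE th1 vk xv (Kneg _ kK kv).
  by have := sqr_ge0 th; lra.
rewrite Y0 addr0; have Yf := npairs0 Y0.
have inK p q : p \in K -> p != v -> edge p q -> q \in K.
  move=> pK pv pq; have := Yf p q; rewrite /across pq pK /=.
  by case: (q \in K) => //=; rewrite inE (lt_gtF (Kneg _ pK pv)).
pose S := \sum_(q in K) x q.
have rowK p : p \in K -> p != v -> S = (rho + 1) * x p.
  move=> pK pv; rewrite /S (bigD1 p) //= mulrDl mul1r -ev addrC; congr (_ + _).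
  apply: eq_bigl => q; apply/andP/idP => [[qK qp]|pq].
    by apply: cl => //; rewrite eq_sym.
  split; first exact: inK pq.
  by apply: contraTneq pq => ->; rewrite edge_irr.
pose m := - x k; have m0 : 0 < m by rewrite oppr_gt0 Kneg.
have Km p : p \in K -> p != v -> x p = - m.
  move=> pK pv; apply: (@mulfI _ (rho + 1)); first by apply: lt0r_neq0; lra.
  by rewrite -rowK // (rowK k) // opprK.
have SK : \sum_(q in K :\ v) x q = - (j%:R + 1) * m.
  rewrite (eq_bigr (fun _ => - m)) => [|q]; last by rewrite !inE => /andP[? ?]; exact: Km.
  by rewrite sumr_const cK1 -[LHS]mulr_natl -natr1; ring.
have eS : S = x v - (j%:R + 1) * m.
  by rewrite /S (big_setD1 v vK) /= SK; ring.
have xvE : x v = th * m.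
  have := rowK k kK kv; rewrite eS (Km k) // rhoE; lra.
pose g := neg x v.
have gE : g = (j%:R + 1) * m.
  rewrite /g /neg sumrN (eq_bigl (fun q => q \in K :\ v)) => [|q]; first by rewrite SK; ring.
  rewrite !inE; apply/andP/andP => [[vq xq]|[qv qK]].
    split; first by apply: contraTneq vq => ->; rewrite edge_irr.
    have := Yf v q; rewrite /across vq vK /= [v \in _]inE xv /= inE.
    by rewrite (lt_gtF xq) andbT => /negbFE.
  by split; [apply: cl; rewrite // eq_sym | exact: Kneg].
have thg : th * g = (j%:R + 1) * x v by rewrite gE xvE; ring.
have th_gt0 : 0 < th.
  by rewrite lt_neqAle th0 andbT; apply: contraTneq xv => e; rewrite xvE -e mul0r ltxx.
have g0 : 0 < g by rewrite gE mulr_gt0 //; lra.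
have neg_other w : w \in pos_set x -> w != v -> neg x w = 0.
  move=> wP wv; apply: neg_eq0 => q wq; have := Yf w q; rewrite /across wq wP /=.
  case wK: (w \in K) => /=; first by rewrite (KP w) ?eqxx in wv.
  by move/negbFE; rewrite inE => /ltW.
have st := stanley ev xu; have dj := deg_ge_j ev xu le1 rhoE th1.
have sl := slack_ge0 u le1; have sn := sum_neg_ge0 x u.
have ou : 0 <= (outside_degree (within (pos_set x)) u)%:R :> R by [].
have vP : v \in pos_set x by rewrite inE.
have djR : j%:R <= (deg (within (pos_set x)) u)%:R :> R by rewrite ler_nat.
have rng : 0 <= rho * neg x u by rewrite mulr_ge0 ?neg_ge0 // ltW.
clear eS SK cK1 Km rowK inK Yf Y0 m0 eS xvE gE.
have [vu|vu] := eqVneq v u.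
  have xv1 : x v = 1 by rewrite vu.
  rewrite st -vu -/g in rng *; rewrite xv1 mulr1 in thg.
  suff : 2 - 4 * th - th ^+ 2 < rho * g by rewrite -vu in ou sl sn djR *; lra.
  have gj : j%:R + 1 <= g by nra.
  have [j2|j2] := leqP 2 j.
    have : 2 <= j%:R :> R by rewrite (ler_nat R 2).
    by rewrite rhoE; nra.
  have j1' : j = 1%N by apply/eqP; rewrite eqn_leq jj andbT -ltnS.
  rewrite rhoE j1' in thg gj *.
  rewrite -(ltr_pM2l th_gt0).
  have -> : th * ((1 - th) * g) = 2 * (1 - th) by rewrite mulrCA thg; ring.
  by nra.
have nu0 : neg x u = 0 by apply: neg_other; rewrite ?(top_pos xu) // eq_sym.
have rv := within_row ev vP; rewrite -/g in rv.
have [uv|uv] := boolP (within (pos_set x) u v).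
  have sg : g <= \sum_(w | within (pos_set x) u w) neg x w := sum_neg_ge uv.
  have row : 1 <= rho * x v + g.
    rewrite -rv (bigD1 u) /=; last by rewrite within_sym.
    rewrite xu lerDl; apply: sumr_ge0 => i /andP[/and3P[_ _]].
    by rewrite inE => /ltW.
  move: dj; rewrite leq_eqVlt => /orP[/eqP dj|dj].
    (* With degree exactly j, the neighbours of [u] miss the value 1 by j - rho in total. *)
    have : \sum_(w | within (pos_set x) u w) (1 - x w) = th.
      rewrite sumrB -degE -dj (within_row ev) ?(top_pos xu) // xu nu0 rhoE; ring.
    rewrite (bigD1 v) //= => e.
    have xv1 : 1 - x v <= th.
      by rewrite -e lerDl; apply: sumr_ge0 => i _; rewrite subr_ge0.
    have h : 2 * (1 - th) <= th * g by rewrite thg; nra.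
    suff : 2 - 4 * th - th ^+ 2 < g by rewrite st; lra.
    by rewrite -(ltr_pM2l th_gt0); nra.
  have h2 : j%:R + 1 <= (deg (within (pos_set x)) u)%:R :> R by rewrite natr1 ler_nat.
  have h : 1 <= g * (1 + th).
    have : (j%:R + 1) * (rho * x v) <= (j%:R + 1) * (th * g).
      have -> : (j%:R + 1) * (rho * x v) = rho * (th * g) by rewrite thg; ring.
      by rewrite ler_pM2r ?mulr_gt0 //; lra.
    by rewrite ler_pM2l; lra.
  have : 1 - th <= g by nra.
  by rewrite st; have := sqr_ge0 th; lra.
have ow := outside_ge vP vu uv; have dv := within_deg_gt0 ev rho0 vP.
have [o2|o2] := leqP 2 (outside_degree (within (pos_set x)) u).
  have : 2 <= (outside_degree (within (pos_set x)) u)%:R :> R by rewrite (ler_nat R 2).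
  by rewrite st; have := sqr_ge0 th; lra.
(* An outside degree below 2 leaves [v] pendant in the part. Its neighbour [w] must be adjacent to
   [u], and the walk u, w, v contributes 1 - x v to the slack. *)
have dv1 : deg (within (pos_set x)) v = 1%N.
  by apply/eqP; rewrite eqn_leq dv andbT -ltnS (leq_ltn_trans ow).
have /cards1P[w wE] : #|[set q | within (pos_set x) v q]| == 1%N by rewrite -deg_card dv1.
have vw : within (pos_set x) v w by have := set11 w; rewrite -wE inE.
have wP : w \in pos_set x by case/and3P: vw.
have wu : w != u by apply: contraNneq uv => <-; rewrite within_sym.
have uw : within (pos_set x) u w.
  have nvw : v != w by apply: contraTneq vw => <-; rewrite within_irr.
  by apply: contraTT o2 => uw; rewrite -leqNgt; apply: (outside_ge2 ev rho0 nvw vP vu uv wP wu uw).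
have s1 : 1 - x v <= slack (within (pos_set x)) x u.
  by apply: slack_ge uw _ => //; rewrite within_sym.
have g1 : rho * x v + g <= 1.
  rewrite -rv (eq_bigl (fun q => q == w)) ?big_pred1_eq // => q.
  by have := congr1 (fun A : {set G} => q \in A) wE; rewrite !inE.
have h1 : 0 < rho * x v by rewrite mulr_gt0.
have h2 : 2 * x v <= th * g by rewrite thg; nra.
have h3 : th * g <= th by rewrite -[leRHS]mulr1 ler_pM2l //; lra.
have h4 : 1 <= (outside_degree (within (pos_set x)) u)%:R :> R by rewrite ler1n (leq_trans dv ow).
by rewrite st; have := sqr_ge0 th; lra.
Qed.

(** * Cliques avoiding the positive part *)

Section Recognition.
Variable G : sgraph.
Implicit Types K A : {set G}.

Lemma link_edge_recognition K A k o :
  [disjoint K & A] -> (forall p, (p \in K) || (p \in A)) ->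
  is_clique K -> is_clique A -> k \in K -> o \in A ->
  (forall p q, p \in K -> q \in A -> edge p q = (p == k) && (q == o)) ->
  cliques_linked_by_edge G #|K| #|A|.
Proof.
move=> dKA cov /is_cliqueP cK /is_cliqueP cA kK oA eKA.
have inA p : p \notin K -> p \in A by move=> h; have := cov p; rewrite (negPf h).
pose rK := enum_rank_in kK; pose rA := enum_rank_in oA.
pose f p : 'I_#|K| + 'I_#|A| := if p \in K then inl (rK p) else inr (rA p).
have rKI p q : p \in K -> q \in K -> (rK p == rK q) = (p == q).
  move=> pK qK; apply/eqP/eqP => [h|-> //].
  by rewrite -(enum_rankK_in kK pK) -(enum_rankK_in kK qK) -/rK h.
have rAI p q : p \in A -> q \in A -> (rA p == rA q) = (p == q).
  move=> pK qK; apply/eqP/eqP => [h|-> //].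
  by rewrite -(enum_rankK_in oA pK) -(enum_rankK_in oA qK) -/rA h.
exists (rK k), (rA o), f; split.
  apply: inj_card_bij.
    move=> p q; rewrite /f; case: ifP => pK; case: ifP => qK // [] /eqP.
      by rewrite rKI // => /eqP.
    by rewrite rAI ?inA ?pK ?qK // => /eqP.
  rewrite card_sum !card_ord -cardsUI.
  have /eqP -> : K :&: A == set0 by rewrite setI_eq0.
  by rewrite cards0 addn0 max_card.
move=> p q; rewrite /f; case: ifPn => pK; case: ifPn => qK /=.
- rewrite rKI //; case: eqVneq => [->|pq]; first by rewrite edge_irr.
  by rewrite cK.
- by have qA := inA q qK; rewrite rKI // rAI // eKA.
- by have pA := inA p pK; rewrite rKI // rAI // edge_sym eKA.
- rewrite rAI ?inA //; case: eqVneq => [->|pq]; first by rewrite edge_irr.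
  by rewrite cA ?inA.
Qed.

Lemma link_path_recognition K A z k o : #|A| = #|K| ->
  [disjoint K & A] -> z \notin K -> z \notin A ->
  (forall p, [|| p == z, p \in K | p \in A]) ->
  is_clique K -> is_clique A -> k \in K -> o \in A ->
  (forall p q, p \in K -> q \in A -> edge p q = false) ->
  (forall p, p \in K -> edge z p = (p == k)) ->
  (forall p, p \in A -> edge z p = (p == o)) ->
  cliques_linked_by_path G #|K|.
Proof.
move=> AK dKA zK zA cov /is_cliqueP cK /is_cliqueP cA kK oA eKA ezK ezA.
have inA p : p != z -> p \notin K -> p \in A.
  by move=> h1 h2; have := cov p; rewrite (negPf h1) (negPf h2).
pose rK := enum_rank_in kK.
have [rA rAI] : exists rA : G -> 'I_#|K|,
    forall p q, p \in A -> q \in A -> (rA p == rA q) = (p == q).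
  exists (fun p => cast_ord AK (enum_rank_in oA p)) => p q pK qK.
  apply/eqP/eqP => [h|-> //]; have {}h := cast_ord_inj h.
  by rewrite -(enum_rankK_in oA pK) -(enum_rankK_in oA qK) h.
pose f p : option ('I_#|K| + 'I_#|K|) :=
  if p == z then None else if p \in K then Some (inl (rK p)) else Some (inr (rA p)).
have rKI p q : p \in K -> q \in K -> (rK p == rK q) = (p == q).
  move=> pK qK; apply/eqP/eqP => [h|-> //].
  by rewrite -(enum_rankK_in kK pK) -(enum_rankK_in kK qK) -/rK h.
exists (rK k), (rA o), f; split.
  apply: inj_card_bij.
    move=> p q; rewrite /f; case: eqVneq => [->|pz]; case: eqVneq => [->|qz] //.
    - by case: ifP.
    - by case: ifP.
    - case: ifP => pK; case: ifP => qK // [] /eqP.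
        by rewrite rKI // => /eqP.
      by rewrite rAI ?inA ?pK ?qK // => /eqP.
  rewrite card_option card_sum !card_ord.
  have -> : (#|K| + #|K| = #|K :|: A|)%N.
    rewrite -{2}AK -cardsUI; have /eqP -> : K :&: A == set0 by rewrite setI_eq0.
    by rewrite cards0 addn0.
  by rewrite -add1n -(_ : #|z |: (K :|: A)| = (1 + #|K :|: A|)%N) ?max_card //
    cardsU1 inE (negPf zK) (negPf zA).
move=> p q; rewrite /f; case: eqVneq => [->|pz]; case: eqVneq => [->|qz] /=.
- by rewrite edge_irr.
- case: ifPn => qK /=; first by rewrite rKI // ezK.
  by have qA := inA q qz qK; rewrite rAI // ezA.
- rewrite edge_sym; case: ifPn => pK /=; first by rewrite rKI // ezK.
  by have pA := inA p pz pK; rewrite rAI // ezA.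
case: ifPn => pK; case: ifPn => qK /=.
- rewrite rKI //; case: eqVneq => [->|pq]; first by rewrite edge_irr.
  by rewrite cK.
- by have qA := inA q qz qK; rewrite eKA.
- by have pA := inA p pz pK; rewrite edge_sym eKA.
- rewrite rAI ?inA //; case: eqVneq => [->|pq]; first by rewrite edge_irr.
  by rewrite cA ?inA.
Qed.

(** [across] counts every edge inside neither set, also at vertices outside both, and counts it
    twice; so there is exactly one. Connectedness would demand another one if it did not join [K] to
    [A] or if some vertex were left over. *)
Lemma bridge_structure K A : connected_graph G -> [disjoint K & A] ->
  (exists p, p \in K) -> (exists p, p \in A) -> npairs (across K A) = 2%N ->
  (forall p, (p \in K) || (p \in A)) /\
  exists k o, [/\ k \in K, o \in A &
    forall p q, p \in K -> q \in A -> edge p q = (p == k) && (q == o)].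
Proof.
move=> cG dKA [k0 k0K] [o0 o0A] e2.
have nKA p : p \in K -> p \in A -> False.
  by move=> pK pA; move/pred0P/(_ p): dKA; rewrite /= pK pA.
have kA p : p \in K -> p \notin A by move=> pK; apply/negP => /(nKA _ pK).
have aK p : p \in A -> p \notin K by move=> pA; apply/negP => pK; exact: nKA pK pA.
have [||o [k [oA kA' ok]]] := @connected_cut G A cG; first by exists o0.
  by exists k0; exact: kA.
have aok : across K A o k.
  by rewrite /across ok (negPf (aK _ oA)) (negPf kA') andbF.
have uniq2 a b := npairs2 (@across_sym _ _ _) (@across_irr _ _ _) e2 aok (a := a) (b := b).
have kK : k \in K.
  apply: contraT => kK.
  have [||a [b]] := @connected_cut G (k |: A) cG.
  - by exists k; rewrite !inE eqxx.
  - exists k0; rewrite !inE negb_or kA // andbT.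
    by apply: contraNneq kK => <-.
  rewrite !inE negb_or => [] [aA /andP[bk bA] ab].
  have : across K A a b.
    rewrite /across ab (negPf bA) andbF andbT /=; apply/negP => /andP[aK' _].
    by case/orP: aA => [/eqP ea|/aK]; [rewrite -ea aK' in kK | rewrite aK'].
  by case/uniq2 => [] [ea eb]; [rewrite eb eqxx in bk | rewrite eb oA in bA].
split.
  move=> p; apply: contraT; rewrite negb_or => /andP[pK pA].
  have [||a [b]] := @connected_cut G (K :|: A) cG.
  - by exists k; rewrite !inE kK.
  - by exists p; rewrite !inE negb_or pK pA.
  rewrite !inE negb_or => [] [aA /andP[bK bA] ab].
  have : across K A a b by rewrite /across ab (negPf bK) (negPf bA) !andbF.
  by case/uniq2 => [] [ea eb]; [rewrite eb kK in bK | rewrite eb oA in bA].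
exists k, o; split => // p q pK qA; apply/idP/andP => [pq|[/eqP -> /eqP ->]]; last first.
  by rewrite edge_sym.
have : across K A p q.
  by rewrite /across pq (negPf (aK _ qA)) (negPf (kA _ pK)) andbF.
by case/uniq2 => [] [ea eb]; [rewrite ea (negPf (aK _ oA)) in pK | rewrite ea eb].
Qed.
End Recognition.

Lemma clique_pos_npairs (R : rcfType) (G : sgraph) (x : G -> R) (K : {set G}) :
  is_clique K -> [disjoint K & pos_set x] ->
  (npairs (@edge G))%:R = #|K|%:R * (#|K|%:R - 1) +
    (npairs (within (pos_set x)))%:R + (npairs (across K (pos_set x)))%:R :> R.
Proof.
move=> cK dK; rewrite (disjoint_edge_split dK) clique_npairs // !natrD natrM.
congr (_ + _ + _); case: #|K| => [|m] /=; first by rewrite !mul0r.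
by rewrite -[m.+1%:R]natr1 addrK.
Qed.

(** Equality with th = 0 kills every excess: [u] has degree j and sees the whole part, its
    neighbours sum to j and so all carry 1, and j (j + 1) pairs on j + 1 vertices make a clique. *)
Lemma tight_pos_set (R : rcfType) (G : sgraph) (x : G -> R) (rho : R) (j : nat) (u : G) :
  is_eigenvector x rho -> 0 < rho -> rho = j%:R ->
  x u = 1 -> (forall p, x p <= 1) ->
  (npairs (within (pos_set x)))%:R = rho ^+ 2 + j%:R ->
  [/\ #|pos_set x| = j.+1, is_clique (pos_set x), forall p, p \in pos_set x -> x p = 1 &
    forall p q, p \in pos_set x -> edge p q -> 0 <= x q].
Proof.
move=> ev rho0 rhoE xu le1 e.
have rhoE' : rho = j%:R - 0 by rewrite subr0.
case: (stanley_tight ev rho0 xu le1 rhoE' ltr01) => [h|[d1 o1 st]]; first lra.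
have n1 : 0 <= rho * neg x u by rewrite mulr_ge0 ?neg_ge0 // ltW.
have n2 := sum_neg_ge0 x u; have n3 := slack_ge0 u le1.
have nu : neg x u = 0.
  by apply: (mulfI (lt0r_neq0 rho0)); rewrite mulr0; lra.
have adj p := outside0_adj ev rho0 o1 (p := p).
have cP : #|pos_set x| = j.+1 by rewrite (outside0_card ev rho0 xu o1) d1.
split => //.
- apply: npairs_clique; rewrite cP; apply/eqP; rewrite -(eqr_nat R) e rhoE /=.
  by rewrite natrM -natr1; apply/eqP; ring.
- move=> p pP; have [-> //|pu] := eqVneq p u.
  have : \sum_(w | within (pos_set x) u w) (1 - x w) = 0.
    rewrite sumrB -degE d1 (within_row ev) ?(top_pos xu) // xu nu rhoE; ring.
  move/eqP; rewrite psumr_eq0 => [|w _]; last by rewrite subr_ge0.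
  move/allP/(_ p (mem_index_enum _)); rewrite adj // subr_eq0 => /eqP <- //.
- move=> p q pP pq; rewrite leNgt; apply/negP => xq.
  have := neg_gt0 pq xq; have [->|pu] := eqVneq p u; first by rewrite nu ltxx.
  have up := adj p pP pu; have := sum_neg_ge up; lra.
Qed.

Lemma case_linked_by_edge (R : rcfType) (G : sgraph) (x : G -> R) (rho th : R) (j : nat)
    (K : {set G}) (u : G) : connected_graph G ->
  is_eigenvector x rho -> 0 < rho -> rho = j%:R - th -> 0 <= th -> th < 1 ->
  x u = 1 -> (forall p, x p <= 1) ->
  is_clique K -> #|K| = (j + 2)%N -> [disjoint K & pos_set x] ->
  2 * rho * #|K|%:R + 4 < (npairs (@edge G))%:R \/
  2 * rho * #|K|%:R + 4 = (npairs (@edge G))%:R /\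
    cliques_linked_by_edge G (j + 2) (j + 1).
Proof.
move=> cG ev rho0 rhoE th0 th1 xu le1 cK Kj dK.
have nP := stanley_ge ev rho0 xu le1 rhoE th1.
have eK : exists p, p \in K by apply/card_gt0P; rewrite Kj addn2.
have eP : exists p, p \in pos_set x by exists u; rewrite (top_pos xu).
have [||o [k [oP kP ok]]] := @connected_cut G (pos_set x) cG => //.
  case: eK => k kK; exists k; apply/negP => kP.
  by move/pred0P/(_ k): dK; rewrite /= kK kP.
have aok : across K (pos_set x) o k.
  rewrite /across ok (negPf kP) andbF /= andbT; apply/negP => /andP[oK _].
  by move/pred0P/(_ o): dK; rewrite /= oK oP.
have Y2 := across_ge2 aok.
have Y2R : 2 <= (npairs (across K (pos_set x)))%:R :> R by rewrite (ler_nat R 2).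
have t2 := sqr_ge0 th.
rewrite (clique_pos_npairs cK dK) Kj natrD.
have [e|ne] := eqVneq (2 * rho * (j%:R + 2) + 4)
   ((j%:R + 2) * (j%:R + 2 - 1) + (npairs (within (pos_set x)))%:R +
     (npairs (across K (pos_set x)))%:R); last first.
  left; rewrite lt_neqAle ne /=; clear ne; rewrite rhoE in nP *.
  by move: nP Y2R; rewrite expr2; lra.
right; split => //.
have th00 : th = 0.
  by rewrite rhoE in e nP; move: nP Y2R t2 th0 e; rewrite !expr2 => *; lra.
rewrite th00 subr0 in rhoE.
have Y2E : npairs (across K (pos_set x)) = 2%N.
  apply/eqP; rewrite -(eqr_nat R); apply/eqP.
  by rewrite rhoE in e nP *; move: nP Y2R e; rewrite !expr2 => *; lra.
have nPE : (npairs (within (pos_set x)))%:R = rho ^+ 2 + j%:R.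
  by rewrite Y2E rhoE in e nP *; move: nP e; rewrite !expr2 => *; lra.
have [cP clP _ _] := tight_pos_set ev rho0 rhoE xu le1 nPE.
have [cov [k' [o' [k'K o'P h]]]] := bridge_structure cG dK eK eP Y2E.
by rewrite -Kj addn1 -cP; apply: link_edge_recognition h.
Qed.

(** Adding x p to the row of [p] completes its sum over [K], which no longer depends on [p]. *)
Lemma clique_row (R : rcfType) (G : sgraph) (x : G -> R) (rho : R) (K : {set G}) p :
  is_eigenvector x rho -> is_clique K -> p \in K ->
  (rho + 1) * x p = \sum_(q in K) x q + \sum_(q | edge p q && (q \notin K)) x q.
Proof.
move=> ev cK pK; rewrite mulrDl mul1r -ev (bigID (fun q => q \in K)) /=.
rewrite addrAC; congr (_ + _); rewrite [RHS](bigD1 p) //= addrC; congr (_ + _).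
apply: eq_bigl => q; case qK: (q \in K); rewrite ?andbF // andbT /=.
case: eqVneq => [->|qp]; first by rewrite edge_irr.
by have := is_cliqueP _ cK p q pK qK; rewrite eq_sym qp => ->.
Qed.

Lemma npairs4_mem (G : sgraph) (F : rel G) p q p' q' a b :
  symmetric F -> irreflexive F ->
  npairs F = 4%N -> F p q -> F p' q' -> (p' \notin [set p; q]) || (q' \notin [set p; q]) ->
  F a b -> (a \in [set p; q]) && (b \in [set p; q]) ||
           (a \in [set p'; q']) && (b \in [set p'; q']).
Proof.
move=> sF iF e4 pq pq' n ab; have nn : [set p; q] != [set p'; q'].
  apply: contraTneq n => ->; rewrite negb_or !negbK.
  by rewrite !inE !eqxx orbT.
by case: (npairs4 sF iF e4 pq pq' nn ab) => <-; rewrite !inE !eqxx !orbT.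
Qed.

(** The positive part is constant 1 without negative neighbours, so a cut edge o-z ends at a zero
    entry. If [z] is outside [K], its row needs a negative neighbour [q]; then z-q is the second and
    last edge across, and connectedness puts [q] in [K]. That [z] lies in [K] is excluded by the
    rows, and for j = 1 by the hypothesis on signs. *)
Lemma path_structure (R : rcfType) (G : sgraph) (x : G -> R) (j : nat) (K : {set G})
    (u : G) : connected_graph G ->
  is_eigenvector x j%:R -> (0 < j)%N -> x u = 1 ->
  is_clique K -> #|K| = (j + 1)%N -> [disjoint K & pos_set x] ->
  (j = 1%N -> forall p, p \in K -> x p < 0) ->
  npairs (across K (pos_set x)) = 4%N ->
  #|pos_set x| = j.+1 -> is_clique (pos_set x) ->
  (forall p, p \in pos_set x -> x p = 1) ->
  (forall p q, p \in pos_set x -> edge p q -> 0 <= x q) ->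
  cliques_linked_by_path G (j + 1).
Proof.
move=> cG ev j0 xu cK Kj dK K1 Y4 cP clP P1 Pnbr.
have jR : 0 < j%:R :> R by rewrite ltr0n.
have [k0 k0K] : exists p, p \in K by apply/card_gt0P; rewrite Kj addn1.
have kP p : p \in K -> p \notin pos_set x.
  by move=> pK; apply/negP => pP; move/pred0P/(_ p): dK; rewrite /= pK pP.
have pK p : p \in pos_set x -> p \notin K by apply: contraTN; exact: kP.
have Pgt p : p \in pos_set x -> 0 < x p by rewrite inE.
have nP p : x p < 0 -> p \notin pos_set x by rewrite inE -leNgt => /ltW.
have [||o [z [oP zP oz]]] := @connected_cut G (pos_set x) cG.
- by exists u; rewrite (top_pos xu).
- by exists k0; exact: kP.
have xz : x z = 0.
  by apply/eqP; rewrite eq_le (Pnbr o z) // andbT; rewrite inE -leNgt in zP.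
set F := across K (pos_set x) in Y4.
have Foz : F o z by rewrite /F /across oz (negPf zP) (negPf (pK _ oP)) andbF.
have Fout a b : edge a b -> a \notin K -> a \notin pos_set x -> F a b.
  by move=> ab aK aP; rewrite /F /across ab (negPf aK) (negPf aP).
have F4 := npairs4_mem (@across_sym _ _ _) (@across_irr _ _ _) Y4 Foz.
pose f p := \sum_(q | edge p q && (q \notin K)) x q.
pose S := \sum_(q in K) x q.
have rowK p : p \in K -> (j%:R + 1) * x p = S + f p := clique_row ev cK.
(* Since rho = j and |K| = j + 1, the sums over [K] cancel and the contributions from outside
   balance. *)
have sf : \sum_(p in K) f p = 0.
  have : \sum_(p in K) (j%:R + 1) * x p = \sum_(p in K) (S + f p).
    by apply: eq_bigr => p; exact: rowK.
  rewrite -mulr_sumr -/S big_split /= sumr_const Kj addn1 -[S *+ _]mulr_natl -natr1.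
  by rewrite -[LHS]addr0 => /addrI.
(* For [z] in [K] the positive contribution of [o] is balanced by a negative neighbour [q] of some
   [p] in [K]. This [q] is pendant, and solving gives x q = S = -1 and x p = -j, so j (j + 1) = 2,
   against j >= 2. *)
have zK : z \notin K.
  apply/negP => zK.
  have [/existsP[p /existsP[q /and4P[pK' qK pq xq]]]|h] :=
    boolP [exists p, exists q, [&& p \in K, q \notin K, edge p q & x q < 0]]; last first.
    have f0 p : p \in K -> 0 <= f p.
      move=> pK'; apply: sumr_ge0 => q /andP[pq qK]; rewrite leNgt; apply: contra h => xq.
      by apply/existsP; exists p; apply/existsP; exists q; rewrite pK' qK pq xq.
    have : 0 < f z.
      rewrite /f (bigD1 o) /=; last by rewrite edge_sym oz pK.
      rewrite P1 // ltr_wpDr //; apply: sumr_ge0 => q /andP[/andP[pq qK] _].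
      rewrite leNgt; apply: contra h => xq.
      by apply/existsP; exists z; apply/existsP; exists q; rewrite zK qK pq xq.
    move/eqP: sf; rewrite (bigD1 z) //= => /eqP sf.
    have : 0 <= \sum_(i in K | i != z) f i by apply: sumr_ge0 => i /andP[iK _]; exact: f0.
    by move: sf; set X := \sum_(i in K | _) _; move=> *; lra.
  have j2 : (1 < j)%N.
    rewrite ltn_neqAle j0 andbT; apply/eqP => j1.
    by have := K1 (esym j1) z zK; rewrite xz ltxx.
  have qP := nP _ xq.
  have qp : edge q p by rewrite edge_sym.
  have Fpq : F q p := Fout _ _ qp qK qP.
  have qo : q != o by apply: contraNneq qP => ->.
  have qz : q != z by apply: contraNneq qK => ->.
  have {}F4 a b := @F4 q p a b Fpq.
  have {}F4 a b : F a b -> (a \in [set o; z]) && (b \in [set o; z]) ||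
           (a \in [set q; p]) && (b \in [set q; p]).
    by apply: F4; rewrite !inE negb_or qo qz.
  have po : p != o by apply: contraTneq pK' => ->; exact: pK.
  have rowq : j%:R * x q = x p.
    rewrite -ev (eq_bigl (fun b => b == p)) ?big_pred1_eq // => b; apply/idP/eqP => [qb|-> //].
    have := F4 _ _ (Fout _ _ qb qK qP); rewrite !inE (negPf qo) (negPf qz) eqxx /=.
    by case/orP => /eqP // e; rewrite e edge_irr in qb.
  have pz : p != z.
    apply: contraTneq xq => e; move: rowq; rewrite e xz => /eqP.
    by rewrite mulf_eq0 gt_eqF //= => /eqP ->; rewrite ltxx.
  have KF a b : a \in K -> edge a b -> b \notin K -> F a b.
    by move=> aK ab bK; rewrite /F /across ab (negPf bK) (negPf (kP _ aK)) andbF.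
  have fz : f z = 1.
    rewrite /f (eq_bigl (fun b => b == o)) ?big_pred1_eq ?P1 // => b.
    apply/andP/eqP => [[zb bK]|->]; last by rewrite edge_sym oz pK.
    have := F4 _ _ (KF _ _ zK zb bK).
    rewrite !inE eqxx orbT /= [z == q]eq_sym (negPf qz) [z == p]eq_sym (negPf pz) /= orbF.
    by case/orP => /eqP // e; rewrite e zK in bK.
  have fp : f p = x q.
    rewrite /f (eq_bigl (fun b => b == q)) ?big_pred1_eq // => b.
    apply/andP/eqP => [[zb bK]|-> //].
    have := F4 _ _ (KF _ _ pK' zb bK).
    rewrite !inE (negPf po) (negPf pz) eqxx orbT /=.
    by case/orP => /eqP // e; rewrite e pK' in bK.
  have f0 a : a \in K -> a != z -> a != p -> f a = 0.
    move=> aK az ap; rewrite /f big_pred0 // => b; apply/negP => /andP[ab bK].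
    have := F4 _ _ (KF _ _ aK ab bK); rewrite !inE (negPf az) (negPf ap) !orbF.
    case/orP => /andP[/eqP e _]; first by rewrite e (negPf (pK _ oP)) in aK.
    by rewrite e (negPf qK) in aK.
  have xq1 : 1 + x q = 0.
    rewrite -fz -fp -sf (bigD1 z) //= (bigD1 p) ?pK' //= big1 ?addr0 // => i.
    by case/andP => /andP[iK iz] ip; exact: f0.
  have h1 := rowK z zK; have h2 := rowK p pK'.
  rewrite fz xz mulr0 in h1; rewrite fp in h2.
  have j2R : 2 <= j%:R :> R by rewrite (ler_nat R 2).
  have xqE : x q = -1 by lra.
  have SE : S = -1 by lra.
  by rewrite -rowq xqE SE in h2; nra.
have [q zq xq] : exists2 q, edge z q & x q < 0.
  have [/existsP[q /andP[zq xq]]|h] := boolP [exists q, edge z q && (x q < 0)].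
    by exists q.
  have := ev z; rewrite xz mulr0 (bigD1 o) /=; last by rewrite edge_sym.
  rewrite P1 // => e; have : 0 <= \sum_(i | edge z i && (i != o)) x i.
    apply: sumr_ge0 => i /andP[zi _]; rewrite leNgt; apply: contra h => xi.
    by apply/existsP; exists i; rewrite zi xi.
  by move: e; set X := \sum_(i | _) _; move=> *; lra.
have qP := nP _ xq.
have qo : q != o by apply: contraNneq qP => ->.
have qz : q != z by apply: contraTneq zq => ->; rewrite edge_irr.
have Fzq : F z q := Fout _ _ zq zK zP.
have {}F4 a b : F a b -> (a \in [set o; z]) && (b \in [set o; z]) ||
         (a \in [set z; q]) && (b \in [set z; q]).
  by apply: F4 => //; rewrite !inE !negb_or qo qz orbT.
have Fmem a b : F a b -> [|| b == o, b == z | b == q].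
  move/F4; rewrite !inE => /orP[] /andP[_ /orP[]] ->; by rewrite ?orbT.
have oK := pK _ oP.
have qK : q \in K.
  apply: contraT => qK.
  have [||a [b [aC bC ab]]] := @connected_cut G (z |: (q |: pos_set x)) cG.
  - by exists z; rewrite !inE eqxx.
  - exists k0; rewrite !in_setU1 !negb_or kP // andbT.
    by apply/andP; split; [apply: contraNneq zK => <- | apply: contraNneq qK => <-].
  have aK : a \notin K by move: aC; rewrite !in_setU1 => /or3P[/eqP->|/eqP->|/pK].
  move: bC; rewrite !in_setU1 !negb_or => /and3P[bz bq bP].
  have /Fmem : F a b by rewrite /F /across ab (negPf aK) (negPf bP) andbF.
  rewrite (negPf bz) (negPf bq) !orbF => /eqP e; by rewrite e oP in bP.
have cov p : [|| p == z, p \in K | p \in pos_set x].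
  apply: contraT; rewrite !negb_or => /and3P[pz pK' pP].
  have [||a [b [aC bC ab]]] := @connected_cut G (z |: (K :|: pos_set x)) cG.
  - by exists z; rewrite !inE eqxx.
  - by exists p; rewrite in_setU1 in_setU !negb_or pz pK' pP.
  move: bC; rewrite in_setU1 in_setU !negb_or => /and3P[bz bK bP].
  have /Fmem : F a b by rewrite /F /across ab (negPf bK) (negPf bP) !andbF.
  rewrite (negPf bz) /= => /orP[] /eqP e; first by rewrite e oP in bP.
  by rewrite e qK in bK.
rewrite -Kj; apply: (@link_path_recognition _ _ (pos_set x) z q o) => //.
- by rewrite cP Kj addn1.
- move=> a b aK bP; apply/negP => ab.
  have : F a b by rewrite /F /across ab (negPf (pK _ bP)) (negPf (kP _ aK)) andbF.
  move/F4; rewrite !inE.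
  have -> : (a == o) = false by apply: contraTF aK => /eqP ->.
  have -> : (a == z) = false by apply: contraTF aK => /eqP ->.
  have -> : (b == q) = false by apply: contraTF bP => /eqP ->.
  have -> : (b == z) = false by apply: contraTF bP => /eqP ->.
  by rewrite andbF.
- move=> a aK; apply/idP/eqP => [za|-> //].
  have := F4 _ _ (Fout _ _ za zK zP); rewrite !inE.
  have -> : (a == o) = false by apply: contraTF aK => /eqP ->.
  have -> : (a == z) = false by apply: contraTF aK => /eqP ->.
  by rewrite andbF /= => /andP[_ /eqP].
- move=> a aP; apply/idP/eqP => [za|->]; last by rewrite edge_sym.
  have := F4 _ _ (Fout _ _ za zK zP); rewrite !inE.
  have -> : (a == q) = false by apply: contraTF aP => /eqP ->.
  have -> : (a == z) = false by apply: contraTF aP => /eqP ->.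
  by rewrite andbF !orbF => /andP[_ /eqP].
Qed.

Lemma case_linked_by_path (R : rcfType) (G : sgraph) (x : G -> R) (rho th : R) (j : nat)
    (K : {set G}) (u : G) : connected_graph G ->
  is_eigenvector x rho -> 0 < rho -> rho = j%:R - th -> 0 <= th -> th < 1 ->
  x u = 1 -> (forall p, x p <= 1) ->
  is_clique K -> #|K| = (j + 1)%N -> [disjoint K & pos_set x] ->
  (j = 1%N -> forall p, p \in K -> x p < 0) ->
  (4 <= npairs (across K (pos_set x)))%N ->
  2 * rho * #|K|%:R + 4 < (npairs (@edge G))%:R \/
  2 * rho * #|K|%:R + 4 = (npairs (@edge G))%:R /\
    cliques_linked_by_path G (j + 1).
Proof.
move=> cG ev rho0 rhoE th0 th1 xu le1 cK Kj dK K1 Y4.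
have nP := stanley_ge ev rho0 xu le1 rhoE th1.
have Y4R : 4 <= (npairs (across K (pos_set x)))%:R :> R by rewrite (ler_nat R 4).
have t2 := sqr_ge0 th.
rewrite (clique_pos_npairs cK dK) Kj natrD.
have [e|ne] := eqVneq (2 * rho * (j%:R + 1) + 4)
   ((j%:R + 1) * (j%:R + 1 - 1) + (npairs (within (pos_set x)))%:R +
     (npairs (across K (pos_set x)))%:R); last first.
  left; rewrite lt_neqAle ne /=; clear ne; rewrite rhoE in nP *.
  by move: nP Y4R; rewrite expr2; lra.
right; split => //.
have th00 : th = 0.
  by rewrite rhoE in e nP; move: nP Y4R t2 th0 e; rewrite !expr2 => *; lra.
rewrite th00 subr0 in rhoE.
have Y4E : npairs (across K (pos_set x)) = 4%N.
  apply/eqP; rewrite -(eqr_nat R); apply/eqP.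
  by rewrite rhoE in e nP *; move: nP Y4R e; rewrite !expr2 => *; lra.
have nPE : (npairs (within (pos_set x)))%:R = rho ^+ 2 + j%:R.
  by rewrite Y4E rhoE in e nP *; move: nP e; rewrite !expr2 => *; lra.
have [cP clP P1 Pn] := tight_pos_set ev rho0 rhoE xu le1 nPE.
have j0 : (0 < j)%N by rewrite -(ltr_nat R) -rhoE.
by rewrite rhoE in ev; apply: (path_structure cG ev j0 xu cK Kj dK).
Qed.

(** * A clique attached to the positive part by a bridge *)

(* The data left by a bridge k-o between a clique K of j+1 vertices and the
   positive part: eliminating K puts the loop -neg x o on the vertex o. *)
Lemma bridge_data (R : rcfType) (G : sgraph) (x : G -> R) (rho th : R) (j : nat)
    (K : {set G}) (u : G) : connected_graph G ->
  is_eigenvector x rho -> 0 < rho -> rho = j%:R - th -> 0 <= th ->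
  x u = 1 -> is_clique K -> #|K| = (j + 1)%N -> [disjoint K & pos_set x] ->
  npairs (across K (pos_set x)) = 2%N ->
  exists k o, [/\ k \in K, o \in pos_set x,
    forall p q, p \in K -> q \in pos_set x -> edge p q = (p == k) && (q == o),
    forall p, (p \in K) || (p \in pos_set x) &
    [/\ 0 < th, forall w, w \in pos_set x -> w != o -> neg x w = 0 &
      (j%:R + 1 - th) * (th * neg x o) = (1 - th) * x o]].
Proof.
move=> cG ev rho0 rhoE th0 xu cK Kj dK Y2.
have eK : exists p, p \in K by apply/card_gt0P; rewrite Kj addn1.
have eP : exists p, p \in pos_set x by exists u; rewrite (top_pos xu).
have [cov [k [o [kK oP eKP]]]] := bridge_structure cG dK eK eP Y2.
exists k, o; split => //.
have xo : 0 < x o by rewrite inE in oP.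
have kP p : p \in K -> p \notin pos_set x.
  by move=> pK; apply/negP => pP; move/pred0P/(_ p): dK; rewrite /= pK pP.
have notP p : (p \notin K) = (p \in pos_set x).
  apply/idP/idP => [pK|]; last by apply: contraTN; exact: kP.
  by have := cov p; rewrite (negPf pK).
pose S := \sum_(q in K) x q.
have rowk : (rho + 1) * x k = S + x o.
  rewrite (clique_row ev cK kK); congr (_ + _).
  rewrite (eq_bigl (fun q => q == o)) ?big_pred1_eq // => q.
  rewrite notP; apply/andP/eqP => [[kq qP]|->]; last by rewrite eKP // !eqxx.
  by move: kq; rewrite eKP // => /andP[_ /eqP].
have rowp p : p \in K -> p != k -> (rho + 1) * x p = S.
  move=> pK pk; rewrite (clique_row ev cK pK) -[RHS]addr0; congr (_ + _).
  rewrite big_pred0 // => q; rewrite notP; apply/negP => /andP[pq qP].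
  by move: pq; rewrite eKP // (negPf pk).
(* The rows summed over [K] give (rho + 1) S = (j + 1) S + x o. *)
have thS : th * S = - x o.
  have : \sum_(p in K) (rho + 1) * x p = j%:R * S + (S + x o).
    rewrite (bigD1 k) //= rowk addrC; congr (_ + _).
    rewrite (eq_bigr (fun _ => S)) => [|p /andP[pK pk]]; last exact: rowp.
    rewrite (eq_bigl (fun p => p \in K :\ k)) => [|p]; last by rewrite !inE andbC.
    have := cardsD1 k K; rewrite kK Kj addn1 add1n => /succn_inj cj.
    by rewrite sumr_const -cj -[LHS]mulr_natl.
  by rewrite -mulr_sumr -/S rhoE => ?; lra.
have th_gt0 : 0 < th.
  by rewrite lt_neqAle th0 andbT; apply/eqP => e; rewrite -e mul0r in thS; lra.
have nego : neg x o = - x k.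
  have S0 : S < 0 by rewrite -(pmulr_rlt0 _ th_gt0) thS oppr_lt0.
  have xk0 : x k <= 0 by have := kP k kK; rewrite inE -leNgt.
  have eqn q : edge o q -> x q < 0 -> q = k.
    move=> oq xq; have qK : q \in K by rewrite -[_ \in K]negbK notP inE -leNgt ltW.
    by move: oq; rewrite edge_sym eKP // => /andP[/eqP].
  have ok : edge o k by rewrite edge_sym eKP // !eqxx.
  have [xk|xk] := ltrP (x k) 0.
    rewrite /neg (eq_bigl (fun q => q == k)) ?big_pred1_eq // => q.
    by apply/andP/eqP => [[oq xq]|-> //]; exact: eqn.
  have xkE : x k = 0 by apply/eqP; rewrite eq_le xk0 xk.
  rewrite xkE oppr0 /neg big_pred0 // => q; apply/negP => /andP[oq xq].
  by move: (xq); rewrite (eqn q oq xq) xkE ltxx.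
split => //.
  move=> w wP wo; apply: neg_eq0 => q wq; rewrite leNgt; apply/negP => xq.
  have qK : q \in K by rewrite -[_ \in K]negbK notP inE -leNgt ltW.
  by move: wq; rewrite edge_sym eKP // (negPf wo) andbF.
have -> : j%:R + 1 - th = rho + 1 by rewrite rhoE; ring.
by rewrite nego mulrCA mulrN rowk mulrN mulrDr thS; ring.
Qed.

Lemma npairs_deg_ge (R : rcfType) (G : sgraph) (x : G -> R) (rho : R) (u : G) :
  is_eigenvector x rho -> 0 < rho ->
  (deg (within (pos_set x)) u + deg (within (pos_set x)) u +
   outside_degree (within (pos_set x)) u <= npairs (within (pos_set x)))%N.
Proof.
move=> ev rho0; rewrite /npairs (bigD1 u) //= -addnA leq_add2l.
rewrite (bigID (within (pos_set x) u)) /= leq_add2r /deg big_mkcond /=.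
rewrite [X in (_ <= X)%N]big_mkcond /=; apply: leq_sum => w _.
case uw: (within _ u w) => //=.
have -> : w != u by apply: contraTneq uw => ->; rewrite within_irr.
by apply: (within_deg_gt0 ev rho0); case/and3P: uw.
Qed.

(** Group the two-step walks by their end z. As [u] sees the whole part, z is reached through each
    of its neighbours except [u]; walks back to [u] contribute nothing because x u = 1. *)
Lemma slack_star (R : rcfType) (G : sgraph) (x : G -> R) (rho : R) (u : G) :
  is_eigenvector x rho -> 0 < rho -> x u = 1 ->
  outside_degree (within (pos_set x)) u = 0%N ->
  slack (within (pos_set x)) x u =
  \sum_(w | within (pos_set x) u w) ((deg (within (pos_set x)) w)%:R - 1) * (1 - x w).
Proof.
move=> ev rho0 xu o0; set PP := within _.
have adj p : p \in pos_set x -> p != u -> PP u p by exact: outside0_adj o0.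
rewrite /slack (exchange_big_dep (fun z => z \in pos_set x)) /=; last first.
  by move=> w z _ /and3P[].
rewrite (bigD1 u) ?(top_pos xu) //= big1 ?add0r; last by move=> w _; rewrite xu subrr.
rewrite [RHS](eq_bigl (fun z => (z \in pos_set x) && (z != u))); last first.
  move=> z; apply/idP/andP => [uz|[zP zu]]; last exact: adj.
  split; first by case/and3P: uz.
  by apply: contraTneq uz => ->; rewrite /PP within_irr.
apply: eq_bigr => z /andP[zP zu].
transitivity ((\sum_(w | PP u w && PP w z) 1) * (1 - x z)).
  by rewrite mulr_suml; apply: eq_bigr => w _; rewrite mul1r.
congr (_ * _).
rewrite degE [in RHS](bigD1 u) /=; last by rewrite [PP _ _]within_sym; exact: adj.
rewrite addrAC subrr add0r; apply: eq_bigl => w.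
rewrite [PP z w]within_sym; apply/andP/andP => [[uw wz]|[wz wu]]; split => //.
  by apply: contraTneq uw => ->; rewrite /PP within_irr.
by apply: adj => //; case/and3P: wz.
Qed.

(** Excludes a pendant vertex at distance two from the top, with entry [y]: its row bounds [y] from
    above, while the assumed edge bound and its improvement by parity bound it from below. *)
Lemma odd_far_arith (R : realFieldType) (j th y : R) :
  2 <= j -> 0 < th -> th < 1 -> (j - th) * y <= 1 -> 0 < y -> y <= 1 ->
  th ^+ 2 + 2 * th <= y -> 2 - y <= 2 * j * th - th ^+ 2 -> False.
Proof.
move=> j2 t0 t1 h1 y0 y1 h2 h3.
have h4 : (j - th) * (th ^+ 2 + 2 * th) <= 1.
  by apply: le_trans h1; rewrite ler_pM2l //; lra.
have h5 : 0 < th ^+ 2 * (j - 1 - th) by rewrite mulr_gt0 ?exprn_gt0 //; lra.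
by move: h3 h4 h5; rewrite !expr2 => *; lra.
Qed.

(** A neighbour w of the top with degree [D] in the part has x w <= D / (j - th), so its slack (D -
    1) (1 - x w) exceeds half of the total that the edge bound allows. *)
Lemma mid_degree_arith (R : realFieldType) (j th D : R) :
  4 <= j -> 0 < th -> th < 1 -> 2 <= D -> D <= j - 1 ->
  (j - th) * (1 - 2 * th - th ^+ 2) < 2 * ((D - 1) * (j - th - D)).
Proof.
move=> j4 t0 t1 D2 Dj; set a := D - 2; set b := j - 1 - D.
have -> : D = a + 2 by rewrite /a; ring.
have -> : j = a + b + 3 by rewrite /a /b; ring.
have a0 : 0 <= a by rewrite /a; lra.
have b0 : 0 <= b by rewrite /b; lra.
have ab : 1 <= a + b by rewrite /a /b; lra.
clearbody a b; have h1 : 0 <= a * b by rewrite mulr_ge0.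
have h2 : 0 <= th * b by rewrite mulr_ge0 // ltW.
have h3 : 0 < (3 + a + b - th) * th ^+ 2 by rewrite mulr_gt0 ?exprn_gt0 //; lra.
have h4 : th ^+ 2 <= th by rewrite expr2 ger_pMl //; lra.
by move: h3 h4; rewrite !expr2 => *; nra.
Qed.

(** Replaces the previous estimate for j = 3: there D = 2, and parity supplies a second upper bound
    on the slack [s]. *)
Lemma mid_degree3_arith (R : realFieldType) (th s : R) :
  0 < th -> th < 1 -> 2 * (1 - th) <= (3 - th) * s ->
  s <= 1 - 2 * th - th ^+ 2 -> s <= 6 * th - th ^+ 2 - 1 -> False.
Proof.
move=> t0 t1 h1 h2 h3.
have h4 : (3 - th) * s <= (3 - th) * (1 - 2 * th - th ^+ 2) by rewrite ler_pM2l //; lra.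
have h5 : (3 - th) * s <= (3 - th) * (6 * th - th ^+ 2 - 1) by rewrite ler_pM2l //; lra.
have t2 : th ^+ 2 <= th by rewrite expr2 ger_pMl //; lra.
have t3 : th ^+ 3 <= th ^+ 2 by rewrite exprS ger_pMl ?exprn_gt0 //; lra.
have t30 : 0 < th ^+ 3 by rewrite exprn_gt0.
have h6 : 5 * th <= 1.
  by move: h1 h4 t3 t30; rewrite !exprS !expr0 => *; nra.
by move: h1 h5 t2 t3 t30; rewrite !exprS !expr0 => *; nra.
Qed.

(** Excludes a positive part that is a star with j + 1 leaves: [s] is the total excess due to
    negative neighbours, and the equation containing it is the sum of the rows of the leaves. *)
Lemma star_arith (R : realFieldType) (j th g xo s : R) :
  2 <= j -> 0 < th -> th < 1 -> 0 <= g -> 0 <= s -> g <= s ->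
  (j - th) ^+ 2 + s = j + 1 ->
  2 * (j + 1) <= j ^+ 2 + j + 2 - 2 * th * (j + 1) ->
  th ^+ 2 + 2 * th <= 1 -> (j = 2 \/ 3 <= j) ->
  (j + 1 - th) * (th * g) = (1 - th) * xo ->
  1 <= (j - th) * xo + g -> False.
Proof.
move=> j2 t0 t1 g0 s0 gs e1 h1 h2 jj e2 h3.
have th2 : th <= 1 / 2 by nra.
case: jj => [ej|j3]; last by nra.
rewrite ej in e1 h1 e2 h3; have th3 : th <= 1 / 3 by lra.
have s2 : s <= 2 / 9 by nra.
have g2 : g <= 2 / 9 by lra.
have xo2 : 7 / 18 <= xo by nra.
have tg0 : th * g <= 1 / 3 * (2 / 9).
  by apply: ler_pM => //; lra.
have tg1 : 0 <= th * g by rewrite mulr_ge0 // ltW.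
by nra.
Qed.

Section Star.
Variables (R : rcfType) (G : sgraph) (x : G -> R) (rho : R) (u : G) (j : nat).
Local Notation P := (pos_set x).
Local Notation PP := (within P).
Hypotheses (ev : is_eigenvector x rho) (rho0 : 0 < rho) (xu : x u = 1).
Hypotheses (o0 : outside_degree PP u = 0%N) (du : deg PP u = j.+1).

Lemma star_or_two_mid_degrees w0 : (npairs PP <= j * j + j)%N ->
  PP u w0 -> deg PP w0 = 1%N ->
  (forall w, PP u w -> deg PP w = 1%N) \/
  exists w w', [/\ w != w', PP u w && PP u w', (2 <= deg PP w < j)%N &
    (2 <= deg PP w' < j)%N].
Proof.
move=> nP uw0 dw0.
have adj p : p \in P -> p != u -> PP u p by exact: outside0_adj o0.
have PPP p q : PP p q -> q \in P by case/and3P.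
pose Q := [set w | PP u w && (1 < deg PP w)%N].
have uQ : u \notin Q by rewrite inE within_irr.
have sub w : w \in Q -> [set q | PP w q] \subset u |: (Q :\ w).
  move=> wQ; apply/subsetP => q; rewrite !inE => wq.
  case: eqVneq => [//|qu] /=; have uq := adj q (PPP _ _ wq) qu.
  rewrite uq; apply/andP; split; first by apply: contraTneq wq => ->; rewrite within_irr.
  rewrite deg_card; have -> : 2%N = #|[set u; w]|.
    rewrite cards2; suff -> : u != w by [].
    by apply: contraNneq uQ => ->.
  apply: subset_leq_card; apply/subsetP => a; rewrite !inE => /orP[]/eqP ->.
    by rewrite within_sym.
  by rewrite within_sym.
have card_sub w : w \in Q -> #|u |: (Q :\ w)| = #|Q|.
  move=> wQ; rewrite cardsU1 (cardsD1 w Q) wQ !inE negb_and.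
  by move: uQ; rewrite inE => ->; rewrite orbT.
have Qj : (#|Q| <= j)%N.
  have : Q \subset [set q | PP u q] :\ w0.
    apply/subsetP => q; rewrite !inE => /andP[uq dq]; rewrite uq andbT.
    by apply: contraTneq dq => ->; rewrite dw0.
  move/subset_leq_card/leq_trans; apply.
  have := cardsD1 w0 [set q | PP u q]; rewrite inE uw0 -deg_card du add1n.
  by move/succn_inj => ->.
have dQ w : w \in Q -> (deg PP w <= #|Q|)%N.
  by move=> wQ; rewrite deg_card -(card_sub w wQ) subset_leq_card // sub.
have [/existsP[w1 /andP[uw1 dw1]]|h] := boolP [exists w, PP u w && (deg PP w != 1)%N]; last first.
  left=> w uw; apply/eqP; apply: contraR h => dw.
  by apply/existsP; exists w; rewrite uw.
right.
have w1Q : w1 \in Q.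
  have := within_deg_gt0 ev rho0 (PPP _ _ uw1).
  by rewrite inE uw1; move: dw1; case: deg => [|[]].
have two w w' : w != w' -> w \in Q -> w' \in Q -> (deg PP w < j)%N -> (deg PP w' < j)%N ->
  exists w w', [/\ w != w', PP u w && PP u w', (2 <= deg PP w < j)%N &
    (2 <= deg PP w' < j)%N].
  rewrite !inE => ww /andP[h1 h2] /andP[h3 h4] h5 h6.
  by exists w, w'; rewrite h1 h2 h3 h4 h5 h6.
have [Qlt|Qge] := ltnP #|Q| j.
  have [q] : exists q, q \in [set q | PP w1 q] :\ u.
    apply/card_gt0P; have := cardsD1 u [set q | PP w1 q]; rewrite -deg_card.
    have : (1 < deg PP w1)%N by move: w1Q; rewrite inE => /andP[].
    by move=> dw e; move: dw; rewrite e; case: (u \in _) => // /ltnW.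
  rewrite !inE => /andP[qu w1q].
  have : q \in u |: (Q :\ w1) by apply: (subsetP (sub _ w1Q)); rewrite inE.
  rewrite in_setU1 (negPf qu) in_setD1 => /andP[qw1 qQ].
  by apply: (two q w1) => //; apply: leq_ltn_trans Qlt; exact: dQ.
have Qe : #|Q| = j by apply/eqP; rewrite eqn_leq Qj Qge.
have [/existsP[w /andP[wQ dw]]|h] := boolP [exists w, (w \in Q) && (deg PP w < j)%N]; last first.
  exfalso; have : (j.+1 + (1 + j * j) <= npairs PP)%N.
    rewrite /npairs (bigD1 u) //= du leq_add2l (bigD1 w0) /=; last first.
      by apply: contraTneq uw0 => ->; rewrite within_irr.
    rewrite dw0 leq_add2l -{1}Qe -sum_nat_const.
    rewrite [X in (_ <= X)%N](bigID (mem Q)) /=.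
    apply: leq_trans (leq_addr _ _).
    rewrite [X in (_ <= X)%N](eq_bigl (fun i => i \in Q)) => [|i]; last first.
      case iQ: (i \in Q); rewrite ?andbF // andbT.
      apply/andP; split; first by apply: contraTneq iQ => ->.
      by apply: contraTneq iQ => ->; rewrite inE dw0 andbF.
    apply: leq_sum => i iQ; rewrite leqNgt; apply: contra h => di.
    by apply/existsP; exists i; rewrite iQ.
  move/leq_trans/(_ nP); rewrite add1n addSn addnS addnC => h2.
  by have := ltnW h2; rewrite ltnn.
have : [set q | PP w q] \proper u |: (Q :\ w).
  by rewrite properEcard sub //= card_sub // Qe -deg_card.
case/properP => _ [w' ]; rewrite !inE => /orP[/eqP ->|/andP[w'w w'Q]] ww'.
  by move: wQ ww'; rewrite inE within_sym => /andP[-> _].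
have w'Q' : w' \in Q by rewrite inE.
apply: (two w w') => //; first by rewrite eq_sym.
rewrite -Qe -(card_sub w' w'Q') deg_card; apply: proper_card.
apply/properP; split; first exact: sub.
exists w; last by rewrite inE within_sym.
by rewrite in_setU1 in_setD1 wQ [w == w']eq_sym w'w orbT.
Qed.
End Star.

(** [j * j + j] is even as well, so parity turns a strict bound by the next even number into this
    one. *)
Lemma even_pairs_le j m (k : nat) : m = k.*2 -> (m < j * j + j + 2)%N ->
  (m <= j * j + j)%N.
Proof.
have [a ea] : exists a, (j * j + j = a.*2)%N.
  exists (j * j.+1)./2; rewrite -mulnSr.
  by rewrite -[LHS]odd_double_half oddM /= andbN.
rewrite ea => ->; lia.
Qed.

Lemma natr_two_or_ge3 (R : realFieldType) (j : nat) : (1 < j)%N ->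
  j%:R = 2 :> R \/ 3 <= j%:R :> R.
Proof.
rewrite leq_eqVlt => /orP[/eqP <-|j3]; first by left.
by right; rewrite (ler_nat R 3).
Qed.

Lemma star_of_two a b : (1 <= a)%N -> (a + a + b <= 1 * 1 + 1)%N -> b = 0%N /\ a = 1%N.
Proof. lia. Qed.

(** The last hypothesis says that the desired strict bound fails, after removal of [K] and of the
    two pairs across. It caps the total excess; a vertex not adjacent to [u], or a degree of [u]
    above j, would exceed the cap. *)
Lemma bridge_top_degree (R : rcfType) (G : sgraph) (x : G -> R) (rho th : R) (j : nat)
    (K : {set G}) (u : G) : connected_graph G ->
  is_eigenvector x rho -> 0 < rho -> rho = j%:R - th -> 0 <= th -> th < 1 ->
  x u = 1 -> (forall p, x p <= 1) ->
  is_clique K -> #|K| = (j + 1)%N -> [disjoint K & pos_set x] ->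
  npairs (across K (pos_set x)) = 2%N ->
  (npairs (within (pos_set x)))%:R <= j%:R ^+ 2 + j%:R + 2 - 2 * th * (j%:R + 1) ->
  outside_degree (within (pos_set x)) u = 0%N /\ deg (within (pos_set x)) u = j.
Proof.
move=> cG ev rho0 rhoE th0 th1 xu le1 cK Kj dK Y2 nPR.
have [k [o [kK oP eKP cov [th_gt0 neg0 nego]]]] :=
  bridge_data cG ev rho0 rhoE th0 xu cK Kj dK Y2.
set PP := within (pos_set x) in nPR *.
have jR : 0 < j%:R :> R by lra.
have jj : (0 < j)%N by rewrite -(ltr0n R).
(* The cap lies strictly below j^2 + j + 2 because th > 0, so parity improves it. *)
have nP : (npairs PP <= j * j + j)%N.
  have [m em] := npairs_even (@within_sym _ (pos_set x)) (@within_irr _ (pos_set x)).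
  apply: even_pairs_le em _; rewrite -(ltr_nat R) !natrD natrM.
  apply: le_lt_trans nPR _; rewrite expr2.
  have : 0 < th * (j%:R + 1) by rewrite mulr_gt0 //; lra.
  by lra.
have nPR2 : (npairs PP)%:R <= j%:R ^+ 2 + j%:R :> R.
  by rewrite expr2 -natrM -natrD ler_nat.
have dj := deg_ge_j ev xu le1 rhoE th1; rewrite -/PP in dj.
have st := stanley ev xu; rewrite -/PP in st.
have sl := slack_ge0 u le1; rewrite -/PP in sl.
have sn := sum_neg_ge0 x u; rewrite -/PP in sn.
have rng : 0 <= rho * neg x u by rewrite mulr_ge0 ?neg_ge0 // ltW.
have djR : j%:R <= (deg PP u)%:R :> R by rewrite ler_nat.
have dR0 : 0 <= (outside_degree PP u)%:R :> R by [].
have t2 := sqr_ge0 th.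
have rho2E : rho ^+ 2 = j%:R ^+ 2 - 2 * th * j%:R + th ^+ 2 by rewrite rhoE; ring.
have [j1|j2] := leqP j 1.
  have {}j1 : j = 1%N by apply/eqP; rewrite eqn_leq j1 jj.
  have := leq_trans (npairs_deg_ge u ev rho0) nP; rewrite -/PP j1.
  by apply: star_of_two; rewrite -j1.
have j2R : 2 <= j%:R :> R by rewrite (ler_nat R 2).
have rho1 : 1 < rho by lra.
have adj0 : outside_degree PP u = 0%N.
  apply/eqP; rewrite -leqn0 leqNgt; apply/negP => o0.
  have oR : 1 <= (outside_degree PP u)%:R :> R by rewrite ler1n.
  have [o2|o1] := leqP 2 (outside_degree PP u).
    have : 2 <= (outside_degree PP u)%:R :> R by rewrite (ler_nat R 2).
    by lra.
  (* [K] hangs at [o] only, so the positive part is connected by itself and some edge of it leaves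
     the closed neighbourhood [C] of [u]. *)
  have [w [z [uw wz zu uz]]] : exists w z, [/\ PP u w, PP w z, z != u & ~~ PP u z].
    pose C := u |: [set w | PP u w].
    have [/existsP[w /existsP[z /and3P[wC zC wz]]]|h] :=
      boolP [exists w, exists z, [&& w \in C, z \notin C & PP w z]].
      exists w, z; move: wC zC; rewrite !inE negb_or => wC /andP[zu uz]; split => //.
      by case/orP: wC => [/eqP e|//]; rewrite -e wz in uz.
    have sC p : p \in C -> p \in pos_set x.
      by rewrite !inE => /orP[/eqP ->|/and3P[_ _]]; rewrite ?xu ?ltr01 // inE.
    have noC p q : p \in C -> q \notin C -> edge p q -> q \in pos_set x -> False.
      move=> pC qC pq qP; case/negP: h; apply/existsP; exists p; apply/existsP; exists q.
      by rewrite pC qC /PP /within pq qP sC.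
    exfalso; have uC : u \in C by rewrite !inE eqxx.
    have [z zP zC] : exists2 z, z \in pos_set x & z \notin C.
      have [/existsP[z /andP[zP zC]]|h'] := boolP [exists z, (z \in pos_set x) && (z \notin C)].
        by exists z.
      move: o0; rewrite /outside_degree big1 // => v /andP[vu uv].
      have vP : v \notin pos_set x.
        apply: contra h' => vP; apply/existsP; exists v.
        by rewrite vP !inE negb_or vu uv.
      by rewrite /deg big1 // => q _; rewrite /PP /within (negPf vP) andbF.
    have kP p : p \in K -> p \notin pos_set x.
      by move=> pK; apply/negP => pP; move/pred0P/(_ p): dK; rewrite /= pK pP.
    have [oC|oC] := boolP (o \in C).
      have [||a [b [aC bC ab]]] := @connected_cut G (C :|: K) cG.
      - by exists u; rewrite inE uC.
      - exists z; rewrite inE negb_or zC /=; by apply: contraL zP; exact: kP.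
      move: bC; rewrite inE negb_or => /andP[bC bK].
      have bP : b \in pos_set x by have := cov b; rewrite (negPf bK).
      move: aC; rewrite inE => /orP[aC|aK]; first exact: noC ab bP.
      by move: ab; rewrite eKP // => /andP[_ /eqP e]; rewrite e oC in bC.
    have [||a [b [aC bC ab]]] := @connected_cut G C cG.
    - by exists u.
    - by exists z.
    have [bK|bK] := boolP (b \in K).
      by move: ab; rewrite edge_sym eKP ?sC // => /andP[_ /eqP e]; rewrite -e aC in oC.
    by apply: (noC a b) => //; have := cov b; rewrite (negPf bK).
  have zP : z \in pos_set x by case/and3P: wz.
  have dz : deg PP z = 1%N.
    apply/eqP; rewrite eqn_leq (within_deg_gt0 ev rho0 zP) andbT.
    by rewrite -ltnS (leq_ltn_trans _ o1) // outside_ge.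
  have s1 : 1 - x z <= slack PP x u by apply: slack_ge uw wz.
  have rz : rho * x z <= 1.
    have := within_row ev zP; rewrite -/PP.
    rewrite (eq_bigl (fun q => q == w)) ?big_pred1_eq => [e|q].
      by have := neg_ge0 x z; have := le1 w; lra.
    have /eqP/cards1P[a ea] : #|[set q | PP z q]| = 1%N by rewrite -deg_card.
    have mem b : PP z b = (b == a).
      by have := congr1 (fun A : {set G} => b \in A) ea; rewrite !inE.
    have /eqP -> : w == a by rewrite -mem [PP _ _]within_sym.
    exact: mem.
  have xz : 0 < x z by rewrite inE in zP.
  have xz1 := le1 z.
  by rewrite rhoE in rz; apply: (odd_far_arith j2R th_gt0 th1 rz xz xz1); lra.
split => //; have adj p := outside0_adj ev rho0 adj0 (p := p); rewrite -/PP in adj.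
apply/eqP; rewrite eqn_leq dj andbT leqNgt; apply/negP => dj1.
have [dj2|dj3] := leqP (j + 2) (deg PP u).
  have : j%:R + 2 <= (deg PP u)%:R :> R by rewrite -natrD ler_nat.
  by lra.
have du : deg PP u = j.+1.
  by apply/eqP; rewrite eqn_leq dj1 andbT -ltnS -addn2.
rewrite du adj0 -natr1 mulr0n addr0 in st djR.
have row1 w : PP u w -> rho * x w + neg x w <= (deg PP w)%:R.
  move=> uw; have wP : w \in pos_set x by case/and3P: uw.
  by rewrite -(within_row ev wP) degE; apply: ler_sum.
have rowu : \sum_(w | PP u w) (1 - x w) = 1 + th - neg x u.
  rewrite sumrB -degE du /PP (within_row ev) ?(top_pos xu) // xu rhoE -natr1; ring.
have slE := slack_star ev rho0 xu adj0; rewrite -/PP in slE.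
have slu : slack PP x u <= 1 - 2 * th - th ^+ 2 - rho * neg x u -
    \sum_(w | PP u w) neg x w by lra.
have dpos w : PP u w -> (0 < deg PP w)%N.
  by move=> uw; apply: (within_deg_gt0 ev rho0); case/and3P: uw.
have term w : PP u w -> 0 <= ((deg PP w)%:R - 1) * (1 - x w).
  by move=> uw; rewrite mulr_ge0 // subr_ge0 ?ler1n ?dpos.
(* Without a leaf, each neighbour counts at least once in the slack, which then reaches 1 + th - neg
   u and exceeds its cap. *)
have [/existsP[w0 /andP[uw0 /eqP dw0]]|noP] := boolP [exists w, PP u w && (deg PP w == 1%N)]; last first.
  have : \sum_(w | PP u w) (1 - x w) <= slack PP x u.
    rewrite slE; apply: ler_sum => w uw; rewrite ler_peMl ?subr_ge0 //.
    have : 2 <= (deg PP w)%:R :> R.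
      rewrite (ler_nat R 2) ltn_neqAle dpos // andbT eq_sym.
      by apply: contra noP => dw; apply/existsP; exists w; rewrite uw.
    by lra.
  have : neg x u <= rho * neg x u by rewrite ler_peMl ?neg_ge0 // ltW.
  by rewrite rowu; lra.
have [star|[w [w' [ww /andP[uw uw'] dw dw']]]] :=
  star_or_two_mid_degrees ev rho0 adj0 du nP uw0 dw0.
  have sl0 : slack PP x u = 0.
    by rewrite slE big1 // => w uw; rewrite star // subrr mul0r.
  have sumrow : rho ^+ 2 + (rho * neg x u + \sum_(w | PP u w) neg x w) = j%:R + 1.
    have : \sum_(w | PP u w) (rho * x w + neg x w) = j%:R + 1.
      rewrite natr1 -du degE; apply: eq_bigr => w uw.
      have wP : w \in pos_set x by case/and3P: uw.
      rewrite -(within_row ev wP) (eq_bigl (fun q => q == u)) ?big_pred1_eq // => q.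
      have /eqP/cards1P[a ea] : #|[set q | PP w q]| = 1%N by rewrite -deg_card star.
      have mem b : PP w b = (b == a).
        by have := congr1 (fun A : {set G} => b \in A) ea; rewrite !inE.
      have /eqP -> : u == a by rewrite -mem [PP _ _]within_sym.
      exact: mem.
    rewrite big_split /= -mulr_sumr /PP (within_row ev) ?(top_pos xu) // xu => <-.
    by ring.
  have nPE : (npairs PP)%:R = 2 * (j%:R + 1) :> R by rewrite st sl0; lra.
  pose s := rho * neg x u + \sum_(w | PP u w) neg x w.
  have s0 : 0 <= s by rewrite addr_ge0.
  have gs : neg x o <= s.
    have [->|ou] := eqVneq o u.
      have : neg x u <= rho * neg x u by rewrite ler_peMl ?neg_ge0 // ltW.
      by rewrite /s; lra.
    by have := sum_neg_ge (adj o oP ou); rewrite -/PP /s; lra.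
  have rowo : 1 <= (j%:R - th) * x o + neg x o.
    rewrite -rhoE; have [->|ou] := eqVneq o u.
      by rewrite xu; have := neg_ge0 x u; lra.
    have uo := adj o oP ou; rewrite -(within_row ev oP) (bigD1 u) /=; last first.
      by rewrite within_sym.
    by rewrite xu lerDl; apply: sumr_ge0 => i /andP[/and3P[_ _]]; rewrite inE => /ltW.
  have jc := natr_two_or_ge3 R j2.
  have e1 : (j%:R - th) ^+ 2 + s = j%:R + 1 by rewrite -rhoE.
  have h1 : 2 * (j%:R + 1) <= j%:R ^+ 2 + j%:R + 2 - 2 * th * (j%:R + 1) :> R.
    by rewrite -nPE.
  have h2 : th ^+ 2 + 2 * th <= 1 by move: slu; rewrite sl0; lra.
  exact: (star_arith j2R th_gt0 th1 (neg_ge0 x o) s0 gs e1 h1 h2 jc nego rowo).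
have s2 : ((deg PP w)%:R - 1) * (1 - x w) + ((deg PP w')%:R - 1) * (1 - x w') <=
    slack PP x u.
  rewrite slE (bigD1 w) //= (bigD1 w') /=; last first.
    by apply/andP; split => //; rewrite eq_sym.
  rewrite addrA lerDl; apply: sumr_ge0 => i /andP[/andP[ui _] _]; exact: term.
have mid v : PP u v -> (2 <= deg PP v < j)%N ->
    [/\ 2 <= (deg PP v)%:R :> R, (deg PP v)%:R <= j%:R - 1 :> R &
    ((deg PP v)%:R - 1) * (j%:R - th - (deg PP v)%:R) <=
    (j%:R - th) * (((deg PP v)%:R - 1) * (1 - x v))].
  move=> uv /andP[d2 dlt]; have d2R : 2 <= (deg PP v)%:R :> R by rewrite (ler_nat R 2).
  split => //; first by have : (deg PP v)%:R + 1 <= j%:R :> R; [rewrite natr1 ler_nat | clear; lra].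
  rewrite mulrCA ler_pM2l; last by move: d2R; clear; lra.
  by move: (row1 v uv) (neg_ge0 x v); rewrite rhoE; clear; lra.
have [d1 d2 d3] := mid w uw dw; have [d1' d2' d3'] := mid w' uw' dw'.
have jth : 0 < j%:R - th by rewrite -rhoE.
have slu' : slack PP x u <= 1 - 2 * th - th ^+ 2.
  by apply: le_trans slu _; rewrite -addrA -opprD lerBlDr lerDl addr_ge0.
have [j4|j3] := leqP 4 j.
  have j4R : 4 <= j%:R :> R by rewrite (ler_nat R 4).
  have h1 := mid_degree_arith j4R th_gt0 th1 d1 d2.
  have h2 := mid_degree_arith j4R th_gt0 th1 d1' d2'.
  have h3 : (j%:R - th) * slack PP x u <= (j%:R - th) * (1 - 2 * th - th ^+ 2).
    by rewrite ler_pM2l.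
  have h4 : (j%:R - th) * (((deg PP w)%:R - 1) * (1 - x w) + ((deg PP w')%:R - 1) * (1 - x w')) <=
     (j%:R - th) * slack PP x u by rewrite ler_pM2l.
  by move: h1 h2 h3 h4 d3 d3'; rewrite mulrDr; clear; lra.
have {}j3 : j = 3%N.
  by apply/eqP; rewrite eqn_leq -ltnS j3 /=; case/andP: dw => h1; exact: leq_ltn_trans h1.
rewrite j3 in d2 d2' d3 d3' st nPR2 rho2E.
have dw2 : (deg PP w)%:R = 2 :> R by move: d1 d2; clear; lra.
have dw2' : (deg PP w')%:R = 2 :> R by move: d1' d2'; clear; lra.
rewrite dw2 in d3 s2; rewrite dw2' in d3' s2.
apply: (mid_degree3_arith th_gt0 th1 (s := slack PP x u)).
- have : (3 - th) * ((2 - 1) * (1 - x w) + (2 - 1) * (1 - x w')) <= (3 - th) * slack PP x u.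
    by rewrite ler_pM2l //; move: th1; clear; lra.
  by move: d3 d3'; rewrite mulrDr; clear; lra.
- exact: slu'.
- by lra.
Qed.

Section BridgeArithmetic.
Variable R : realFieldType.

(* In the next lemmas t = rho + 1, j = t + th - 1, g is the loop at o and
   tp is the smaller root of tp^2 - (j + 2) tp + 1. *)
Lemma quad_root_bound (j tp : R) : 1 <= j -> 0 < tp -> tp < 1 ->
  tp ^+ 2 - (j + 2) * tp + 1 = 0 -> tp * (j + 1) < 1.
Proof. by move=> j1 p0 p1 e; move: e; rewrite expr2 => e; nra. Qed.

(** Two or more edges missing in the positive part: the last hypothesis is the sum of its rows, with
    every missing degree bounded by [r]. *)
Lemma missing_many_arith (j th tp r : R) : 1 <= j -> 0 < th -> th < 1 ->
  0 < tp -> tp < 1 -> tp ^+ 2 - (j + 2) * tp + 1 = 0 ->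
  2 <= r -> 2 * r - r * th + th ^+ 2 <= th * (j + 1) -> r + tp * (j + 1) < th * (j + 1).
Proof.
move=> j1 t0 t1 p0 p1 e r2 h; have := quad_root_bound j1 p0 p1 e.
have h1 : 0 <= (r - 2) * (1 - th) by rewrite mulr_ge0; lra.
have h2 := sqr_ge0 (1 - th); rewrite expr2 in h2; rewrite expr2 in h.
by move=> h3; lra.
Qed.

(** One missing edge and the bridge at the top; [y] is the common entry at the two ends of the
    missing edge. *)
Lemma missing_top_arith (j th g y : R) : 2 <= j -> 0 < th -> th < 1 ->
  (j + 1 - th) * (th * g) = 1 - th ->
  (j + 2 - th) * y = j + 1 - th + g -> 0 < g ->
  th * (j + 1 - th + g) = 2 * y + g -> 2 - th + g <= 2 * y -> 2 <= th * (j + 1).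
Proof.
move=> j2 t0 t1 eg ey g0 e h; rewrite leNgt; apply/negP => c.
have h1 : th * (1 - th) <= g * (2 - th).
  have tt0 : 0 < (j + 1 - th) * th by rewrite mulr_gt0 //; lra.
  rewrite -(ler_pM2l tt0).
  have -> : (j + 1 - th) * th * (g * (2 - th)) = (1 - th) * (2 - th) by rewrite -eg; ring.
  have -> : (j + 1 - th) * th * (th * (1 - th)) = (1 - th) * ((j + 1 - th) * th ^+ 2) by ring.
  rewrite ler_pM2l; last by lra.
  have h2 : (j + 1 - th) * th ^+ 2 <= (2 - th ^+ 2) * th.
    by rewrite expr2 mulrA ler_pM2r //; lra.
  have h3 : 0 <= (1 - th) ^+ 2 * (2 + th) by rewrite mulr_ge0 ?sqr_ge0 //; lra.
  apply: le_trans h2 _; move: h3; rewrite !expr2 => *; lra.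
by lra.
Qed.

(** One missing edge and the bridge at one of its ends, where the entry is [y1]; the other end has
    the entry [y2]. *)
Lemma missing_end_arith (j th tp g y1 y2 : R) : 2 <= j -> 0 < th -> th < 1 ->
  0 < tp -> tp < 1 -> tp ^+ 2 - (j + 2) * tp + 1 = 0 ->
  (j + 1 - th) * (th * g) = (1 - th) * y1 ->
  (j + 1 - th) * y1 + g = j + 1 - th - y2 ->
  (j + 1 - th) * y2 = j + 1 - th - y1 ->
  th * (j + 1 - th) = y1 + y2 + g -> 1 + tp * (j + 1) < th * (j + 1).
Proof.
move=> j2 t0 t1 p0 p1 ep eg e1 e2 e3; rewrite ltNge; apply/negP => c.
have pb := quad_root_bound (_ : 1 <= j) p0 p1 ep.
have {}pb : tp * (j + 1) < 1 by apply: pb; lra.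
have ts : (j + 1 - th) * (y1 + y2) = (j + 1 - th) * (2 - th) by lra.
have s12 : y1 + y2 = 2 - th by apply: mulfI ts; apply: lt0r_neq0; lra.
have ey1 : (j - th) * y1 = (j + 1 - th) * (1 - th).
  have -> : y1 = 2 - th - y2 by lra.
  have : y2 = 2 - th - y1 by lra.
  by move=> ?; nra.
have eq : (j - th) * th * g = (1 - th) ^+ 2.
  have tn : j + 1 - th != 0 by apply: lt0r_neq0; lra.
  apply: (mulfI tn); have -> : (j + 1 - th) * ((j - th) * th * g) =
     (j - th) * ((j + 1 - th) * (th * g)) by ring.
  by rewrite eg mulrCA ey1; ring.
have Lg : th * (j + 1) - 1 = 1 - th + th ^+ 2 + g by rewrite expr2; lra.
have L1 : th * (j + 1) - 1 < 1 by lra.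
have g0 : 0 < g.
  have : 0 < (j - th) * th * g by rewrite eq exprn_gt0 //; lra.
  by rewrite pmulr_rgt0 // mulr_gt0 //; lra.
have gl : 1 - th < g * (2 + th).
  have q1 : (j - th) * th < (1 - th) * (2 + th) by lra.
  have : (1 - th) * (1 - th) < (1 - th) * (g * (2 + th)).
    rewrite -expr2 -eq.
    have -> : (1 - th) * (g * (2 + th)) = (1 - th) * (2 + th) * g by ring.
    by rewrite ltr_pM2r.
  by rewrite ltr_pM2l //; lra.
(* This gives j + 1 < 5, which leaves only a short range for [tp]. *)
have thl : 2 / 5 < th.
  rewrite ltNge; apply/negP => th25.
  have th2 : th ^+ 2 <= 2 / 5 * th by rewrite expr2 ler_pM2r.
  have : 0 <= (1 - th) * (1 - 2 * th - th ^+ 2) by rewrite mulr_ge0; lra.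
  have : g < th - th ^+ 2 by lra.
  move=> h; have : g * (2 + th) < (th - th ^+ 2) * (2 + th) by rewrite ltr_pM2r //; lra.
  by rewrite !expr2; lra.
have j3 : j + 1 < 5.
  rewrite ltNge; apply/negP => j4.
  have : th * 5 <= th * (j + 1) by rewrite ler_pM2l.
  by lra.
have tpsq : tp ^+ 2 < tp by rewrite expr2 gtr_pMl //; lra.
have tp5 : 1 / 6 < tp.
  have : tp * (j + 2) <= tp * 6 by rewrite ler_pM2l //; lra.
  by have : 0 < tp ^+ 2; [rewrite exprn_gt0 | lra].
have tp2 : tp < 1 / 2.
  have : tp * 4 <= tp * (j + 2) by rewrite ler_pM2l //; lra.
  by lra.
(* By its equation tp (j + 1) = 1 - tp + tp^2, at most 31/36 when [tp] lies between 1/6 and 5/6. *)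
have h1 : tp * (j + 1) <= 31 / 36.
  have : 0 <= (tp - 1 / 6) * (5 / 6 - tp) by rewrite mulr_ge0; lra.
  by rewrite expr2 in ep *; lra.
(* Multiplying by 2 + th reduces the claim to the positivity of a cubic in [th]; its powers are
   bounded by tangents at 7/10, close to its minimum. *)
have h2 : 0 <= (th - 7 / 10) ^+ 2 * (th + 7 / 5) by rewrite mulr_ge0 ?sqr_ge0 //; lra.
have h3 := sqr_ge0 (th - 7 / 10).
have h4 : (1 - th + th ^+ 2 + g) * (2 + th) <= 31 / 36 * (2 + th).
  by rewrite ler_pM2r; lra.
by rewrite !expr2 in h2 h3 h4; lra.
Qed.

(** One missing edge and the bridge at a vertex, with entry [xo], that is neither the top nor an end
    of the missing edge. *)
Lemma missing_other_arith (j th g y xo : R) : 3 <= j -> 0 < th -> th < 1 -> 0 < g ->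
  (j + 1 - th) * (th * g) = (1 - th) * xo ->
  (j + 1 - th) * xo + g = j + 1 - th -> (j + 2 - th) * y = j + 1 - th ->
  th * (j + 1 - th) = 2 * y + g -> 2 <= th * (j + 1).
Proof.
move=> j3 t0 t1 g0 e1 e2 e3 e4; rewrite leNgt; apply/negP => c.
have th12 : th < 1 / 2.
  have : th * 4 <= th * (j + 1) by rewrite ler_pM2l //; lra.
  by lra.
have [t tE] : {t | t = j + 1 - th} by exists (j + 1 - th).
have e3' : (t + 1) * y = t by rewrite tE; lra.
rewrite -tE in e1 e2 e4; have t72 : 7 / 2 < t by lra.
have tp : 0 < t by lra.
have tn : t != 0 by rewrite gt_eqF.
(* In s = 1 - y and h = g / t the equations become th = 2 s + h and xo = 1 - h, with s (t + 1) =
   1. *)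
have [h ht] : {h | h * t = g} by exists (g / t); rewrite divfK.
have [s sE] : {s | s = 1 - y} by exists (1 - y).
have yE : y = 1 - s by lra.
have st : s * (t + 1) = 1 by rewrite sE; lra.
have s0 : 0 < s by rewrite -(pmulr_lgt0 _ (_ : 0 < t + 1)) ?st //; lra.
have h0 : 0 < h by rewrite -(pmulr_lgt0 _ tp) ht.
have thE : th = 2 * s + h.
  by apply: (mulIf tn); lra.
have xoE : xo = 1 - h by apply: (mulfI tn); lra.
have s29 : s < 2 / 9.
  have : s * (9 / 2) < s * (t + 1) by rewrite ltr_pM2l //; lra.
  by lra.
have h27 : h * (7 / 2) < g by rewrite -ht ltr_pM2l.
have gs : g * s < h.
  have -> : g * s = h * (1 - s).
    have -> : 1 - s = s * t by rewrite -st; ring.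
    by rewrite -ht; ring.
  by have : 0 < h * s; [rewrite mulr_gt0 | lra].
have c2 : g + th ^+ 2 < 2 * s.
  have : th * (j + 1) = 2 * y + g + th ^+ 2 by rewrite -e4 tE; ring.
  by rewrite yE; lra.
(* Otherwise 9/40 + (49/10) s^2 < 2 s, which is impossible; 10/49 is the vertex of this parabola. *)
have g9 : g < 9 / 40.
  rewrite ltNge; apply/negP => g9.
  have h1 : 9 / 40 * s <= g * s by rewrite ler_pM2r.
  have h2 : s * (s * (9 / 40)) <= s * h by rewrite ler_pM2l //; lra.
  have h3 := sqr_ge0 (s - 10 / 49).
  have h4 := sqr_ge0 h.
  by rewrite thE !expr2 in c2 h3 h4; lra.
have e5 : (2 - 2 * s + g) * g = (1 - 2 * s - h) * (1 - h).
  have -> : 2 - 2 * s + g = t * th by lra.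
  by rewrite -mulrA e1 xoE thE; ring.
have l1 : (2 - 2 * s + g) * g <= (2 - 2 * s + 9 / 40) * (9 / 40).
  by apply: ler_pM; lra.
have h3 : h <= 9 / 140 by lra.
have l2 : (1 - 2 * s - 9 / 140) * (1 - 9 / 140) <= (1 - 2 * s - h) * (1 - h).
  by apply: ler_pM; lra.
by lra.
Qed.
End BridgeArithmetic.

(** Both sides have j + 1 vertices. With r edges missing in the positive part, the strict bound
    reads r + tp (j + 1) < th (j + 1): missing edges are paid for by the drop of the eigenvalue. The
    case r = 0 is the extremal graph itself. *)
Lemma bridge_balanced (R : rcfType) (G : sgraph) (x : G -> R) (rho th : R) (j : nat)
    (K : {set G}) (u : G) : connected_graph G ->
  is_eigenvector x rho -> 0 < rho -> rho = j%:R - th -> 0 <= th -> th < 1 ->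
  x u = 1 -> (forall p, x p <= 1) ->
  is_clique K -> #|K| = (j + 1)%N -> [disjoint K & pos_set x] ->
  npairs (across K (pos_set x)) = 2%N ->
  outside_degree (within (pos_set x)) u = 0%N -> deg (within (pos_set x)) u = j ->
  #|G| = (j + 1).*2 /\
  ([/\ cliques_linked_by_edge G (j + 1) (j + 1), 0 < th,
      th ^+ 2 - (j%:R + 2) * th + 1 = 0 &
      (npairs (@edge G))%:R = 2 * rho * (j%:R + 1) + 2 + 2 * (th * (j%:R + 1))] \/
   forall tp, 0 < tp -> tp < 1 -> tp ^+ 2 - (j%:R + 2) * tp + 1 = 0 ->
     2 * rho * (j%:R + 1) + 2 + 2 * (tp * (j%:R + 1)) < (npairs (@edge G))%:R).
Proof.
move=> cG ev rho0 rhoE th0 th1 xu le1 cK Kj dK Y2 o0 du.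
have [k [o [kK oP eKP cov [th_gt0 neg0 nego]]]] :=
  bridge_data cG ev rho0 rhoE th0 xu cK Kj dK Y2.
have cP : #|pos_set x| = (j + 1)%N by rewrite (outside0_card ev rho0 xu o0) du addn1.
split.
  have -> : #|G| = #|K :|: pos_set x|.
    by apply: eq_card => p; rewrite !inE; have := cov p; rewrite inE => ->.
  have := cardsUI K (pos_set x); rewrite (eqP (_ : K :&: pos_set x == set0)) ?setI_eq0 //.
  by rewrite cards0 addn0 => ->; rewrite Kj cP addnn.
have jR : 0 < j%:R :> R by lra.
have jj : (0 < j)%N by rewrite -(ltr0n R).
have j1 : 1 <= j%:R :> R by rewrite ler1n.
set P := pos_set x in oP eKP cov dK Y2 o0 du cP neg0 *.
have uP : u \in P by exact: top_pos.
pose L : rel G := fun p q => [&& p \in P, q \in P, p != q & ~~ edge p q].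
have sL : symmetric L.
  by move=> p q; rewrite /L edge_sym eq_sym; case: (p \in P); case: (q \in P).
have iL : irreflexive L by move=> p; rewrite /L eqxx !andbF.
have eL : (npairs (within P) + npairs L = (j + 1) * j)%N.
  rewrite -npairsU => [|p q /and3P[pq _ _]]; last by rewrite /L pq !andbF.
  have := npairs_complete P; rewrite cP addn1 /= => <-; apply: eq_npairs => p q /=.
  rewrite /within /L; case: eqVneq => [->|_]; first by rewrite edge_irr !andbF.
  by case: edge; case: (p \in P); case: (q \in P).
have [r er] := npairs_even sL iL.
have nPE : (npairs (within P))%:R = (j%:R + 1) * j%:R - 2 * r%:R :> R.
  have := congr1 (fun n => n%:R : R) eL.
  by rewrite natrD !natrM natrD er -muln2 natrM => h; lra.
have ME : (npairs (@edge G))%:R = (j%:R + 1) * j%:R * 2 - 2 * r%:R + 2 :> R.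
  by rewrite (clique_pos_npairs cK dK) Kj -/P nPE Y2 natrD; ring.
have goalE tp : r%:R + tp * (j%:R + 1) < th * (j%:R + 1) ->
    2 * rho * (j%:R + 1) + 2 + 2 * (tp * (j%:R + 1)) < (npairs (@edge G))%:R.
  by rewrite ME rhoE => h; lra.
pose X := \sum_(q in P) x q; pose g := neg x o.
have g0 : 0 < g.
  have : 0 < (j%:R + 1 - th) * (th * g).
    by rewrite nego mulr_gt0 //; [lra | rewrite inE in oP].
  by rewrite pmulr_rgt0 ?pmulr_rgt0 //; lra.
have row w : w \in P -> (rho + 1) * x w + neg x w = X - \sum_(q | L w q) x q.
  move=> wP; have -> : X = x w + \sum_(q | within P w q) x q + \sum_(q | L w q) x q.
    rewrite /X (bigD1 w) //= (bigID (fun q => edge w q)) /= addrA.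
    congr (_ + _ + _); apply: eq_bigl => q.
      rewrite /within wP /=; case wq: (edge w q); rewrite ?andbF // andbT.
      by rewrite andb_idr // => _; apply: contraTneq wq => ->; rewrite edge_irr.
    by rewrite /L wP /= eq_sym -andbA.
  by rewrite (within_row ev wP); ring.
have Lu q : L u q = false.
  apply: contra_eqF o0 => /and4P[_ qP uq eq]; rewrite -lt0n.
  have := @outside_ge R G x u q qP; rewrite eq_sym uq => /(_ isT).
  rewrite /within (negPf eq) /= => /(_ isT); apply: leq_trans.
  exact: within_deg_gt0 ev rho0 _ qP.
have XE : X = rho + 1 + neg x u.
  by have := row u uP; rewrite big_pred0 // xu mulr1 subr0 => <-.
have sneg : \sum_(w in P) neg x w = g.
  by rewrite (bigD1 o) //= big1 ?addr0 // => w /andP[wP wo]; exact: neg0.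
(* The rows summed over the part: each of its j + 1 vertices sees the total [X], up to the missing
   neighbours. *)
have star : th * X = \sum_(q in P) (deg L q)%:R * x q + g.
  have : \sum_(w in P) ((rho + 1) * x w + neg x w) =
      \sum_(w in P) (X - \sum_(q | L w q) x q) by apply: eq_bigr => w; exact: row.
  rewrite big_split /= -mulr_sumr -/X sneg sumrB sumr_const cP -[X *+ _]mulr_natl natrD.
  have -> : \sum_(w in P) \sum_(q | L w q) x q = \sum_(q in P) (deg L q)%:R * x q.
    rewrite (exchange_big_dep (fun q => q \in P)) /=; last by move=> w q _ /and4P[].
    apply: eq_bigr => q qP; rewrite degE mulr_suml [LHS](eq_bigl (L q)) => [|w].
      by apply: eq_bigr => w _; rewrite mul1r.
    by rewrite sL andb_idl // => /and4P[].
  by rewrite rhoE => ?; lra.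
have degL0 q : q \notin P -> deg L q = 0%N.
  by move=> qP; rewrite /deg big1 // => w _; rewrite /L (negPf qP).
have sdeg : \sum_(q in P) (deg L q)%:R = 2 * r%:R :> R.
  rewrite -natr_sum -natrM mul2n -er /npairs [in RHS](bigID (mem P)) /=.
  by rewrite [X in _ = (_ + X)%:R]big1 ?addn0 //; exact: degL0.
have negu0 : 0 <= neg x u := neg_ge0 x u.
have degr w : (deg L w <= r)%N.
  rewrite -leq_double -er /npairs (bigD1 w) //= -addnn leq_add2l.
  rewrite (bigID (L w)) /=; apply: leq_trans (leq_addr _ _).
  rewrite {1}/deg big_mkcond /= [X in (_ <= X)%N]big_mkcond /=; apply: leq_sum => q _.
  case wq: (L w q) => //=.
  have -> : q != w by apply: contraTneq wq => ->; rewrite iL.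
  by rewrite lt0n; apply/eqP => d0; move: d0; rewrite /deg (bigD1 w) //= sL wq.
have [r2|r1] := leqP 2 r.
  right=> tp p0 p1 ep; apply: goalE.
  apply: (missing_many_arith j1 th_gt0 th1 p0 p1 ep); first by rewrite (ler_nat R 2).
  have h1 : \sum_(q in P) (deg L q)%:R * (1 - x q) <= r%:R * \sum_(q in P) (1 - x q).
    rewrite mulr_sumr; apply: ler_sum => q _.
    by rewrite ler_wpM2r ?subr_ge0 // ler_nat.
  have e1 : \sum_(q in P) (deg L q)%:R * (1 - x q) = 2 * r%:R - (th * X - g).
    rewrite star addrK -sdeg -sumrB; apply: eq_bigr => q _; ring.
  have e2 : \sum_(q in P) (1 - x q) = j%:R + 1 - X.
    by rewrite sumrB sumr_const cP natrD.
  have h2 : 0 <= (r%:R - th) * neg x u.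
    rewrite mulr_ge0 //; have : 2 <= r%:R :> R by rewrite (ler_nat R 2).
    by lra.
  rewrite e1 e2 XE rhoE in h1; rewrite expr2; lra.
case: r er nPE ME goalE sdeg degr r1 => [|[|//]] er nPE ME goalE sdeg degr _.
  left; have L0 := npairs0 er.
  have clP : is_clique P.
    apply/is_cliqueP => p q pP qP pq; have := L0 p q.
    by rewrite /L pP qP pq /= => /negbFE.
  have rowX w : w \in P -> (rho + 1) * x w + neg x w = X.
    by move=> wP; rewrite row // big_pred0 ?subr0.
  (* With the bridge at [u], every other entry would be 1 + g / (rho + 1), which is more than 1. *)
  have ou : o != u.
    apply/eqP => ou; have [w wP wo] : exists2 w, w \in P & w != o.
      have : (0 < #|P :\ o|)%N by have := cardsD1 o P; rewrite oP cP addn1 add1n => /succn_inj <-.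
      by case/card_gt0P => w; rewrite !inE => /andP[wo wP]; exists w; rewrite ?inE.
    have := rowX w wP; rewrite neg0 // addr0 XE -ou -/g => e.
    have : (rho + 1) * x w <= (rho + 1) * 1 by rewrite ler_pM2l //; lra.
    by lra.
  have nu : neg x u = 0 by rewrite neg0 // eq_sym.
  have star0 : th * (rho + 1) = g.
    rewrite -[RHS]add0r -[0 in RHS](_ : \sum_(q in P) (deg L q)%:R * x q = 0).
      by rewrite -star XE nu addr0.
    by apply: big1 => q _; have := degr q; rewrite leqn0 => /eqP ->; rewrite mul0r.
  have xoE : x o = 1 - th.
    have h : (rho + 1) != 0 by apply: lt0r_neq0; lra.
    apply: (mulfI h); have := rowX o oP; rewrite -/g XE nu addr0 => e; lra.
  (* Substituting x o = 1 - th and g = th (rho + 1) into the equation of the loop gives equal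
     squares; both bases are positive, and their equality is the quadratic equation for [th]. *)
  have e2 : ((rho + 1) * th) ^+ 2 = (1 - th) ^+ 2.
    by have := nego; rewrite -/g xoE -star0 rhoE => e; rewrite !expr2; lra.
  have e3 : (rho + 1) * th = 1 - th.
    move/eqP: e2; rewrite eqf_sqr => /orP[/eqP //|/eqP e].
    have : 0 < (rho + 1) * th by rewrite mulr_gt0 //; lra.
    by lra.
  split => //; [|by rewrite expr2; rewrite rhoE in e3; lra|by rewrite ME rhoE; ring].
  by have := link_edge_recognition dK cov cK clP kK oP eKP; rewrite Kj cP.
right=> tp p0 p1 ep; apply: goalE.
have [z1 [z2 L12]] : exists z1 z2, L z1 z2.
  have [/existsP[z1 /existsP[z2 h]]|h] := boolP [exists z1, exists z2, L z1 z2].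
    by exists z1, z2.
  move: er; rewrite /npairs big1 // => p _; rewrite /deg big1 // => q _.
  by case pq: (L p q) => //; case/negP: h; apply/existsP; exists p; apply/existsP; exists q.
have Luniq a b := npairs2 sL iL er L12 (a := a) (b := b).
have [z1P z2P z12 _] := and4P L12.
have L21 : L z2 z1 by rewrite sL.
have Lz1 : \sum_(q | L z1 q) x q = x z2.
  rewrite (eq_bigl (fun q => q == z2)) ?big_pred1_eq // => q.
  apply/idP/eqP => [h|-> //]; case: (Luniq _ _ h) => [[_ ->] //|[e _]].
  by rewrite e eqxx in z12.
have Lz2 : \sum_(q | L z2 q) x q = x z1.
  rewrite (eq_bigl (fun q => q == z1)) ?big_pred1_eq // => q.
  apply/idP/eqP => [h|-> //]; case: (Luniq _ _ h) => [[e _]|[_ ->] //].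
  by rewrite e eqxx in z12.
have Lw w : w != z1 -> w != z2 -> \sum_(q | L w q) x q = 0.
  move=> w1 w2; rewrite big_pred0 // => q; apply/negP => h.
  by case: (Luniq _ _ h) => [] [e _]; rewrite e eqxx in w1 w2.
have degz : \sum_(q in P) (deg L q)%:R * x q = x z1 + x z2.
  have d1 : deg L z1 = 1%N.
    apply/eqP; rewrite eqn_leq degr /= lt0n; apply/eqP => d0.
    by move: d0; rewrite /deg (bigD1 z2) //= L12.
  have d2 : deg L z2 = 1%N.
    apply/eqP; rewrite eqn_leq degr /= lt0n; apply/eqP => d0.
    by move: d0; rewrite /deg (bigD1 z1) //= L21.
  rewrite (bigD1 z1) //= (bigD1 z2) /=; last by rewrite z2P eq_sym.
  rewrite d1 d2 !mul1r big1 ?addr0 // => q /andP[/andP[_ q1] q2].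
  rewrite /deg big1 ?mul0r // => w _; case h: (L q w) => //.
  by case: (Luniq _ _ h) => [] [e _]; rewrite e eqxx in q1 q2.
rewrite degz in star.
have uz1 : u != z1 by apply: contraTneq L12 => <-; rewrite Lu.
have uz2 : u != z2 by apply: contraTneq L21 => <-; rewrite Lu.
have r1 := row z1 z1P; have r2 := row z2 z2P; rewrite Lz1 in r1; rewrite Lz2 in r2.
have j2 : 2 <= j%:R :> R.
  have sub : [set u; z1; z2] \subset P.
    by apply/subsetP => q; rewrite !inE -orbA => /or3P[]/eqP ->; rewrite -?in_set;
      [move: uP | move: z1P | move: z2P]; rewrite inE.
  have := subset_leq_card sub; rewrite cP addn1 -!setUA cardsU1 cardsU1 cards1 !inE.
  by rewrite negb_or uz1 uz2 z12 /= => h; rewrite (ler_nat R 2).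
have pb := quad_root_bound j1 p0 p1 ep.
have xz1 := le1 z1; have xz2 := le1 z2.
have ttn : rho != 0 by rewrite gt_eqF.
have [ou|ou] := eqVneq o u.
  have n1 : neg x z1 = 0 by apply: neg0; rewrite // ou eq_sym.
  have n2 : neg x z2 = 0 by apply: neg0; rewrite // ou eq_sym.
  have nu : neg x u = g by rewrite /g ou.
  rewrite n1 XE nu addr0 in r1; rewrite n2 XE nu addr0 in r2.
  have e12 : x z1 = x z2 by apply: (mulfI ttn); move: r1 r2; clear; lra.
  have h1 : (1 - x z1) + (1 - x z2) <= j%:R + 1 - X.
    have <- : \sum_(q in P) (1 - x q) = j%:R + 1 - X.
      by rewrite sumrB sumr_const cP natrD.
    rewrite (bigD1 z1) //= (bigD1 z2) /=; last by rewrite z2P eq_sym.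
    by rewrite [X in _ <= X]addrA lerDl; apply: sumr_ge0 => q _; rewrite subr_ge0.
  have : 2 <= th * (j%:R + 1).
    apply: (@missing_top_arith _ j%:R th g (x z1) j2 th_gt0 th1) => //.
    - by rewrite nego ou xu mulr1.
    - by move: r1; rewrite rhoE -e12; clear; lra.
    - by move: star; rewrite XE nu rhoE e12; clear; lra.
    - by move: h1; rewrite XE nu rhoE -e12; clear; lra.
  by move: pb; clear; lra.
have nu : neg x u = 0 by rewrite neg0 // eq_sym.
rewrite XE nu addr0 in star r1 r2.
have [oz1|oz1] := eqVneq o z1.
  have n2 : neg x z2 = 0 by apply: neg0; rewrite // oz1 eq_sym.
  apply: (@missing_end_arith _ j%:R th tp g (x z1) (x z2)) => //.
  - by rewrite nego oz1.
  - by move: r1; rewrite -oz1 -/g rhoE oz1; clear; lra.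
  - by move: r2; rewrite n2 rhoE; clear; lra.
  - by move: star; rewrite rhoE; clear; lra.
have [oz2|oz2] := eqVneq o z2.
  have n1 : neg x z1 = 0 by apply: neg0; rewrite // oz2.
  apply: (@missing_end_arith _ j%:R th tp g (x z2) (x z1)) => //.
  - by rewrite nego oz2.
  - by move: r2; rewrite -oz2 -/g rhoE oz2; clear; lra.
  - by move: r1; rewrite n1 rhoE; clear; lra.
  - by move: star; rewrite rhoE; clear; lra.
have n1 : neg x z1 = 0 by apply: neg0; rewrite // eq_sym.
have n2 : neg x z2 = 0 by apply: neg0; rewrite // eq_sym.
rewrite n1 addr0 in r1; rewrite n2 addr0 in r2.
have e12 : x z1 = x z2 by apply: (mulfI ttn); move: r1 r2; clear; lra.
have ro := row o oP; rewrite Lw // subr0 XE nu addr0 -/g in ro.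
have j3 : 3 <= j%:R :> R.
  have sub : [set o; u; z1; z2] \subset P.
    by apply/subsetP => q; rewrite !inE -!orbA => /or4P[]/eqP ->;
      [move: oP | move: uP | move: z1P | move: z2P]; rewrite inE.
  have := subset_leq_card sub; rewrite cP addn1 -!setUA !cardsU1 cards1 !inE.
  by rewrite !negb_or ou oz1 oz2 uz1 uz2 z12 /= => h; rewrite (ler_nat R 3).
have : 2 <= th * (j%:R + 1).
  apply: (@missing_other_arith _ j%:R th g (x z1) (x o) j3 th_gt0 th1 g0) => //.
  - by move: ro; rewrite rhoE; clear; lra.
  - by move: r1; rewrite rhoE -e12; clear; lra.
  - by move: star; rewrite rhoE -e12; clear; lra.
by move: pb; clear; lra.
Qed.

(* npairs counts every edge twice, so 2 * rho * om + 4 <= M is rho * om <= m - 2. In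
   the last case the extremal value involves the eigenvalue j - tp of the extremal graph. *)
Definition bound_outcome (R : rcfType) (G : sgraph) (rho : R) (om : nat) : Prop :=
  let M : R := (npairs (@edge G))%:R in
  [\/ 2 * rho * om%:R + 4 < M,
      exists j, 2 * rho * om%:R + 4 = M /\ cliques_linked_by_edge G (j + 2) (j + 1),
      exists j, 2 * rho * om%:R + 4 = M /\ cliques_linked_by_path G (j + 1) |
      exists j, [/\ #|G| = (j + 1).*2, (0 < j)%N &
        (exists tp, [/\ cliques_linked_by_edge G (j + 1) (j + 1), 0 < tp, tp < 1,
           tp ^+ 2 - (j%:R + 2) * tp + 1 = 0 &
           M = 2 * rho * om%:R + 2 + 2 * (tp * (j%:R + 1))]) \/
        forall tp, 0 < tp -> tp < 1 -> tp ^+ 2 - (j%:R + 2) * tp + 1 = 0 ->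
           2 * rho * om%:R + 2 + 2 * (tp * (j%:R + 1)) < M]].

Lemma disjoint_clique_outcome (R : rcfType) (G : sgraph) (x : G -> R) (rho th : R)
    (j : nat) (K : {set G}) : connected_graph G ->
  is_eigenvector x rho -> 0 < rho -> rho = j%:R - th -> 0 <= th -> th < 1 ->
  (exists p, 0 < x p) -> is_clique K -> ((#|K| == j + 1) || (#|K| == j + 2))%N ->
  [disjoint K & pos_set x] ->
  (#|K| = (j + 1)%N -> j = 1%N -> forall p, p \in K -> x p < 0) ->
  bound_outcome G rho #|K|.
Proof.
move=> cG ev0 rho0 rhoE th0 th1 xpos cK Kj dK0 K10.
have [c [u [c0 ev xu le1]]] := exists_top ev0 xpos.
have dK : [disjoint K & pos_set (fun p => c * x p)] by rewrite pos_setZ.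
case/orP: Kj => /eqP Kj; last first.
  case: (case_linked_by_edge cG ev rho0 rhoE th0 th1 xu le1 cK Kj dK) => h.
    by constructor 1.
  by constructor 2; exists j.
have K1 : j = 1%N -> forall p, p \in K -> c * x p < 0.
  by move=> j1 p pK; rewrite pmulr_rlt0 // K10.
have [Y4|Y4] := leqP 4 (npairs (across K (pos_set (fun p => c * x p)))).
  case: (case_linked_by_path cG ev rho0 rhoE th0 th1 xu le1 cK Kj dK K1 Y4) => h.
    by constructor 1.
  by constructor 3; exists j.
have Y2 : npairs (across K (pos_set (fun p => c * x p))) = 2%N.
  have eK : exists p, p \in K by apply/card_gt0P; rewrite Kj addn1.
  have kP p : p \in K -> p \notin pos_set (fun p => c * x p).
    by move=> pK; apply/negP => pP; move/pred0P/(_ p): dK; rewrite /= pK pP.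
  have [||a [b [aP bP ab]]] := @connected_cut G (pos_set (fun p => c * x p)) cG.
  - by exists u; rewrite inE xu.
  - by case: eK => p pK; exists p; exact: kP.
  have Y2 : (2 <= npairs (across K (pos_set (fun p => (c * x p)%R))))%N.
    apply: (@across_ge2 _ _ _ a b); rewrite /across ab (negPf bP) andbF andbT /=.
    by apply: contraTN aP => /andP[aK _]; exact: kP.
  by move: Y2 Y4; have [m ->] := across_even K (pos_set (fun p => c * x p));
    case: m => [|[|m]].
have [h|h] := ltP (2 * rho * #|K|%:R + 4) (npairs (@edge G))%:R; first by constructor 1.
have [|o0 du] := bridge_top_degree cG ev rho0 rhoE th0 th1 xu le1 cK Kj dK Y2.
  move: h; rewrite (clique_pos_npairs cK dK) Kj Y2 natrD rhoE expr2; lra.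
have [cGE h'] := bridge_balanced cG ev rho0 rhoE th0 th1 xu le1 cK Kj dK Y2 o0 du.
have jj : (0 < j)%N by rewrite -(ltr0n R); lra.
constructor 4; exists j; split => //; rewrite Kj natrD.
case: h' => [[h1 h2 h3 h4]|h']; last by right.
by left; exists th.
Qed.

(** * Case analysis on a maximum clique *)

Lemma exists_max_clique (G : sgraph) :
  exists2 K : {set G}, is_clique K & #|K| = clique_number G.
Proof.
have h : (0 < #|[pred S : {set G} | is_clique S]|)%N.
  apply/card_gt0P; exists set0; rewrite inE; apply/is_cliqueP => p q.
  by rewrite inE.
by have [K cK e] := eq_bigmax_cond (fun S : {set G} => #|S|) h; exists K.
Qed.

Lemma clique_number_ge (G : sgraph) (K : {set G}) :
  is_clique K -> (#|K| <= clique_number G)%N.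
Proof. by move=> cK; apply: leq_bigmax_cond. Qed.

Lemma nat_ceil (R : realType) (rho : R) : 0 < rho ->
  exists (j : nat) (th : R), [/\ rho = j%:R - th, 0 <= th & th < 1].
Proof.
move=> rho0.
have ex : exists j : nat, rho <= j%:R.
  by exists (Num.Def.archi_bound rho); apply: ltW; apply: archi_boundP; exact: ltW.
case: (ex_minnP ex) => j jr jmin; exists j, (j%:R - rho); split; [ring|lra|].
case: j jr jmin => [|j] jr jmin; first by move: jr; rewrite leNgt rho0.
have : ~~ (rho <= j%:R) by apply/negP => /jmin; rewrite ltnn.
by rewrite -ltNge -natr1; lra.
Qed.

Lemma straddling_glued_gt (R : rcfType) (G : sgraph) (x : G -> R) (rho th : R)
    (j : nat) (K : {set G}) :
  is_eigenvector x rho -> 0 < rho -> rho = j%:R - th -> 0 <= th -> th < 1 ->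
  is_clique K -> #|K| = (j + 2)%N -> #|K :&: pos_set x| = 1%N ->
  #|K :&: neg_set x| = (j + 1)%N -> 2 * rho * #|K|%:R + 4 < (npairs (@edge G))%:R.
Proof.
move=> ev0 rho0 rhoE th0 th1 cK Kj a1 b1.
have [v] : exists v, v \in K :&: pos_set x by apply/set0Pn; rewrite -card_gt0 a1.
move=> vI; have [vK] := setIP vI; rewrite inE => xv.
have vE : K :&: pos_set x = [set v].
  by move/eqP/cards1P: a1 => [w wE]; move: vI; rewrite wE => /set1P->.
have NE : K :&: neg_set x = K :\: pos_set x.
  apply/eqP; rewrite eqEcard; apply/andP; split.
    apply/subsetP => p; rewrite !inE oppr_gt0 => /andP[-> xp].
    by rewrite andbT -leNgt ltW.
  by rewrite b1 cardsD vE cards1 Kj addn2 addn1.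
have [c [u [c0 ev xu le1]]] := exists_top ev0 (ex_intro _ v xv).
apply: (glued_clique_gt ev rho0 rhoE th0 th1 xu le1 cK Kj vK).
  by rewrite mulr_gt0.
move=> p pK pv; rewrite pmulr_rlt0 // -oppr_gt0.
have : p \in K :\: pos_set x.
  rewrite inE pK andbT; apply: contra pv => pP.
  by rewrite -in_set1 -vE inE pK.
by rewrite -NE !inE => /andP[].
Qed.

(** The splits escaping [straddling_gt] are 1 against j + 1 for |K| = j + 2, and 2 against 1 for a
    triangle with j = 2. The triangle case relies on no maximum clique lying inside one part. *)
Lemma straddling_outcome (R : rcfType) (G : sgraph) (x : G -> R) (rho th : R)
    (j : nat) (K : {set G}) :
  is_eigenvector x rho -> 0 < rho -> rho = j%:R - th -> 0 <= th -> th < 1 ->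
  is_clique K -> ((#|K| == j + 1) || (#|K| == j + 2))%N ->
  ~~ ((#|K| == j + 1) && (j == 1))%N ->
  (0 < #|K :&: pos_set x|)%N -> (0 < #|K :&: neg_set x|)%N ->
  (forall K' : {set G}, is_clique K' -> #|K'| = #|K| -> ~~ (K' \subset pos_set x)) ->
  (forall K' : {set G}, is_clique K' -> #|K'| = #|K| -> ~~ (K' \subset neg_set x)) ->
  2 * rho * #|K|%:R + 4 < (npairs (@edge G))%:R.
Proof.
move=> ev rho0 rhoE th0 th1 cK Kj nj1 a0 b0 noP noN.
have evN := is_eigenvectorN ev.
have ab := straddling_card x K.
have NN : pos_set (fun p => - - x p) = pos_set x.
  by apply/setP => p; rewrite !inE opprK.
have [c|nc] := boolP [|| (#|K| == j + 2) && ((#|K :&: pos_set x| + #|K :&: neg_set x| < #|K|)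
    || (1 < #|K :&: pos_set x|) && (1 < #|K :&: neg_set x|)), (#|K| == j + 1) && (2 < j) |
      [&& #|K| == j + 1, j == 2 & 6 <= npairs (across (pos_set x) (neg_set x))]]%N.
  exact: (straddling_gt ev rho0 rhoE th0 th1 cK a0 b0 c).
have jj : (0 < j)%N by rewrite -(ltr0n R); lra.
case/orP: Kj => /eqP Kj; last first.
  have [h|h] : (#|K :&: pos_set x| = 1 /\ #|K :&: neg_set x| = j + 1 \/
       #|K :&: pos_set x| = j + 1 /\ #|K :&: neg_set x| = 1)%N.
    by move: nc ab a0 b0; rewrite Kj eqxx; clear; lia.
  - exact: (straddling_glued_gt ev rho0 rhoE th0 th1 cK Kj h.1 h.2).
  - by apply: (straddling_glued_gt evN rho0 rhoE th0 th1 cK Kj h.2); rewrite NN h.1.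
have j2 : j = 2%N by move: nc nj1 jj; rewrite Kj eqxx; clear; lia.
have Xlt := straddling_across x cK.
have [h|h] : (#|K :&: pos_set x| = 2 /\ #|K :&: neg_set x| = 1 \/
       #|K :&: pos_set x| = 1 /\ #|K :&: neg_set x| = 2)%N.
  move: nc ab a0 b0 Xlt; rewrite Kj j2 eqxx /=.
  set a := #|_|; set b := #|_|; set X := npairs _; move: a b X; clear => a b X.
  by case: a b => [|[|[|a]]] [|[|[|b]]] //=; lia.
all: rewrite j2 in Kj rhoE; rewrite Kj.
- by apply: (straddling_triangle_gt ev rho0 rhoE th0 th1 cK Kj h.1 h.2) => K' c3 K'3;
    apply: noP; rewrite ?Kj.
- apply: (straddling_triangle_gt evN rho0 rhoE th0 th1 cK Kj h.2); first by rewrite NN h.1.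
  by move=> K' c3 K'3; apply: noN; rewrite ?Kj.
Qed.

Lemma positive_outcome (R : realType) (G : sgraph) (x : G -> R) (rho : R) :
  connected_graph G -> is_eigenvector x rho -> 0 < rho ->
  (exists p, 0 < x p) -> (exists p, x p < 0) ->
  bound_outcome G rho (clique_number G).
Proof.
move=> cG ev rho0 xpos xneg.
have [j [th [rhoE th0 th1]]] := nat_ceil rho0.
have jj : (0 < j)%N by rewrite -(ltr0n R); lra.
have evN := is_eigenvectorN ev.
have xpos' : exists p, 0 < - x p by case: xneg => p xp; exists p; rewrite oppr_gt0.
have xneg' : exists p, - x p < 0 by case: xpos => p xp; exists p; rewrite oppr_lt0.
have NN : pos_set (fun p => - - x p) = pos_set x.
  by apply/setP => p; rewrite !inE opprK.
have [p0 p0N] : exists p, p \in neg_set x by case: xpos' => p xp; exists p; rewrite inE.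
have [q0 pq0] : exists q, within (neg_set x) p0 q.
  have := within_deg_gt0 evN rho0 p0N; rewrite deg_card => /card_gt0P[q].
  by rewrite inE; exists q.
have cK0 : is_clique [set p0; q0].
  have [e _ _] := and3P pq0.
  apply/is_cliqueP => a b; rewrite !inE => /orP[]/eqP-> /orP[]/eqP->; rewrite ?eqxx //.
  by rewrite edge_sym.
have npq : p0 != q0 by apply: contraTneq pq0 => ->; rewrite within_irr.
have om2 : (2 <= clique_number G)%N.
  by have := clique_number_ge cK0; rewrite cards2 npq.
have [K cK Kom] := exists_max_clique G.
have [omj|jom] := leqP (clique_number G) j.
  by constructor 1; apply: (clique_number_small cG ev rho0 rhoE).
have [jom3|jom3] := leqP (j + 3) (clique_number G).
  by constructor 1; rewrite -Kom; apply: (clique_number_large ev rho0 rhoE);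
    rewrite ?Kom.
have omE : (clique_number G == j + 1)%N || (clique_number G == j + 2)%N.
  by move: jom jom3; rewrite !(addn1, addn2, addn3) !ltnS [(_ <= _.+2)%N]leq_eqVlt
    => h /orP[->|h2]; rewrite ?orbT // eqn_leq -ltnS h2 h.
(* For j = 1 and clique number 2, an edge inside the negative part is itself a maximum clique, with
   the negative entries that the path case requires when j = 1. *)
have [/andP[/eqP om1 /eqP j1]|nj1] := boolP ((clique_number G == j + 1)%N && (j == 1%N)).
  have cE : #|[set p0; q0]| = clique_number G by rewrite cards2 npq om1 j1.
  have N0 p : p \in [set p0; q0] -> x p < 0.
    have [_ h1 h2] := and3P pq0.
    by rewrite !inE => /orP[]/eqP ->; [move: h1 | move: h2]; rewrite inE oppr_gt0.
  rewrite -cE; apply: (disjoint_clique_outcome cG ev rho0 rhoE) => //.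
    by rewrite cE.
  apply/pred0P => p /=; apply/negP => /andP[/N0 h]; rewrite inE => h2.
  by have := lt_trans h h2; rewrite ltxx.
have dis_ok (y : G -> R) (K' : {set G}) : is_eigenvector y rho -> (exists p, 0 < y p) ->
    is_clique K' -> #|K'| = clique_number G -> [disjoint K' & pos_set y] ->
    bound_outcome G rho (clique_number G).
  move=> evy ypos cK' K'om dK'; rewrite -K'om.
  apply: (disjoint_clique_outcome cG evy rho0 rhoE) => //; rewrite K'om //.
  by move=> om1 j1; case/negP: nj1; rewrite om1 j1.
have [/existsP[K' /and3P[cK' /eqP K'om dK']]|noP] := boolP [exists K' : {set G},
    [&& is_clique K', #|K'| == clique_number G & [disjoint K' & pos_set x]]].
  exact: (dis_ok x K').
have [/existsP[K' /and3P[cK' /eqP K'om dK']]|noN] := boolP [exists K' : {set G},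
    [&& is_clique K', #|K'| == clique_number G & [disjoint K' & neg_set x]]].
  exact: (dis_ok (fun p => - x p) K').
have a0 : (0 < #|K :&: pos_set x|)%N.
  rewrite lt0n cards_eq0 setI_eq0; apply: contra noP => h.
  by apply/existsP; exists K; rewrite cK Kom eqxx.
have b0 : (0 < #|K :&: neg_set x|)%N.
  rewrite lt0n cards_eq0 setI_eq0; apply: contra noN => h.
  by apply/existsP; exists K; rewrite cK Kom eqxx.
have pnd := pos_neg_disjoint x.
constructor 1; rewrite -Kom; rewrite -Kom in omE nj1.
apply: (straddling_outcome ev rho0 rhoE th0 th1 cK omE nj1 a0 b0) => K' cK' K'K.
  apply: contra noN => sK; apply/existsP; exists K'; rewrite cK' K'K Kom eqxx.
  exact: disjointWl sK pnd.
apply: contra noP => sK; apply/existsP; exists K'; rewrite cK' K'K Kom eqxx.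
by apply: disjointWl sK _; rewrite disjoint_sym.
Qed.

(** * The extremal graphs *)

Section TwoCliques.
Variables (R : rcfType) (G : sgraph) (K A : {set G}).
Hypotheses (cK : is_clique K) (cA : is_clique A) (dKA : [disjoint K & A]).

(** On the support of [a] the adjacency matrix acts as the all-ones matrix minus the identity. *)
Lemma clique_form (B : {set G}) (a : G -> R) : is_clique B ->
  (forall p, p \notin B -> a p = 0) ->
  \sum_p \sum_(q | edge p q) a q * a p = (\sum_p a p) ^+ 2 - \sum_p a p ^+ 2.
Proof.
move=> cB a0; rewrite expr2 mulr_suml -sumrB; apply: eq_bigr => p _.
rewrite -mulr_suml expr2 [in RHS]mulrC -mulrBl.
have [pB|pB] := boolP (p \in B); last by rewrite (a0 p pB) !mulr0.
congr (_ * _); rewrite [in RHS](bigD1 p) //= addrAC subrr add0r.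
rewrite big_mkcond [in RHS]big_mkcond; apply: eq_bigr => q _.
have [->|qp] := eqVneq q p; first by rewrite edge_irr.
have [qB|/a0 ->] := boolP (q \in B); last by rewrite if_same.
by move/is_cliqueP: cB => ->; rewrite 1?eq_sym.
Qed.

Lemma two_clique_form (a b : G -> R) (al be : R) :
  (forall p, p \notin K -> a p = 0) -> (forall p, p \notin A -> b p = 0) ->
  let w p := al * a p + be * b p in
  \sum_p \sum_(q | edge p q) w q * w p =
    al ^+ 2 * ((\sum_p a p) ^+ 2 - \sum_p a p ^+ 2) +
    be ^+ 2 * ((\sum_p b p) ^+ 2 - \sum_p b p ^+ 2) +
    2 * al * be * \sum_p \sum_(q | edge p q) b q * a p.
Proof.
move=> aK bA w; rewrite -(clique_form cK aK) -(clique_form cA bA).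
have sC : \sum_p \sum_(q | edge p q) a q * b p = \sum_p \sum_(q | edge p q) b q * a p.
  rewrite (exchange_big_dep predT) //=; apply: eq_bigr => p _.
  by apply: eq_big => [q|q _]; [rewrite edge_sym | rewrite mulrC].
have -> : 2 * al * be * \sum_p \sum_(q | edge p q) b q * a p =
    al * be * (\sum_p \sum_(q | edge p q) b q * a p) +
    al * be * \sum_p \sum_(q | edge p q) a q * b p by rewrite sC; ring.
rewrite !mulr_sumr -!big_split /=; apply: eq_bigr => p _.
rewrite !mulr_sumr -!big_split /=; apply: eq_bigr => q _.
by rewrite /w; ring.
Qed.

Variables (k o : G) (j : nat) (s : R).
Hypotheses (cardK : #|K| = (j + 1)%N) (cardA : #|A| = (j + 1)%N).

(** The indicator of [B] lowered by [s] at the end [c] of the link: the value 1 - th at the bridge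
    is the one found in the extremal case of [bridge_balanced]. For [s] = 0 it is the plain
    indicator. *)
Definition dented (B : {set G}) (c p : G) : R := (p \in B)%:R - s * (p == c)%:R.

Lemma dented_out (B : {set G}) (c p : G) : c \in B -> p \notin B -> dented B c p = 0.
Proof.
move=> cB pB; rewrite /dented (negPf pB).
by have [e|_] := eqVneq p c; [rewrite e cB in pB | rewrite mulr0 subr0].
Qed.

Lemma sum_indicator (B : {set G}) : \sum_p (p \in B)%:R = #|B|%:R :> R.
Proof.
rewrite -natr_sum -sum1_card [in RHS]big_mkcond.
by congr _%:R; apply: eq_bigr => p _; case: (p \in B).
Qed.

Lemma sum_point (c : G) : \sum_p (p == c)%:R = 1 :> R.
Proof.
rewrite (bigD1 c) //= eqxx big1 ?addr0 // => p /negPf->.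
by [].
Qed.

Lemma dented_sum (B : {set G}) c : #|B| = (j + 1)%N ->
  \sum_p dented B c p = j%:R + 1 - s.
Proof. by move=> Bj; rewrite sumrB -mulr_sumr sum_indicator sum_point Bj natrD mulr1. Qed.

Lemma dented_sqr (B : {set G}) c : #|B| = (j + 1)%N -> c \in B ->
  \sum_p dented B c p ^+ 2 = j%:R + (1 - s) ^+ 2.
Proof.
move=> Bj cB.
rewrite (eq_bigr (fun p => (p \in B)%:R + (s ^+ 2 - 2 * s) * (p == c)%:R)).
  by rewrite big_split -mulr_sumr /= sum_indicator sum_point Bj natrD; ring.
move=> p _; rewrite /dented; have [->|_] := eqVneq p c; first by rewrite cB /=; ring.
by case: (p \in B) => /=; ring.
Qed.

Hypotheses (kK : k \in K) (oA : o \in A).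
Hypothesis link : forall p q, p \in K -> q \in A -> edge p q -> p = k /\ q = o.

Lemma dented_cross : \sum_p \sum_(q | edge p q) dented A o q * dented K k p =
  (edge k o)%:R * (1 - s) ^+ 2.
Proof.
have out p q : p != k \/ q != o -> edge p q -> dented A o q * dented K k p = 0.
  move=> h e; have [pK|/(dented_out kK)->] := boolP (p \in K); last by rewrite mulr0.
  have [qA|/(dented_out oA)->] := boolP (q \in A); last by rewrite mul0r.
  by have [pk qo] := link pK qA e; move: h; rewrite pk qo !eqxx => -[].
rewrite (bigD1 k) //= [X in _ + X]big1 ?addr0; last first.
  by move=> p pk; rewrite big1 // => q; apply: out; left.
rewrite big_mkcond (bigD1 o) //= [X in _ + X]big1 ?addr0; last first.
  by move=> q qo; case: ifP => // e; apply: out => //; right.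
rewrite /dented kK oA !eqxx; case: (edge k o) => /=; ring.
Qed.

(* The span of the two dented indicators carries the form j - s: the quadratic
   equation for s balances the dents against the linking edge. *)
Lemma rho2_ge_two_cliques :
  s = 0 /\ ~~ edge k o \/ [/\ 0 < s, s < 1 & s ^+ 2 - (j%:R + 2) * s + 1 = 0] ->
  j%:R - s <= rho2 R G.
Proof.
move=> hs.
have ko : k != o by apply: contraTneq kK => ->; rewrite (disjointFl dKA oA).
have s1 : s < 1 by case: hs => [[-> _]|[]].
have G1 : (1 < #|G|)%N.
  by apply: leq_trans (max_card (mem [set k; o])); rewrite cards2 ko.
have aK p : p \notin K -> dented K k p = 0 by apply: dented_out.
have bA p : p \notin A -> dented A o p = 0 by apply: dented_out.
apply: (@rho2_ge R G (dented K k) (dented A o)) => //.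
- move=> p; have [pK|/aK->] := boolP (p \in K); last by rewrite mul0r.
  by rewrite bA ?mulr0 // (disjointFr dKA pK).
- by exists k; rewrite /dented kK eqxx; apply: lt0r_neq0; rewrite /=; lra.
- by exists o; rewrite /dented oA eqxx; apply: lt0r_neq0; rewrite /=; lra.
move=> al be; pose w p := al * dented K k p + be * dented A o p.
change ((j%:R - s) * (\sum_p w p ^+ 2) <= \sum_p \sum_(q | edge p q) w q * w p).
rewrite (two_clique_form al be aK bA) dented_cross.
rewrite !dented_sum // !dented_sqr //.
have -> : \sum_p w p ^+ 2 = (al ^+ 2 + be ^+ 2) * (j%:R + (1 - s) ^+ 2).
  rewrite mulrDl -[in X in X + _](dented_sqr cardK kK) -[in X in _ + X](dented_sqr cardA oA).
  rewrite !mulr_sumr -big_split; apply: eq_bigr => p _ /=; rewrite /w.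
  have [pK|/aK->] := boolP (p \in K); last by ring.
  by rewrite bA ?(disjointFr dKA pK) //; ring.
case: hs => [[-> /negPf->]|[s0 _ h]] /=.
  by rewrite le_eqVlt; apply/orP; left; apply/eqP; ring.
rewrite -subr_ge0.
have -> : al ^+ 2 * ((j%:R + 1 - s) ^+ 2 - (j%:R + (1 - s) ^+ 2)) +
    be ^+ 2 * ((j%:R + 1 - s) ^+ 2 - (j%:R + (1 - s) ^+ 2)) +
    2 * al * be * ((edge k o)%:R * (1 - s) ^+ 2) -
    (j%:R - s) * ((al ^+ 2 + be ^+ 2) * (j%:R + (1 - s) ^+ 2)) =
  (1 - s) ^+ 2 * (al ^+ 2 + be ^+ 2 + 2 * al * be * (edge k o)%:R) -
  (al ^+ 2 + be ^+ 2) * (1 - s) * (s ^+ 2 - (j%:R + 2) * s + 1) by ring.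
rewrite h mulr0 subr0; apply: mulr_ge0; first exact: sqr_ge0.
case: (edge k o) => /=; last by rewrite mulr0 addr0 addr_ge0 ?sqr_ge0.
by have := sqr_ge0 (al + be); rewrite sqrrD -mulr_natl; lra.
Qed.
End TwoCliques.

Lemma quad_root (R : rcfType) (j : nat) : (0 < j)%N ->
  exists tp : R, [/\ 0 < tp, tp < 1 & tp ^+ 2 - (j%:R + 2) * tp + 1 = 0].
Proof.
move=> j0.
have j1 : 1 <= j%:R :> R by rewrite (ler_nat R 1).
pose d : R := (j%:R + 2) ^+ 2 - 4.
have d0 : 0 <= d by rewrite /d expr2; nra.
have h := sqr_sqrtr d0; have h0 := sqrtr_ge0 d.
exists ((j%:R + 2 - Num.sqrt d) / 2); split.
- have : Num.sqrt d < j%:R + 2.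
    rewrite ltNge; apply/negP => hle.
    have : 0 <= (Num.sqrt d - (j%:R + 2)) * (Num.sqrt d + (j%:R + 2)).
      by apply: mulr_ge0; lra.
    by rewrite -subr_sqr h /d; lra.
  by lra.
- have : j%:R < Num.sqrt d.
    rewrite ltNge; apply/negP => hle.
    have : 0 <= (j%:R - Num.sqrt d) * (j%:R + Num.sqrt d) by apply: mulr_ge0; lra.
    by rewrite -subr_sqr h /d !expr2; lra.
  by lra.
- have e : ((j%:R + 2 - Num.sqrt d) / 2) ^+ 2 - (j%:R + 2) * ((j%:R + 2 - Num.sqrt d) / 2) + 1
    = (Num.sqrt d ^+ 2 - ((j%:R + 2) ^+ 2 - 4)) / 4 by field.
  by rewrite e h /d subrr mul0r.
Qed.

(** Two distinct roots would sum to j + 2 >= 2, so they cannot both be below 1. *)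
Lemma quad_root_uniq (R : rcfType) (j t t' : R) : 0 <= j ->
  t < 1 -> t' < 1 -> t ^+ 2 - (j + 2) * t + 1 = 0 ->
  t' ^+ 2 - (j + 2) * t' + 1 = 0 -> t = t'.
Proof.
move=> j0 t1 t1' h h'.
have /eqP : (t - t') * (t + t' - (j + 2)) = 0.
  have -> : (t - t') * (t + t' - (j + 2)) =
     (t ^+ 2 - (j + 2) * t + 1) - (t' ^+ 2 - (j + 2) * t' + 1) by ring.
  by rewrite h h' subrr.
by rewrite mulf_eq0 => /orP[/eqP|/eqP]; lra.
Qed.

(** * Edge counts and structure of the linked cliques *)

Lemma sum_neq (T : finType) (i : T) : (\sum_j (i != j) = #|T|.-1)%N.
Proof.
rewrite -(cardC1 i) -sum1_card [in RHS]big_mkcond; apply: eq_bigr => j _.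
by rewrite !inE eq_sym; case: (_ == _).
Qed.

Lemma sum_eq (T : finType) (i : T) : (\sum_j (j == i) = 1)%N.
Proof. by rewrite (bigD1 i) //= eqxx big1 ?addn0 // => j /negPf->. Qed.

Lemma sum_option (T : finType) (F : option T -> nat) :
  (\sum_x F x = F None + \sum_x F (Some x))%N.
Proof.
rewrite (bigD1 None) //=; congr addn.
rewrite (reindex_omap Some id) /=; last by case.
by apply: eq_bigl => x; rewrite eqxx.
Qed.

Lemma npairs_link_edge a b (u : 'I_a) (v : 'I_b) :
  npairs (@edge (link_edge u v)) = (a * a.-1 + b * b.-1 + 2)%N.
Proof.
rewrite /npairs /deg big_sumType /=.
have -> : (\sum_(i < a) \sum_(q : 'I_a + 'I_b) link_edge_rel u v (inl i) q =
    a * a.-1 + 1)%N.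
  under eq_bigr => i _ do rewrite big_sumType /= sum_neq card_ord.
  rewrite big_split sum_nat_const /= card_ord; congr addn.
  rewrite (bigD1 u) //= eqxx sum_eq big1 ?addn0 // => i /negPf->.
  by rewrite big1.
have -> : (\sum_(i < b) \sum_(q : 'I_a + 'I_b) link_edge_rel u v (inr i) q =
    b * b.-1 + 1)%N.
  under eq_bigr => i _ do rewrite big_sumType /= sum_neq card_ord addnC.
  rewrite big_split sum_nat_const /= card_ord; congr addn.
  rewrite (bigD1 v) //= eqxx [X in (_ + X)%N]big1 ?addn0.
    by under eq_bigr => i _ do rewrite andbT; exact: sum_eq.
  by move=> i /negPf->; rewrite big1 // => i' _; rewrite andbF.
by rewrite addnACA.
Qed.

Lemma npairs_link_path k (u v : 'I_k) :
  npairs (@edge (link_path u v)) = (k * k.-1 + k * k.-1 + 4)%N.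
Proof.
rewrite /npairs /deg sum_option big_sumType /= sum_option big_sumType /= !sum_eq add0n.
have -> : (\sum_(i < k) \sum_q link_path_rel u v (Some (inl i)) q = k * k.-1 + 1)%N.
  under eq_bigr => i _ do
    rewrite sum_option big_sumType /= sum_neq card_ord big1_eq addn0 addnC.
  by rewrite big_split sum_nat_const /= card_ord sum_eq.
have -> : (\sum_(i < k) \sum_q link_path_rel u v (Some (inr i)) q = k * k.-1 + 1)%N.
  under eq_bigr => i _ do
    rewrite sum_option big_sumType /= sum_neq card_ord big1_eq add0n addnC.
  by rewrite big_split sum_nat_const /= card_ord sum_eq.
by lia.
Qed.

Section Isomorphism.
Variables (G H : sgraph) (f : G -> H).
Hypotheses (bf : bijective f) (ef : forall x y : G, edge (f x) (f y) = edge x y).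

Lemma npairs_iso : npairs (@edge G) = npairs (@edge H).
Proof.
have sumf (F : H -> nat) : (\sum_q F q = \sum_p F (f p))%N.
  by apply: reindex; apply: onW_bij.
rewrite /npairs /deg [RHS]sumf; apply: eq_bigr => p _.
by rewrite [RHS]sumf; apply: eq_bigr => q _; rewrite ef.
Qed.

Lemma clique_preim (T : finType) (h : T -> H) :
  injective h -> (forall i j, edge (h i) (h j) = (i != j)) ->
  is_clique (f @^-1: (h @: setT)) /\ #|f @^-1: (h @: setT)| = #|T|.
Proof.
move=> ih eh; split.
  apply/is_cliqueP => p q; rewrite !inE => /imsetP[i _ pi] /imsetP[j _ qj] pq.
  rewrite -ef pi qj eh; apply: contra pq => /eqP ij.
  by rewrite -(inj_eq (bij_inj bf)) pi qj ij.
by rewrite on_card_preimset ?card_imset ?cardsT //; apply: onW_bij.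
Qed.
End Isomorphism.

Lemma linked_by_edge_structure (G : sgraph) a b : cliques_linked_by_edge G a b ->
  [/\ #|G| = (a + b)%N, npairs (@edge G) = (a * a.-1 + b * b.-1 + 2)%N &
    exists (K A : {set G}) k o, [/\ is_clique K /\ is_clique A, [disjoint K & A],
      #|K| = a /\ #|A| = b, k \in K /\ o \in A &
      forall p q, p \in K -> q \in A -> edge p q -> p = k /\ q = o]].
Proof.
move=> [u [v [f [bf ef]]]]; have injf := bij_inj bf.
split.
- by rewrite (bij_eq_card bf) card_sum !card_ord.
- by rewrite (npairs_iso bf ef) npairs_link_edge.
have [g fK gK] := bf.
have [|//|cK Kc] := @clique_preim G (link_edge u v) f bf ef 'I_a inl; first by move=> ? ? [].
have [|//|cA Ac] := @clique_preim G (link_edge u v) f bf ef 'I_b inr; first by move=> ? ? [].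
exists (f @^-1: (@inl 'I_a 'I_b @: setT)), (f @^-1: (@inr 'I_a 'I_b @: setT)).
exists (g (inl u)), (g (inr v)); split => //.
- apply/pred0P => p /=; rewrite !inE; apply/negP => /andP[/imsetP[i _ ->]].
  by case/imsetP.
- by rewrite Kc Ac !card_ord.
- by rewrite !inE !gK !imset_f.
move=> p q; rewrite !inE => /imsetP[i _ pi] /imsetP[i' _ qi].
rewrite -ef pi qi /= => /andP[/eqP iu /eqP iv].
by rewrite -iu -iv -pi -qi !fK.
Qed.

Lemma linked_by_path_structure (G : sgraph) k : cliques_linked_by_path G k ->
  [/\ #|G| = (k + k + 1)%N, npairs (@edge G) = (k * k.-1 + k * k.-1 + 4)%N &
    exists K A : {set G}, [/\ is_clique K /\ is_clique A, [disjoint K & A],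
      #|K| = k /\ #|A| = k &
      forall p q, p \in K -> q \in A -> ~~ edge p q]].
Proof.
move=> [u [v [f [bf ef]]]]; have injf := bij_inj bf.
split.
- by rewrite (bij_eq_card bf) card_option card_sum !card_ord addn1.
- by rewrite (npairs_iso bf ef) npairs_link_path.
pose hl (i : 'I_k) : link_path u v := Some (inl i).
pose hr (i : 'I_k) : link_path u v := Some (inr i).
have [|//|cK Kc] := @clique_preim G (link_path u v) f bf ef 'I_k hl; first by move=> ? ? [].
have [|//|cA Ac] := @clique_preim G (link_path u v) f bf ef 'I_k hr; first by move=> ? ? [].
exists (f @^-1: (hl @: setT)), (f @^-1: (hr @: setT)); split => //.
- apply/pred0P => p /=; rewrite !inE; apply/negP => /andP[/imsetP[i _ ->]].
  by case/imsetP.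
- by rewrite Kc Ac !card_ord.
by move=> p q; rewrite !inE => /imsetP[i _ pi] /imsetP[i' _ qi]; rewrite -ef pi qi.
Qed.

(** Dropping the end of the link from the larger clique leaves two cliques of order j + 1 without
    edges between them, whose indicators are the test vectors. *)
Lemma linked_by_edge_rho2 (R : rcfType) (G : sgraph) j :
  cliques_linked_by_edge G (j + 2) (j + 1) ->
  j%:R <= rho2 R G /\ (j + 2 <= clique_number G)%N.
Proof.
move=> /linked_by_edge_structure[_ _ [K [A [k [o [[cK cA] dKA [Kj Aj] [kK oA] link]]]]]].
split; last by rewrite -Kj clique_number_ge.
have Kk : #|K :\ k| = (j + 1)%N by move: (cardsD1 k K); rewrite kK Kj; lia.
have [k' k'K] : exists k', k' \in K :\ k by apply/card_gt0P; rewrite Kk addn1.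
have sub : K :\ k \subset K by rewrite subD1set.
have dis : [disjoint K :\ k & A] by exact: disjointWl dKA.
have none p q : p \in K :\ k -> q \in A -> ~~ edge p q.
  rewrite !inE => /andP[pk pK] qA; apply: contra pk => e.
  by have [-> _] := link p q pK qA e.
rewrite -[X in X <= _]subr0.
apply: (rho2_ge_two_cliques (clique_sub sub cK) cA dis Kk Aj k'K oA).
  by move=> p q pK qA; rewrite (negPf (none p q pK qA)).
by left; split=> //; exact: none.
Qed.

(** The two cliques are already nonadjacent once the middle vertex of the path is ignored, so their
    indicators serve as test vectors. *)
Lemma linked_by_path_rho2 (R : rcfType) (G : sgraph) j :
  cliques_linked_by_path G (j + 1) ->
  j%:R <= rho2 R G /\ (j + 1 <= clique_number G)%N.
Proof.
move=> /linked_by_path_structure[_ _ [K [A [[cK cA] dKA [Kj Aj] none]]]].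
split; last by rewrite -Kj clique_number_ge.
have [k kK] : exists k, k \in K by apply/card_gt0P; rewrite Kj addn1.
have [o oA] : exists o, o \in A by apply/card_gt0P; rewrite Aj addn1.
rewrite -[X in X <= _]subr0.
apply: (rho2_ge_two_cliques cK cA dKA Kj Aj kK oA).
  by move=> p q pK qA; rewrite (negPf (none p q pK qA)).
by left; split=> //; exact: none.
Qed.

Lemma linked_evenly_rho2 (R : rcfType) (G : sgraph) j (tp : R) :
  0 < tp -> tp < 1 -> tp ^+ 2 - (j%:R + 2) * tp + 1 = 0 ->
  cliques_linked_by_edge G (j + 1) (j + 1) ->
  j%:R - tp <= rho2 R G /\ (j + 1 <= clique_number G)%N.
Proof.
move=> t0 t1 te.
move=> /linked_by_edge_structure[_ _ [K [A [k [o [[cK cA] dKA [Kj Aj] [kK oA] link]]]]]].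
split; last by rewrite -Kj clique_number_ge.
by apply: (rho2_ge_two_cliques cK cA dKA Kj Aj kK oA link); right.
Qed.

Lemma link_edge_connected a b (u : 'I_a) (v : 'I_b) : connected_graph (link_edge u v).
Proof.
have cl i j : connect (@edge (link_edge u v)) (inl i) (inl j).
  by have [->|ij] := eqVneq i j; [exact: connect0 | exact: connect1].
have cr i j : connect (@edge (link_edge u v)) (inr i) (inr j).
  by have [->|ij] := eqVneq i j; [exact: connect0 | exact: connect1].
have uv : connect (@edge (link_edge u v)) (inl u) (inr v).
  by apply: connect1; rewrite /= !eqxx.
have vu : connect (@edge (link_edge u v)) (inr v) (inl u).
  by apply: connect1; rewrite /= !eqxx.
split; first by apply/card_gt0P; exists (inl u).
move=> [i|i] [j|j] //.
- exact: connect_trans (cl i u) (connect_trans uv (cr v j)).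
- exact: connect_trans (cr i v) (connect_trans vu (cl u j)).
Qed.

(** * Graphs whose second eigenvalue is not positive *)

Lemma connected_npairs_ge (G : sgraph) : connected_graph G -> (1 < #|G|)%N ->
  (#|G| <= npairs (@edge G))%N.
Proof.
move=> cG G1; rewrite -sum1_card /npairs; apply: leq_sum => p _.
have [||a [b [/set1P-> _ ab]]] := @connected_cut G [set p] cG.
- by exists p; rewrite inE.
- have /card_gt0P[q] : (0 < #|~: [set p]|)%N by rewrite cardsC1 -ltnS prednK // ltnW.
  by rewrite inE; exists q.
by rewrite deg_card; apply/card_gt0P; exists b; rewrite inE.
Qed.

(** Two nonadjacent vertices are two unlinked cliques of order 1, which force the second eigenvalue
    to be at least 0. *)
Lemma negative_rho2_complete (R : rcfType) (G : sgraph) : (1 < #|G|)%N ->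
  rho2 R G < 0 -> is_clique [set: G].
Proof.
move=> G1 r0; apply/is_cliqueP => p q _ _ pq; apply: contraLR r0 => npq; rewrite -leNgt.
have c1 (r : G) : is_clique [set r].
  by apply/is_cliqueP => a b /set1P-> /set1P->; rewrite eqxx.
have dpq : [disjoint [set p] & [set q]] by rewrite disjoints1 inE.
rewrite -[X in X <= _](subrr 0).
apply: (@rho2_ge_two_cliques R G _ _ (c1 p) (c1 q) dpq p q 0%N);
  rewrite ?cards1 ?set11 //; last by left.
by move=> a b /set1P-> /set1P->.
Qed.

(** By the rows, (rho + 1) x is constant, yet the eigenvector takes both signs. *)
Lemma complete_rho2 (R : rcfType) (G : sgraph) : (1 < #|G|)%N -> connected_graph G ->
  is_clique [set: G] -> rho2 R G = -1.
Proof.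
move=> G1 cG cT; have [x [ev [p xp] [q xq]]] := rho2_eigenvector R cG G1.
have row r : (rho2 R G + 1) * x r = \sum_r x r.
  rewrite (clique_row ev cT) ?inE // [X in _ + X]big_pred0 ?addr0.
    by apply: eq_bigl => r'; rewrite inE.
  by move=> r'; rewrite inE andbF.
have : (rho2 R G + 1) * (x p - x q) = 0 by rewrite mulrBr !row subrr.
move/eqP; rewrite mulf_eq0 => /orP[/eqP|/eqP]; lra.
Qed.

Lemma clique_number_le (G : sgraph) : (clique_number G <= #|G|)%N.
Proof. by apply/bigmax_leqP => S _; rewrite max_card. Qed.

Lemma nonpositive_rho2_bound (R : rcfType) (G : sgraph) : connected_graph G ->
  (4 <= #|G|)%N -> rho2 R G <= 0 ->
  2 * (`|rho2 R G| * (clique_number G)%:R) + 4 <= (npairs (@edge G))%:R /\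
  ((5 <= #|G|)%N ->
   2 * (`|rho2 R G| * (clique_number G)%:R) + 4 < (npairs (@edge G))%:R).
Proof.
move=> cG G4; have G1 : (1 < #|G|)%N by apply: leq_trans G4.
rewrite le_eqVlt => /orP[/eqP r0|r0].
  rewrite r0 normr0 mul0r mulr0 add0r; have Mn := connected_npairs_ge cG G1.
  split=> [|G5]; first by rewrite (ler_nat R 4); apply: leq_trans Mn.
  rewrite (ltr_nat R 4); exact: leq_trans Mn.
have cT := negative_rho2_complete G1 r0.
rewrite (complete_rho2 R G1 cG cT) normrN1 mul1r.
have ME : (npairs (@edge G))%:R = #|G|%:R * (#|G|%:R - 1) :> R.
  have -> : npairs (@edge G) = npairs (within [set: G]).
    by apply: eq_npairs => p q; rewrite /within !inE !andbT.
  by rewrite clique_npairs // cardsT natrM; case: #|G| G1 => // m _; rewrite -natr1 addrK.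
rewrite ME.
have om : (clique_number G)%:R <= #|G|%:R :> R by rewrite ler_nat clique_number_le.
have n4 : 4 <= #|G|%:R :> R by rewrite (ler_nat R 4).
(* n (n - 1) - (2 n + 4) = (n - 4) (n + 1): the bound is attained by K_4, hence the separate strict
   version from order 5 on. *)
split=> [|G5]; first by nra.
have : 5 <= #|G|%:R :> R by rewrite (ler_nat R 5).
by nra.
Qed.

(** * The bounds according to the parity of the order *)

Lemma rho2_outcome (R : realType) (G : sgraph) : connected_graph G -> (1 < #|G|)%N ->
  0 < rho2 R G -> bound_outcome G `|rho2 R G| (clique_number G).
Proof.
move=> cG G1 r0; have [x [ev xp xn]] := rho2_eigenvector R cG G1.
by rewrite gtr0_norm //; exact: (positive_outcome cG ev).
Qed.

(** The order identifies the index in the two equality outcomes, and its parity excludes the last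
    outcome. *)
Lemma odd_bound (R : realType) (G : sgraph) j : connected_graph G ->
  #|G| = (2 * j + 3)%N -> (0 < j)%N ->
  [\/ 2 * (`|rho2 R G| * (clique_number G)%:R) + 4 < (npairs (@edge G))%:R,
      2 * (`|rho2 R G| * (clique_number G)%:R) + 4 = (npairs (@edge G))%:R /\
        cliques_linked_by_edge G (j + 2) (j + 1) |
      2 * (`|rho2 R G| * (clique_number G)%:R) + 4 = (npairs (@edge G))%:R /\
        cliques_linked_by_path G (j + 1)].
Proof.
move=> cG Gn j0; have G5 : (5 <= #|G|)%N by lia.
have G1 : (1 < #|G|)%N by lia.
have [r0|r0] := lerP (rho2 R G) 0.
  by constructor 1; have [_] := nonpositive_rho2_bound cG (ltnW G5) r0; exact.
rewrite mulrA; case: (rho2_outcome cG G1 r0).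
- by constructor 1.
- move=> [j' [e h]]; have [Gj _ _] := linked_by_edge_structure h.
  have <- : j' = j by lia.
  by constructor 2.
- move=> [j' [e h]]; have [Gj _ _] := linked_by_path_structure h.
  have <- : j' = j by lia.
  by constructor 3.
- by move=> [j' [Gj _ _]]; lia.
Qed.

(** Parity excludes the odd families, and tp (j + 1) < 1 makes the first outcome stronger than
    needed. In the last outcome the order fixes the index, and uniqueness of the root identifies
    [tp]. *)
Lemma even_bound (R : realType) (G : sgraph) j (tp : R) : connected_graph G ->
  #|G| = (j + 1).*2 -> (0 < j)%N ->
  0 < tp -> tp < 1 -> tp ^+ 2 - (j%:R + 2) * tp + 1 = 0 ->
  2 * (`|rho2 R G| * (clique_number G)%:R) + 2 + 2 * (tp * (j%:R + 1)) <
    (npairs (@edge G))%:R \/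
  2 * (`|rho2 R G| * (clique_number G)%:R) + 2 + 2 * (tp * (j%:R + 1)) =
    (npairs (@edge G))%:R /\ cliques_linked_by_edge G (j + 1) (j + 1).
Proof.
move=> cG Gn j0 t0 t1 te.
have j1 : 1 <= j%:R :> R by rewrite (ler_nat R 1).
have tj := quad_root_bound j1 t0 t1 te.
have G4 : (4 <= #|G|)%N by lia.
have G1 : (1 < #|G|)%N by lia.
have [r0|r0] := lerP (rho2 R G) 0.
  by left; have [h _] := nonpositive_rho2_bound cG G4 r0; lra.
rewrite mulrA; case: (rho2_outcome cG G1 r0).
- by left; lra.
- by move=> [j' [e h]]; have [Gj _ _] := linked_by_edge_structure h; lia.
- by move=> [j' [e h]]; have [Gj _ _] := linked_by_path_structure h; lia.
move=> [j' [Gj _]]; have <- : j = j' by lia.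
case=> [[t' [h t0' t1' te' e]]|h]; last by left; apply: h.
by right; split=> //; rewrite e (quad_root_uniq (ltW (lt_le_trans ltr01 j1)) t1 t1' te te').
Qed.

Lemma linked_evenly_ge (R : rcfType) (G : sgraph) j (tp : R) : (0 < j)%N ->
  0 < tp -> tp < 1 -> tp ^+ 2 - (j%:R + 2) * tp + 1 = 0 ->
  cliques_linked_by_edge G (j + 1) (j + 1) ->
  (npairs (@edge G))%:R <=
    2 * (`|rho2 R G| * (clique_number G)%:R) + 2 + 2 * (tp * (j%:R + 1)).
Proof.
move=> j0 t0 t1 te h; have [_ -> _] := linked_by_edge_structure h.
have [rge omge] := linked_evenly_rho2 t0 t1 te h.
have j1 : 1 <= j%:R :> R by rewrite (ler_nat R 1).
have om : j%:R + 1 <= (clique_number G)%:R :> R by rewrite natr1 ler_nat -addn1.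
have : (j%:R - tp) * (j%:R + 1) <= `|rho2 R G| * (clique_number G)%:R.
  by apply: ler_pM; rewrite ?(le_trans rge) ?ler_norm //; lra.
by rewrite !natrD !natrM addn1 /= -!natr1; lra.
Qed.

Lemma npairs_edgeR (R : pzSemiRingType) (G : sgraph) :
  (npairs (@edge G))%:R = 2 * (nb_edges G)%:R :> R.
Proof. by rewrite npairs_edge -mul2n natrM. Qed.

Lemma odd_order (R : realType) (G : sgraph) j : connected_graph G ->
  #|G| = (2 * j + 3)%N -> (0 < j)%N ->
  `|rho2 R G| * (clique_number G)%:R <= (nb_edges G)%:R - 2 /\
  (`|rho2 R G| * (clique_number G)%:R = (nb_edges G)%:R - 2 <->
     cliques_linked_by_edge G (j + 2) (j + 1) \/ cliques_linked_by_path G (j + 1)).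
Proof.
move=> cG Gn j0; have j0' : 0 <= j%:R :> R by exact: ler0n.
have bound : `|rho2 R G| * (clique_number G)%:R <= (nb_edges G)%:R - 2.
  by case: (odd_bound R cG Gn j0) => [h|[h _]|[h _]]; rewrite npairs_edgeR in h; lra.
split=> //; split=> [e|].
  case: (odd_bound R cG Gn j0) => [h|[_ h]|[_ h]]; [|by left|by right].
  by move: h; rewrite npairs_edgeR e ltNge => /negP[]; lra.
move=> lk; apply/eqP; rewrite eq_le bound /=.
rewrite -(@ler_pM2l R 2) ?ltr0n // mulrBr -npairs_edgeR.
case: lk => h.
  have [_ -> _] := linked_by_edge_structure h.
  have [rge omge] := linked_by_edge_rho2 R h.
  have om : j%:R + 2 <= (clique_number G)%:R :> R by rewrite -natrD ler_nat.
  have : j%:R * (j%:R + 2) <= `|rho2 R G| * (clique_number G)%:R.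
    by apply: ler_pM; rewrite ?(le_trans rge) ?ler_norm //; lra.
  by rewrite !natrD !natrM addn1 addn2 /= -!natr1; lra.
have [_ -> _] := linked_by_path_structure h.
have [rge omge] := linked_by_path_rho2 R h.
have om : j%:R + 1 <= (clique_number G)%:R :> R by rewrite natr1 ler_nat -addn1.
have : j%:R * (j%:R + 1) <= `|rho2 R G| * (clique_number G)%:R.
  by apply: ler_pM; rewrite ?(le_trans rge) ?ler_norm //; lra.
by rewrite !natrD !natrM addn1 /= -!natr1; lra.
Qed.

Lemma even_order (R : realType) (G : sgraph) j : connected_graph G ->
  #|G| = (j + 1).*2 -> (0 < j)%N ->
  ((forall H : sgraph, #|H| = (j + 1).*2 -> connected_graph H ->
      `|rho2 R H| * (clique_number H)%:R - (nb_edges H)%:R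
      <= `|rho2 R G| * (clique_number G)%:R - (nb_edges G)%:R)
   <-> cliques_linked_by_edge G (j + 1) (j + 1)).
Proof.
move=> cG Gn j0; have [tp [t0 t1 te]] := quad_root R j0.
split=> [hmax|h H Hn cH].
  (* A maximizer is compared with an explicit extremal graph; the choice of the linked vertices is
     immaterial. *)
  have u : 'I_(j + 1) by rewrite addn1; exact: ord0.
  have lk : cliques_linked_by_edge (link_edge u u) (j + 1) (j + 1).
    by exists u, u, id; split=> //; exists id.
  have [Hn _ _] := linked_by_edge_structure lk.
  have := hmax (link_edge u u); rewrite Hn addnn => /(_ erefl (link_edge_connected u u)).
  have := linked_evenly_ge j0 t0 t1 te lk; rewrite npairs_edgeR.
  case: (even_bound cG Gn j0 t0 t1 te) => [|[]//].
  by rewrite npairs_edgeR ltNge => /negP h h1 h2; case: h; lra.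
have := linked_evenly_ge j0 t0 t1 te h; rewrite npairs_edgeR.
by case: (even_bound cH Hn j0 t0 t1 te) => [|[+ _]]; rewrite npairs_edgeR; lra.
Qed.

Lemma order_two (G : sgraph) : connected_graph G -> #|G| = 2%N ->
  [/\ is_clique [set: G], nb_edges G = 1%N & cliques_linked_by_edge G 1 1].
Proof.
move=> cG G2; have G1 : (1 < #|G|)%N by rewrite G2.
have /card_gt1P[p [q [_ _ pq]]] := G1.
have TE : [set: G] = [set p; q].
  by apply/esym/eqP; rewrite eqEcard subsetT cards2 pq cardsT G2.
have cov r : (r == p) || (r == q) by have := in_setT r; rewrite TE !inE.
have epq : edge p q.
  have [||a [b [/set1P-> bp ab]]] := @connected_cut G [set p] cG.
  - by exists p; rewrite inE.
  - by exists q; rewrite inE eq_sym.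
  by move: bp ab; rewrite inE; case/orP: (cov b) => /eqP ->; rewrite ?eqxx.
have cT : is_clique [set: G].
  rewrite TE; apply/is_cliqueP => a b; rewrite !inE.
  by move=> /orP[]/eqP-> /orP[]/eqP->; rewrite ?eqxx // edge_sym.
split=> //.
  have e : npairs (@edge G) = npairs (within [set: G]).
    by apply: eq_npairs => a b; rewrite /within !inE !andbT.
  by apply/double_inj; rewrite -npairs_edge e clique_npairs // cardsT G2.
rewrite -[X in cliques_linked_by_edge _ X _](cards1 p) -[X in cliques_linked_by_edge _ _ X](cards1 q).
have c1 (r : G) : is_clique [set r].
  by apply/is_cliqueP => a b /set1P-> /set1P->; rewrite eqxx.
apply: (link_edge_recognition _ _ (c1 p) (c1 q) (set11 p) (set11 q)).
- by rewrite disjoints1 inE.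
- by move=> r; rewrite !inE.
- by move=> a b /set1P-> /set1P->; rewrite !eqxx.
Qed.

Theorem theorem1p8 (R : realType) (n : nat) (G : sgraph)
    (hn : #|G| = n) (hG : connected_graph G) :
  ((5 <= n)%N -> odd n ->
     `|rho2 R G| * (clique_number G)%:R <= (nb_edges G)%:R - 2
     /\ (`|rho2 R G| * (clique_number G)%:R = (nb_edges G)%:R - 2 <->
           cliques_linked_by_edge G (n + 1)./2 (n - 1)./2
           \/ cliques_linked_by_path G (n - 1)./2))
  /\
  ((2 <= n)%N -> ~~ odd n ->
     ((forall H : sgraph, #|H| = n -> connected_graph H ->
         `|rho2 R H| * (clique_number H)%:R - (nb_edges H)%:R
         <= `|rho2 R G| * (clique_number G)%:R - (nb_edges G)%:R)
      <-> cliques_linked_by_edge G n./2 n./2)).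
Proof.
split=> n2 on.
  have [j [j0 nj]] : exists j, (0 < j)%N /\ n = (2 * j + 3)%N.
    by exists (n./2 - 1)%N; split; lia.
  have -> : (n + 1)./2 = (j + 2)%N by lia.
  have -> : (n - 1)./2 = (j + 1)%N by lia.
  by apply: odd_order => //; rewrite hn.
have [j nj] : exists j, n = (j + 1).*2 by exists (n./2 - 1)%N; lia.
have -> : n./2 = (j + 1)%N by lia.
(* For n = 2 the quadratic equation has the double root 1, so [even_order] does not apply; but then
   every connected graph is K_2, and both sides of the equivalence hold. *)
have [j0|j0] := posnP j; last by rewrite nj in hn *; apply: even_order.
have value (H : sgraph) : #|H| = n -> connected_graph H ->
    `|rho2 R H| * (clique_number H)%:R - (nb_edges H)%:R = 1.
  rewrite nj j0 => H2 cH; have [cT e _] := order_two cH H2.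
  rewrite (complete_rho2 R _ cH cT) ?H2 // normrN1 mul1r e.
  have -> : clique_number H = 2%N; last by lra.
  move: (clique_number_le H) (clique_number_ge cT); rewrite cardsT H2 => le2 ge2.
  by apply: anti_leq; rewrite le2.
split=> [_|_ H Hn cH]; last by rewrite !value.
by rewrite j0; have [] := order_two hG _; rewrite // hn nj j0.
Qed.
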